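(* Let $$P(x) = x^{17} - 5x^{16} + 12x^{15} - 28x^{14} + 72x^{13} - 132x^{12} + 116x^{11} - 74x^9 + 90x^8 - 28x^7 - 12x^6 + 24x^5 - 12x^4 - 4x^3 - 3x - 1\in\mathbb{Q}[x].$$ Then the Galois group of $P$ over $\mathbb{Q}$ is isomorphic, as a permutation group, to $\mathrm{SL}_2(\mathbb{F}_{16})$ with its natural action on $\mathbb{P}^1(\mathbb{F}_{16})$. That is, if $L$ is a splitting field of $P$ over $\mathbb{Q}$ and $\Omega(P)\subset L$ is the set of roots of $P$, then there exist a group isomorphism $\phi:\mathrm{Gal}(L/\mathbb{Q})\to\mathrm{SL}_2(\mathbb{F}_{16})$ and a bijection $b:\Omega(P)\to\mathbb{P}^1(\mathbb{F}_{16})$ such that $b(\sigma(r))=\phi(\sigma)\cdot b(r)$ for all $\sigma\in\mathrm{Gal}(L/\mathbb{Q})$ and all $r\in\Omega(P)$.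
   Context: The Galois group of a polynomial $f\in\mathbb{Q}[x]$ means the Galois group of a splitting field of $f$ over $\mathbb{Q}$ together with its natural action on the roots of $f$ in this splitting field. $\mathbb{F}_{16}$ is the field with 16 elements, $\mathbb{P}^1(\mathbb{F}_{16})$ is the set of one-dimensional subspaces of $\mathbb{F}_{16}^2$ (it has 17 elements), and $\mathrm{SL}_2(\mathbb{F}_{16})$ acts on it through its linear action on $\mathbb{F}_{16}^2$; this action is faithful because $\mathbb{F}_{16}$ has characteristic 2. *)

(* Defs.v *)
From HB Require Import structures.
From mathcomp Require Import all_boot all_order all_fingroup all_algebra.
From mathcomp Require Import all_solvable all_field.

Set Implicit Arguments.
Unset Strict Implicit.
Unset Printing Implicit Defensive.

Import GRing.Theory.
Local Open Scope ring_scope.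

Definition P : {poly rat} :=
  'X^17 - 5 *: 'X^16 + 12 *: 'X^15 - 28 *: 'X^14 + 72 *: 'X^13
  - 132 *: 'X^12 + 116 *: 'X^11 - 74 *: 'X^9 + 90 *: 'X^8 - 28 *: 'X^7
  - 12 *: 'X^6 + 24 *: 'X^5 - 12 *: 'X^4 - 4 *: 'X^3 - 3 *: 'X - 1.

Section GaloisActionOnRoots.
Variable L : splittingFieldType rat.

(* The product of [gal_of] is in diagrammatic order ([galM]), whereas Galois
   groups are taken here with the usual composition of maps. *)
Definition gal_comp (s t : gal_of {:L}) : gal_of {:L} := (t * s)%g.

Lemma gal_compE (s t : gal_of {:L}) : gal_comp s t =1 s \o t.
Proof. by move=> x; rewrite /gal_comp galM ?memvf. Qed.

Variable p : {poly rat}.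

Definition roots_in : Type := {r : L | root (map_poly (in_alg L) p) r}.

Lemma gal_root (s : gal_of {:L}) (r : L) :
  root (map_poly (in_alg L) p) r -> root (map_poly (in_alg L) p) (s r).
Proof.
suff -> : root (map_poly (in_alg L) p) (s r) =
          root (map_poly s (map_poly (in_alg L) p)) (s r).
  by rewrite fmorph_root.
congr (root _ _); rewrite -map_poly_comp; apply: eq_map_poly => a /=.
by rewrite linearZ /= rmorph1.
Qed.

Definition gal_act (s : gal_of {:L}) (r : roots_in) : roots_in :=
  exist _ (s (val r)) (gal_root s (valP r)).

End GaloisActionOnRoots.

Section ProjectiveLine.
Variable F : finFieldType.

Definition SL2 : {set {'GL_2[F]}} := [set g : {'GL_2[F]} | \det (GLval g) == 1].

Lemma SL2_group_set : group_set SL2.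
Proof.
apply/group_setP; split=> [|g h]; rewrite !inE ?GL_1E ?det1 //.
by move=> /eqP dg /eqP dh; rewrite GL_MxE det_mulmx dg dh mulr1.
Qed.

Canonical SL2_group := group SL2_group_set.

Definition projective_line : Type := {U : {vspace 'cV[F]_2} | \dim U == 1%N}.

Definition GL2_lin (g : {'GL_2[F]}) : 'End('cV[F]_2) :=
  linfun (mulmx (GLval g : 'M[F]_2)).

Lemma GL2_lin_dim (g : {'GL_2[F]}) (U : {vspace 'cV[F]_2}) :
  \dim U == 1%N -> \dim (GL2_lin g @: U)%VS == 1%N.
Proof.
rewrite limg_dim_eq //; apply/eqP; rewrite -subv0 (subv_trans (capvSr _ _)) //.
rewrite subv0; apply/lker0P => x y; rewrite !lfunE /=.
by apply: (can_inj (mulKmx (GL_unitmx g))).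
Qed.

Definition GL2_act (g : {'GL_2[F]}) (l : projective_line) : projective_line :=
  exist _ (GL2_lin g @: val l)%VS (GL2_lin_dim g (valP l)).

End ProjectiveLine.

(* Main.v *)
From Stdlib Require Import ZArith Lia Classical_Prop.
From HB Require Import structures.
Require Import Defs.
From mathcomp Require Import all_boot all_order all_fingroup all_algebra.
From mathcomp Require Import all_solvable all_field mpoly ssrZ ring.

Delimit Scope Z_scope with Z.
Set Implicit Arguments.
Unset Strict Implicit.
Unset Printing Implicit Defensive.

Import Order.TTheory GRing.Theory Num.Theory.

(** Let G be the Galois group of P, acting on the 17 complex roots. The points
    of the projective line over F16 are labelled by 0, ..., 16, where a label
    below 16 is the binary code of a field element and 16 is the point at
    infinity. The two inclusions between G and SL2(F16) are proved separately.

    UPPER BOUND. P splits modulo a certain prime p slightly above 2 ^ 72, and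
    [roots_mod_p] lists the roots mod p so that the i-th root carries the label
    i. By the fundamental theorem of symmetric functions the complex roots can
    be numbered compatibly with the roots mod p: every integral polynomial
    relation between the former also holds for the latter ([specialization]).
    Two invariants, known mod p by computation, then bound G.

    The first invariant is geometric. The images of the projective line over
    F4 are the 68 circles ([blocks]) of the inversive plane of order 4, five
    points each, any three points on exactly one. The products of the roots
    over the blocks are the roots of an integral polynomial Q of degree 68, and
    Q has a factor A(x, Y) of degree 20 over Q[x]/(P), whose roots belong to
    the 20 blocks through the root x. The factorization is one identity between
    integral polynomials ([factorization]), so it holds in characteristic 0
    too, and counting roots transports the incidence relation from p to the
    complex numbers ([incidenceP]). Four roots are concyclic exactly when the
    four corresponding specializations of A have a common factor, a condition
    that the Galois group preserves ([concyclic_gal]). A search shows that only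
    the powers of the Frobenius map preserve concyclicity and fix infinity, 0
    and 1; as SL2(F16) is 3-transitive, every element of G is an element of
    SL2(F16) times a power of Frobenius ([gal_semilinear]).

    The second invariant removes the Frobenius factor. The sum [cr_sum] over
    all quadruples of roots of a given cross-ratio is fixed by SL2(F16), while
    Frobenius permutes cyclically the sums for the cross-ratios 2, 4, 3, 5.
    If h1 and h2 are fixed or exchanged by G, then (h1 - n)(h2 - n) is an
    integer for every integer n; when h1 = n mod p, this integer is divisible
    by p and, if the roots are small compared to p, it is 0. So h1 = n in
    characteristic 0 as well, and G cannot move h1 to h2 if they differ mod p
    ([conjugate_pair]). This is used first for the sums grouped in two pairs,
    then inside a pair ([gal_in_SL2]).

    LOWER BOUND. For a prime q modulo which P is separable, some element of G
    acts on the complex roots as x -> x ^ q acts on the roots mod q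
    ([gal_frobenius]). At 5 this gives a 17-cycle, at 7 an element with two
    fixed points and a cycle of length 15. Together they generate a triply
    transitive group ([transitive3]). An element of SL2(F16) is determined by
    the images of three points, so it agrees everywhere with the element of G
    that has the same three images ([SL2_gal]). *)

(** * Permutation groups of degree 17 *)

Section Transitivity.
Local Open Scope group_scope.
Variables (T : finType).
Implicit Types (c d h : {perm T}) (x y : T).

Lemma porbit_dvd c n x : c ^+ n = 1 -> #|porbit c x| %| n.
Proof.
move=> /eqP; rewrite -order_dvdn; apply: dvdn_trans.
by rewrite porbitE dvdn_orbit.
Qed.

Lemma expg_porbit c n x : #|porbit c x| %| n -> (c ^+ n) x = x.
Proof.
case/dvdnP=> m ->; rewrite mulnC expgM permX; elim: m => // m IHm.
by rewrite iterS IHm permX; apply: iter_porbit.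
Qed.

Variables (G : {group {perm T}}) (c d : {perm T}) (x0 x1 : T).
Hypotheses (cG : c \in G) (dG : d \in G).
Hypotheses (card_T : #|T| = 17%N) (c17 : c ^+ 17 = 1) (c_move : forall x, c x != x).
Hypotheses (ne_x01 : x0 != x1) (dx0 : d x0 = x0) (dx1 : d x1 = x1).
Hypotheses (d15 : d ^+ 15 = 1).
Hypothesis d_move : forall x, x != x0 -> x != x1 -> (d ^+ 3) x != x /\ (d ^+ 5) x != x.

Lemma porbit_c x : porbit c x = [set: T].
Proof.
apply/eqP; rewrite eqEcard subsetT cardsT card_T.
have /primeP[_ /(_ _ (porbit_dvd x c17))/orP[/eqP cx1 | /eqP -> //]] : prime 17 by [].
by have /eqP[] := c_move x; rewrite -[c]expg1 expg_porbit // cx1.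
Qed.

Lemma porbit_d x : x != x0 -> x != x1 -> porbit d x = ~: [set x0; x1].
Proof.
move=> xx0 xx1; have fix_d y m : d y = y -> (d ^+ m) y = y.
  by move=> dy; rewrite permX; elim: m => //= m ->.
have fixed y : d y = y -> x != y -> y \notin porbit d x.
  move=> dy ne_xy; rewrite porbit_sym; apply/porbitP => -[m].
  by rewrite fix_d // => /eqP; rewrite (negPf ne_xy).
apply/eqP; rewrite eqEcard; apply/andP; split.
  apply/subsetP=> y; apply: contraTT; rewrite !inE negbK.
  by case/orP=> /eqP ->; apply: fixed.
have -> : #|~: [set x0; x1]| = 15.
  by have := cardsC [set x0; x1]; rewrite cards2 ne_x01 card_T => -[].
have [d3 d5] := d_move xx0 xx1.
have := porbit_dvd x d15; rewrite dvdn_divisors // (_ : divisors 15 = [:: 1; 3; 5; 15]%N) // !inE.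
case/or4P=> /eqP Dn; rewrite Dn //.
- by case/eqP: d3; rewrite expg_porbit // Dn.
- by case/eqP: d3; rewrite expg_porbit // Dn.
- by case/eqP: d5; rewrite expg_porbit // Dn.
Qed.

Lemma transitive_G x y : exists2 h, h \in G & h x = y.
Proof.
have: y \in porbit c x by rewrite porbit_c inE.
by case/porbitP=> m ->; exists (c ^+ m); rewrite ?groupX.
Qed.

Lemma fix2_transitive x y : x != x0 -> x != x1 -> y != x0 -> y != x1 ->
  exists2 h, h \in G & [/\ h x0 = x0, h x1 = x1 & h x = y].
Proof.
move=> xx0 xx1 yx0 yx1.
have: y \in porbit d x by rewrite porbit_d // !inE negb_or yx0.
case/porbitP=> m ->; exists (d ^+ m); rewrite ?groupX //; split=> //.
  by rewrite permX; elim: m => //= m ->.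
by rewrite permX; elim: m => //= m ->.
Qed.

(** A power g of the 17-cycle moves x0 to x1, so the conjugate of d by g fixes
    x0. It moves x1, as otherwise g x1 would be fixed by d, hence g would
    exchange x0 and x1, which is impossible for an element of odd order. *)
Lemma fix1_transitive y : y != x0 -> exists2 h, h \in G & h x0 = x0 /\ h x1 = y.
Proof.
move=> yx0; have [-> | yx1] := eqVneq y x1.
  by exists 1; rewrite ?group1 ?perm1.
have: x1 \in porbit c x0 by rewrite porbit_c inE.
case/porbitP=> k Dx1; pose g := c ^+ k; have gx0 : g x0 = x1 by [].
have gx1_x1 : g x1 != x1 by rewrite -{2}gx0 (inj_eq perm_inj) eq_sym.
have gx1_x0 : g x1 != x0.
  apply: contra_neq ne_x01 => gx1.
  (* As g ^ 17 = 1, g is a power of g ^ 2 and fixes x0 with it. *)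
  have g9 : (g ^+ 2) ^+ 9 = g.
    have g17 : g ^+ 17 = 1 by rewrite -expgM mulnC expgM c17 expg1n.
    by rewrite -expgM (expgD g 17 1) g17 mul1g.
  have g2x0 : (g ^+ 2) x0 = x0 by rewrite permM gx0.
  by rewrite -gx0 -[in RHS]g9 permX; elim: (9) => //= n <-.
pose h := g * d * g^-1.
have hx0 : h x0 = x0 by rewrite !permM gx0 dx1 -gx0 permK.
have hG : h \in G by rewrite !groupM ?groupV ?groupX.
have hx1_x1 : h x1 != x1.
  have [d3 _] := d_move gx1_x0 gx1_x1; apply: contra_neq d3 => hx1.
  suff dg : d (g x1) = g x1 by rewrite permX /= !dg.
  by rewrite -{2}hx1 !permM permKV.
have hx1_x0 : h x1 != x0 by rewrite -[X in _ != X]hx0 (inj_eq perm_inj) eq_sym.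
have [r rG [rx0 rx1 rh]] := fix2_transitive hx1_x0 hx1_x1 yx0 yx1.
exists (h * r); first exact: groupM.
by rewrite [(h * r) x0]permM [(h * r) x1]permM hx0 rx0 rh.
Qed.

(** The 17-cycle c makes the group transitive, [fix1_transitive] makes the
    stabilizer of x0 transitive on the rest, and the powers of the 15-cycle d
    do the same for the stabilizer of x0 and x1. *)
Lemma transitive3 x2 y0 y1 y2 : x2 != x0 -> x2 != x1 ->
    y0 != y1 -> y0 != y2 -> y1 != y2 ->
  exists2 h, h \in G & [/\ h x0 = y0, h x1 = y1 & h x2 = y2].
Proof.
move=> x20 x21 y01 y02 y12; have [a aG ax0] := transitive_G x0 y0.
have [|b bG [bx0 bx1]] := @fix1_transitive (a^-1 y1).
  by rewrite -(inj_eq (@perm_inj _ a)) permKV ax0 eq_sym.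
have [|||| r rG [rx0 rx1 rx2]] := @fix2_transitive x2 (b^-1 (a^-1 y2)) => //.
- by rewrite -(inj_eq (@perm_inj _ b)) permKV bx0 -(inj_eq (@perm_inj _ a)) permKV ax0 eq_sym.
- by rewrite -(inj_eq (@perm_inj _ b)) permKV bx1 (inj_eq (@perm_inj _ _)) eq_sym.
exists (r * b * a); rewrite ?groupM //.
by rewrite !permM rx0 rx1 rx2 bx0 bx1 ax0 !permKV.
Qed.

End Transitivity.

(** * Labels of the projective line over F16 *)

(** The coordinates of an element of F16 over F2 in the basis 1, z, z^2, z^3,
    where z ^ 4 = z + 1. *)
Definition bits := (bool * bool * bool * bool)%type.
Definition bits_of (u : nat) : bits :=
  (odd u, odd u./2, odd u./2./2, odd u./2./2./2).
Definition code_of (b : bits) : nat :=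
  let: (b0, b1, b2, b3) := b in b0 + (b1 + (b2 + b3.*2).*2).*2.
Definition bits_add (a b : bits) : bits :=
  let: (a0, a1, a2, a3) := a in let: (b0, b1, b2, b3) := b in
  (a0 (+) b0, a1 (+) b1, a2 (+) b2, a3 (+) b3).
Definition bits_mul (a b : bits) : bits :=
  let: (a0, a1, a2, a3) := a in let: (b0, b1, b2, b3) := b in
  let c4 := (a1 && b3) (+) ((a2 && b2) (+) (a3 && b1)) in
  let c5 := (a2 && b3) (+) (a3 && b2) in
  let c6 := a3 && b3 in
  ((a0 && b0) (+) c4,
   ((a0 && b1) (+) (a1 && b0)) (+) (c4 (+) c5),
   ((a0 && b2) (+) ((a1 && b1) (+) (a2 && b0))) (+) (c5 (+) c6),
   ((a0 && b3) (+) ((a1 && b2) (+) ((a2 && b1) (+) (a3 && b0)))) (+) c6).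

Definition codes := iota 0 16.
Definition add_table := Eval vm_compute in
  [seq [seq code_of (bits_add (bits_of u) (bits_of v)) | v <- codes] | u <- codes].
Definition mul_table := Eval vm_compute in
  [seq [seq code_of (bits_mul (bits_of u) (bits_of v)) | v <- codes] | u <- codes].
Definition tab (t : seq (seq nat)) (u v : nat) : nat := nth 0 (nth [::] t u) v.
Definition cadd := tab add_table.
Definition cmul := tab mul_table.
Definition inv_table := Eval vm_compute in
  [seq (index 1 [seq cmul u v | v <- codes]) %% 16 | u <- codes].
Definition cinv u := nth 0 inv_table u.

(** The determinant of the vectors (i, 1) and (j, 1), where the point 16 is
    represented by the vector (1, 0). *)
Definition br (i j : nat) : nat :=
  if i == 16 then (j != 16 : nat) else if j == 16 then 1 else cadd i j.
Definition ratio (i j k : nat) : nat := cmul (br i k) (cinv (br j k)).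
(** The cross-ratio of i, j, k, l is lam. *)
Definition has_cr (lam i j k l : nat) : bool :=
  [&& i != j, ratio i j k != 0 & ratio i j k == cmul lam (ratio i j l)].
(** The codes 6 and 7 are the elements of F4 outside F2: a cross-ratio lies in
    F4 exactly when the four points lie on one image of the line over F4. *)
Definition concyclic i j k l := has_cr 6 i j k l || has_cr 7 i j k l.

Definition points := iota 0 17.
Definition triples (n : nat) : seq (nat * nat * nat) :=
  [seq (ab, c) | ab <- [seq (a, b) | a <- iota 0 n, b <- iota 0 a],
                 c <- iota 0 ab.2].
(** The order in which the search places the points, chosen so that each new
    point is strongly constrained by the previous ones. *)
Definition pt_order := [:: 16; 0; 1; 6; 7; 2; 12; 14; 3; 4; 5; 8; 9; 10; 11; 13; 15].
Definition compatible (l : seq nat) (v : nat) :=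
  let x := nth 0 pt_order (size l) in
  all (fun abc : (nat * nat * nat)%type => let: (a, b, c) := abc in
     concyclic (nth 0 pt_order a) (nth 0 pt_order b) (nth 0 pt_order c) x ==
     concyclic (nth 0 l a) (nth 0 l b) (nth 0 l c) v) (triples (size l)).
Definition extend (l : seq nat) : seq (seq nat) :=
  [seq rcons l v | v <- points & (v \notin l) && compatible l v].
Definition frob (i : nat) := if i == 16 then 16 else cmul i i.
(** The list starts with the images of infinity, 0 and 1, which are fixed, and
    is extended by one point at each of the 14 rounds. *)
Definition search := iter 14 (fun ls => flatten (map extend ls)) [:: [:: 16; 0; 1]].
Definition search_check : bool :=
  all (fun l => l \in [seq map (iter c frob) pt_order | c <- iota 0 4]) search.

Definition codes_check : bool :=
  all (fun u => [&& cinv u < 16, (u == 0) || (cmul u (cinv u) == 1),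
    code_of (bits_of u) == u & all (fun v =>
      [&& cadd u v < 16, cmul u v < 16,
          bits_of (cadd u v) == bits_add (bits_of u) (bits_of v),
          bits_of (cmul u v) == bits_mul (bits_of u) (bits_of v) &
          (cadd u v == 0) == (u == v)]) codes]) codes.

Lemma codes_checkT : codes_check. Proof. by vm_cast_no_check (erefl true). Qed.
Lemma search_checkT : search_check. Proof. by vm_cast_no_check (erefl true). Qed.

(** * Certificates *)

(** The images of the projective line over F4, listed in the order that
    [block_roots] and all indices below 68 refer to. *)
Definition blocks : seq (seq nat) :=
  [:: [:: 1; 7; 8; 9; 13]; [:: 3; 6; 11; 14; 16]; [:: 0; 1; 5; 9; 15]; [:: 3; 4;
  8; 9; 11]; [:: 0; 3; 4; 6; 13]; [:: 0; 5; 8; 13; 16]; [:: 3; 4; 12; 14; 15];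
  [:: 5; 8; 11; 12; 14]; [:: 2; 3; 7; 11; 13]; [:: 4; 9; 10; 13; 15]; [:: 3; 6;
  7; 9; 15]; [:: 1; 5; 10; 14; 16]; [:: 0; 2; 4; 7; 9]; [:: 3; 5; 9; 12; 13];
  [:: 1; 3; 4; 7; 10]; [:: 8; 9; 14; 15; 16]; [:: 1; 6; 12; 13; 14]; [:: 1; 2;
  3; 9; 14]; [:: 2; 5; 13; 14; 15]; [:: 0; 2; 5; 6; 11]; [:: 0; 6; 10; 14; 15];
  [:: 0; 4; 11; 15; 16]; [:: 0; 1; 6; 7; 16]; [:: 0; 1; 3; 11; 12]; [:: 5; 6; 7;
  10; 13]; [:: 3; 5; 10; 11; 15]; [:: 0; 4; 5; 10; 12]; [:: 1; 2; 5; 7; 12]; [::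
  1; 2; 4; 6; 15]; [:: 2; 9; 11; 12; 15]; [:: 1; 2; 8; 11; 16]; [:: 0; 7; 8; 10;
  11]; [:: 10; 11; 12; 13; 16]; [:: 4; 5; 6; 9; 14]; [:: 4; 7; 13; 14; 16]; [::
  1; 7; 11; 14; 15]; [:: 0; 9; 11; 13; 14]; [:: 3; 7; 8; 12; 16]; [:: 4; 6; 8;
  10; 16]; [:: 5; 7; 9; 11; 16]; [:: 1; 3; 5; 6; 8]; [:: 2; 4; 8; 12; 13]; [::
  0; 2; 12; 14; 16]; [:: 0; 1; 4; 8; 14]; [:: 1; 6; 9; 10; 11]; [:: 2; 3; 4; 5;
  16]; [:: 0; 3; 5; 7; 14]; [:: 0; 1; 2; 10; 13]; [:: 2; 6; 9; 13; 16]; [:: 0;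
  3; 9; 10; 16]; [:: 0; 7; 12; 13; 15]; [:: 2; 6; 7; 8; 14]; [:: 1; 4; 5; 11;
  13]; [:: 4; 5; 7; 8; 15]; [:: 1; 4; 9; 12; 16]; [:: 1; 3; 13; 15; 16]; [:: 0;
  6; 8; 9; 12]; [:: 4; 6; 7; 11; 12]; [:: 6; 8; 11; 13; 15]; [:: 2; 3; 6; 10;
  12]; [:: 7; 9; 10; 12; 14]; [:: 2; 7; 10; 15; 16]; [:: 5; 6; 12; 15; 16]; [::
  2; 4; 10; 11; 14]; [:: 1; 8; 10; 12; 15]; [:: 3; 8; 10; 13; 14]; [:: 0; 2; 3;
  8; 15]; [:: 2; 5; 8; 9; 10]].

(** The lists of blocks and of ratios are filtered progressively, so that no
    search is repeated in the inner loops. *)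
Definition blocks_check : bool :=
  all (fun i => let Bi := [seq B <- blocks | i \in (B : seq nat)] in
  all (fun j => let Bij := [seq B <- Bi | j \in (B : seq nat)] in
    let r := [seq ratio i j k | k <- points] in
    (j == i) || all (fun k => let Bijk := [seq B <- Bij | k \in (B : seq nat)] in
      let rk := nth 0 r k in
      [|| k == i, k == j | all (fun l => let rl := nth 0 r l in
        [|| l == i, l == j, l == k |
        has (fun B => l \in (B : seq nat)) Bijk ==
        ([&& i != j, rk != 0 & rk == cmul 6 rl] || [&& i != j, rk != 0 & rk == cmul 7 rl])]) points])
    points) points) points.

Lemma blocks_checkT : blocks_check. Proof. by vm_cast_no_check (erefl true). Qed.

Local Open Scope Z_scope.

Definition P_coefs : seq Z :=
  [:: -1; -3; 0; -4; -12; 24; -12; -28; 90; -74; 0; 116; -132; 72; -28; 12; -5;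
  1].

(** 17180134177 * 2 ^ 38 + 1, a prime of Proth form for which P splits. *)
Definition big_prime : Z := 4722439323590840025089.

Definition roots_mod_p : seq Z :=
  [:: 3222681908709875357357; 778823693912882825304; 2115658249902605357300;
  2795981854174118606401; 2664305234989615552475; 436093161758499932593;
  139800225692105220857; 1552241876264024518957; 1349135314564591018455;
  2306961661934206802390; 3373499370140532854591; 4093558567723986714067;
  2928977299963026246430; 10169344911146526672; 4212725415794571398334;
  1895972917096766078859; 3902928491194165189675].

Definition Q_coefs : seq Z :=
  [:: 1; 28; 278; -388; -10591; 16952; 362444; -2165300; 4396844; -692968;
  -25251476; 124337324; -293565324; 447354488; -1193184636; 602877108;
  5040397500; -23757404408; 83888516964; -218030237036; 465891189556;
  -1054245161000; 2083141411468; -3521531231732; 5247429907700; -6514348569352;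
  6915371267772; -7234563464372; 6557003048796; -3158231015528; 4507141509668;
  -26523945378668; 65281042935454; -77923330259968; 26342408042960;
  57667651506668; -87876346928522; 21381066525864; 89692772739204;
  -157950159851772; 150818156786132; -101684955174968; 55283969542852;
  -28494034669084; 15677715885228; -8448478223256; 3805741709356;
  -1205204577988; 94901279180; 97227819896; -40250139812; 23775070460;
  -16334241868; 13649998152; -6662605020; 319939876; -237941236; -45855192;
  236020500; -32415196; -15484; -758392; 449836; 12668; -4391; -1692; 90; 8; 1].

(** Polynomials in two variables are lists, by increasing degree in Y, of lists
    of coefficients in x. [A_coefs] is the factor A of Q described at the top,
    multiplied by the common denominator 4422, and [H_coefs] is the cofactor. *)
Definition A_coefs : seq (seq Z) :=
  [:: [:: 0; 0; 0; 0; 0; 0; 0; 0; 0; 0; 0; 0; 0; 0; 0; 4422]; [:: -20127;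
  -70668; -36939; -102357; -295188; 331602; -76701; -585759; 1523940; -720696;
  -336957; 2159553; -1587432; 660642; -238197; 109317; -43185]; [:: 79889;
  288253; 170384; 401367; 1179996; -1222311; 142836; 2367509; -5677958; 2341857;
  1682244; -8238373; 5405752; -2128861; 793038; -419931; 132193]; [:: -58878;
  -230013; -191310; -358200; -1000422; 659865; 48396; -1932858; 4019532;
  -930747; -1719510; 6354744; -3135726; 1143849; -443712; 310158; -38832]; [::
  -122696; -402931; -157061; -570576; -1474680; 2106543; -920925; -2240936;
  7620074; -5160567; 502443; 8713870; -7189798; 3497011; -1318293; 414510;
  -302134]; [:: 292670; 1092049; 918770; 1861806; 4176135; -2778279; 1766346;
  3774044; -16463315; 6391329; -5966040; -16767916; 11297275; -6638359; 2426508;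
  -778794; 566395]; [:: -419476; -1609136; -1153870; -2219817; -6706599;
  6944376; 886980; -16497079; 33166573; -15512502; -16256244; 51399359;
  -23511719; 11744426; -5167050; 1785561; -672119]; [:: -493552; -451442;
  2667923; -1557513; 1009914; 20483142; -21308121; 8132477; 27630262; -63001608;
  30336639; -7159141; -16531328; 4969340; -937053; 1586865; -542756]; [::
  587902; -41461; -2133599; 9313644; -2415750; -15541011; 60862869; -67432166;
  5216882; 107720823; -196787511; 152806126; -55383856; 20091073; -10786035;
  3061140; 102878]; [:: -3540512; -8560501; 3975586; -13979352; -24406935;
  79856091; -77632740; 7653604; 156274943; -224731989; 212174100; -119745494;
  42555029; -14461421; 6633954; -1449174; -380533]; [:: 4060; -3654766;
  -7079912; 11292735; -12611061; -33298512; 104815752; -102785147; -57053557;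
  300599208; -369097386; 218635615; -88050061; 34911310; -15269178; 3812541;
  -37825]; [:: -588322; -5590034; -11026243; 6711183; -2622864; -26194728;
  80505309; -37015303; -51018110; 118953972; 67192305; -162784765; 100003354;
  -35846086; 15992865; -7990683; 1737766]; [:: -824040; -4975227; -12179025;
  -12267906; 21363306; -21398733; -31937673; 211282590; -276348732; 53050065;
  434244399; -518000604; 280379220; -107889129; 47219103; -19903764; 3906882];
  [:: 4673098; 10172465; -14866064; 6894000; 32800239; -112429047; 79404300;
  75502270; -247063399; 156866289; 12877614; -55380050; 28046579; -11390231;
  6822870; -2787888; 440411]; [:: 71496; 5574006; 5091564; -21936465; 37567281;
  -1558482; -110821974; 196563093; -101654883; -155180376; 294904206;
  -219852105; 102369201; -41859288; 17955348; -5787051; 841341]; [:: 2207030;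
  2095396; -1484245; 19288503; -19244292; -13354500; 71345403; -123949939;
  71294212; 55992582; -211678377; 210428603; -110803814; 43241258; -18362169;
  7296417; -1397348]; [:: -1241844; -27153; 2808549; -11585802; 10979220;
  12580629; -54010311; 69695568; -12687312; -71819157; 120971853; -95861568;
  47164722; -18872871; 7811121; -2740500; 468582]; [:: -180749; -906481;
  1351987; 1252491; -6744807; 10329249; 2664807; -29348339; 38205563; -2135637;
  -45211281; 47033503; -24118039; 9487273; -4255155; 1658535; -296680]; [::
  -10833; -546897; -278286; 2404980; -3669921; 1089837; 10399878; -18681240;
  9877329; 14059545; -27439452; 20708688; -9702165; 3961209; -1698798; 553776;
  -81942]; [:: -77130; -87603; -86721; -468033; 716604; -494163; -756927;
  3131067; -3675804; 1570233; 3576555; -4905021; 2754774; -1056969; 463329;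
  -202353; 41346]; [:: 4422]].

Definition H_coefs : seq (seq Z) :=
  [:: [:: -9599069766; -7677233190; 18247223808; -80967191448; 66651231768;
  85768510608; -318812668680; 459145475448; -169029667620; -345835041948;
  804797632320; -721188631944; 369235779528; -145541781264; 61073568600;
  -23121063768; 4255144674]; [:: -93206319792; -32742568503; 102842083554;
  -674414007540; 712198250151; 374898237993; -2290213808676; 3773140569834;
  -1876166505543; -2017966304763; 5870131223478; -5498003021544; 2848026281793;
  -1120956107253; 473600520000; -182662284342; 34131442905]; [:: 554511106942;
  477486306611; -1115015213888; 4768709221521; -3797874982056; -5326959477537;
  19072122809484; -27080834798537; 9575564025896; 21061589012373;
  -48062303164896; 42876459758341; -21925117561996; 8643592337803;
  -3624497414088; 1369417100751; -251606258284]; [:: 700385976985;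
  -200825531125; 27907810813; 3855276296724; -6038596994025; 2115699316281;
  8495586605115; -20918640851708; 16617054499397; 652505393523; -23051011728279;
  25025148469024; -13422887296027; 5260198919227; -2266107295641; 919909884864;
  -178797277684]; [:: -3772835914925; -2734937449222; 6666159604786;
  -30975712755471; 26513869247019; 30590304133818; -119426169946314;
  175047047853799; -67595963511505; -126303865960668; 301761150623262;
  -272050821832163; 139523127603299; -54983193693626; 23092583258118;
  -8766185454213; 1617120951710]; [:: -2980330318500; -1982720799387;
  4834808912346; -23869463265009; 21296299554108; 21756604608345;
  -90380434834416; 135434363252187; -55037259552000; -93508500046215;
  230323368420846; -209036958792321; 107394134283150; -42309191670561;
  17788895240112; -6772797767961; 1252360873956]; [:: -25930702926699;
  -13653535384857; 36513768464268; -200939480323128; 192823159236663;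
  153641649068727; -729102943640778; 1134360362458584; -504245419977321;
  -711192249114603; 1862278586251008; -1710404944206552; 881381573787231;
  -347119652966037; 146247773432034; -55950955707948; 10384296237792]; [::
  44408954268434; 46518496527331; -101773548211543; 403044621638001;
  -294376337212746; -506620511116683; 1675530590554797; -2310776608043587;
  746365511233606; 1925714391625407; -4234406699776347; 3745516133957081;
  -1910679834620348; 753358971565559; -315482304613539; 118753424259933;
  -21748326546332]; [:: 103839581155292; 45978880726924; -131802622473802;
  780482707670898; -783096602367072; -525468066920784; 2753164088727744;
  -4383784667659354; 2043760705581892; 2573066447520018; -7018326516190410;
  6496502987933750; -3354912153355004; 1321041301604000; -557178840228168;
  213855333964938; -39802068368618]; [:: 504687615339726; 298304642221671;
  -788047973899734; 4003500458926434; -3676260401495115; -3425544944595711;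
  14902114085132754; -22568355840215640; 9444516406122831; 15085354137634227;
  -37752243095871426; 34345231146939570; -17653909488889113; 6956072527604247;
  -2926481873073258; 1114935735486564; -206231279425107]; [:: 744150012492292;
  31345069644575; -397790945682698; 4718138341003293; -5992717365445260;
  -410412514048851; 13557803021327700; -25952723655938021; 16165168628632232;
  8291880033759501; -35417026483952346; 35042971777007557; -18407458046762620;
  7231017554281417; -3077759906532288; 1212509213191335; -230469648481714]; [::
  42583215528825; -421250296136481; 733768887412281; -907677483630048;
  -973078221119547; 4661124736651143; -7545585289143771; 5703931374595596;
  3145197106103679; -13222123991236953; 18156795168500997; -13720521539340264;
  6667350317680635; -2644914500380275; 1075674841697001; -371128334084964;
  62741996654298]; [:: -371613017419807; -1117134681605480; 2266960930895708;
  -5275377554569809; 1056301675760571; 12738422484698142; -28308415624417638;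
  30366272891780501; -380677439290313; -40691559367389882; 68387411016433392;
  -55900169457252241; 27877069629360391; -11032501351860286; 4555886920194234;
  -1647804245554563; 291681707693296]; [:: -2906274060422338; -2277508250397485;
  5031268366168598; -23932833918525183; 20371647166068342; 23669481759174201;
  -92294536078526790; 136462291423266977; -54119158014496586;
  -96907026249965841; 236900429242417554; -215042922950935915;
  110501138746495024; -43507994120835205; 18287144139828642; -6967647707746887;
  1289336326820164]; [:: -2368335376734625; -1072568179756541; 3595287317938562;
  -18370231080340956; 17591416130265231; 14605509118470957; -67601286003384306;
  102295738749030104; -41967553512827657; -68405615235029883;
  166605077439307230; -150162078328952008; 76988187805550395;
  -30386204792580103; 12770664184921842; -4839181917422904; 891252561458662];
  [:: -784972503320434; 267881788613791; -588566198552563; -4990339275970455;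
  8579973735617064; -4808099462265429; -9765569586633729; 31342195181032901;
  -30461573601703112; 3134428419825219; 38133548409662673; -43273411532092291;
  23272938669453550; -9072896647694935; 3957623966236479; -1625905120743255;
  315798995048350]; [:: 2548137916289178; 1472273681004084; -2865989572123584;
  22275541185544428; -23295337561340904; -12665950681006764; 80392267544314428;
  -138377098177517508; 75310947271532280; 75759746139911448;
  -230275055198347008; 216163948966446756; -111621191780533248;
  43893848056073508; -18635163434286612; 7180269159489828; -1332917350281996];
  [:: 2766191290130980; -1204198124111242; -1236787268863640; 11709207117826308;
  -17090173136034402; 2849135810477730; 22727409148457352; -40415054451037664;
  21448884684162386; -771759490646850; -21089506608618432; 25133183964906292;
  -14370052878604390; 5679382656961174; -2342895450046368; 994354769986920;
  -210805581302746]; [:: -15911078173776292; -13116257850138746;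
  32743312615238240; -131278370733021306; 100869105589287960;
  156537657530622186; -526771188163564836; 717255291520042322;
  -221908392464177936; -584096572801012950; 1272688255746170976;
  -1126221489338427658; 575545224204824632; -226972420125326254;
  94860792350516292; -35749110613440726; 6570387038696752]; [::
  -10678674156118502; 3766342661479142; 841159464550858; -69707535865483776;
  105220659588318126; -30159533326360650; -179617479690725982;
  416122152075256216; -310054352218099654; -85331164765702266;
  529973627374607778; -531789935715642560; 278488401214534610;
  -109677267440445350; 47183522395137354; -18544962731839080; 3488441440143416];
  [:: 29613128846352874; 13103705367686900; -47895254864526908;
  248684496675458970; -239419855638975174; -193057418034719184;
  935383332759580392; -1442470965329208050; 620345398689149738;
  976518377571599352; -2387512855826271540; 2140583246347611802;
  -1093298724242598478; 431842296481377640; -181917763435502664;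
  68614766498153070; -12542304890934772]; [:: -9568318742571012;
  -10577181129323922; 40841667521459664; -123639527893730130; 80581555483673580;
  187654290983754834; -586717585037412360; 739774165944405390;
  -155602562615179812; -775181134324822746; 1387400581415652264;
  -1128772998773537898; 558954540297827256; -222571305552335682;
  92644302904791864; -33080317890308610; 5734950434311800]; [::
  -33063953625444890; -15879718666069090; 26931319926545296;
  -228405884747161752; 240070323895991154; 116041057025281578;
  -741213433963283376; 1291137438038413552; -714172512489816358;
  -595948469496083766; 2065595131198137672; -2011384001968622336;
  1053366712635234074; -412680107780108798; 174922825821463032;
  -68777483859080064; 13065097192143944]; [:: 32461289227074368;
  25628474008251670; -53612804508242566; 281770834547742774;
  -245057642877449304; -259374237748712322; 1077887776871324262;
  -1660255287785348554; 735542661330529888; 1116621076115354862;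
  -2903404724177387406; 2664170305997630078; -1370762208860988020;
  539260769130817442; -227466066405712410; 87006021684832686;
  -16111286562192488]; [:: 8743030135578520; -805310366106064; 3377703723516580;
  15078604258571736; -34313019896997480; 26743640238601908; -23941188963163332;
  9715061731086016; 6900053068952648; -119706888261965700; 155116265031717156;
  -91189513480867736; 35585869078549592; -14815669077149276; 6548470725830076;
  -1519673826344832; 54159208092356]; [:: -29565967195859368;
  -21683481126912566; 37405950682874792; -198053602224256776;
  171388881766415202; 189377616635226498; -714980157195422484;
  1054359743619717092; -407202349295621594; -685731841941921294;
  1785935867138384832; -1671775634698914976; 870633843160329358;
  -341542735251824530; 143159865025736580; -55614370811335692;
  10533852278624206]; [:: 14407509301511952; 15903438691186590;
  -19097332984378524; 99287422130527518; -74539243504090320;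
  -113013607940032674; 367528072202177340; -537720841514568390;
  213256707641682144; 339223174482771978; -949178110200580284;
  910398438432568998; -477720357634482072; 186718472963006694;
  -78341723981418204; 30844349329394154; -5912253013360500]; [::
  -4592367689830230; -6129236192276946; 1787556872165490; -29058586287663576;
  26559846804740658; 16030703237827530; -81960895511050770; 163622212618782792;
  -118038915739381626; -18210427829402418; 253329417780054282;
  -285425805589427184; 155688861001296678; -60154531845391290;
  25642837886944038; -10728158831902944; 2152336838648076]; [::
  2710749289051118; 3025231581614680; -797362115963584; 20676302608973934;
  -22457681610390726; -3654511611624216; 57083378872008336; -126564394506788446;
  98268336752728186; 18370170089979060; -195359623508095560; 212049253833756614;
  -113928628128636662; 44237452216027952; -18971998512362496; 7781412070801242;
  -1525590759087224]; [:: -216223760451256; -183219008847230; -1770705077773336;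
  -2131793900329062; 5733846731571912; -9175404560495166; 2249633680441908;
  23109436145749010; -36169815502789760; 16003169661231018; 33741966730500144;
  -45580736173067590; 25231942644746596; -9694067316016618; 4309746398768676;
  -1861656207536214; 372878756112952]; [:: 1732129017285746; 758839187223382;
  -1794169206634252; 14218776832614096; -15201620957338686; -7031981238746034;
  50566089090490704; -88350008405706064; 47568799661106394; 49517708404469178;
  -147575447265878628; 137964015428465600; -71169459727229534;
  28001896939146998; -11881700846314488; 4569550699318872; -847174185683972];
  [:: -839121691361288; -565621437183250; 1663219442491858; -7874079995665866;
  7146494247843252; 7073191895206242; -31663546458761598; 48343934102539222;
  -20610124554491956; -34370471134832202; 82431692543324730; -73388640734616218;
  37357717154456072; -14760298888218194; 6222228196081122; -2336887339405434;
  424646511535556]; [:: -38840717271274; -60572813975534; -113434041640192;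
  68149522138284; -240505800388848; 202402037802588; 545311241091756;
  -841334809097908; 464322990269644; 505756991795172; 506567180858496;
  -1264621511054044; 805312387916344; -288913485076180; 120194617896348;
  -62811461848716; 14940191153050]; [:: -96283057641588; -94113063043551;
  268081744578774; -866734171267152; 586995819071259; 1300197146607093;
  -3889977550759332; 4726411443098742; -560399854234539; -5395861184744931;
  9413856555419946; -7744606299283788; 3871033995412485; -1535804801318049;
  635275862808096; -230072284649202; 40821511621281]; [:: -96035998065210;
  -39080015580537; 116362254186528; -768425228226231; 833419396451856;
  316807603572375; -2508245071244040; 4429809816020439; -2585462302571544;
  -1878315797483583; 6566248491426240; -6299361851929179; 3275449341281172;
  -1288116150091389; 547712762181348; -212859982022745; 39872659208604]; [::
  -28628219707987; -3187366855793; 11457732115481; -152683078948020;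
  199562136540699; 2251865935089; -375744628505373; 745886689769732;
  -516130261076639; -34679611279737; 784204040041173; -871021243174720;
  474152091707305; -185083596254965; 78868731049359; -32551107064440;
  6484149735676]; [:: 33444221300675; 32251489219762; -62429526779062;
  278073808937589; -218395260136293; -313212879768042; 1098994526376258;
  -1575191016168181; 572556877376935; 1191740965937220; -2826949028333610;
  2560275275815433; -1316150633420117; 517818223970642; -217237636355166;
  82823839807959; -15357579932714]; [:: 15769687657576; 5442113714381;
  -18514321075274; 111417636832707; -118653787560072; -57961928814699;
  367522932704184; -606450046889705; 303631293152132; 307822133960961;
  -910144202402742; 854803572965419; -443418112102438; 174600065813731;
  -73742618893224; 28472010231003; -5330702997244]; [:: -2760568500411;
  -3253331218245; 6336634335972; -24158461165200; 16378728678231;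
  33686888723391; -103443250173990; 137117640922008; -34429981866225;
  -130299410731359; 268645738393656; -234855984648648; 119568134517447;
  -47131946430285; 19663824520710; -7375631628084; 1349649015192]; [::
  -60022057746; 284509806855; -449175097539; -87040665927; 1928182362306;
  -4231182133971; 3970990235757; 1035958602861; -7764934068870; 10511425961427;
  -7820289456951; 3918587212617; -1633484736048; 661036450119; -223073676483;
  44169160725; -3017067996]; [:: -37566106244; -108269535196; -60338376026;
  186662428470; -295318014072; -5048414820; 1049507172900; -1178157918950;
  -57922766572; 2338420946322; -2274191259354; 951300738850; -282866420188;
  137840321980; -56482953300; 494923446; 4011745622]; [:: 36828460122;
  28325761647; -5351674098; 305460053094; -391356406455; -16722718467;
  996853287234; -2100725068044; 1502998333419; 578111153787; -3170000297502;
  3222967893486; -1698381383061; 664289105979; -284697356826; 113359077864;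
  -21610233435]; [:: 2543447372; 3238025155; 5172760742; -9248118747;
  5715967836; 21417930261; -73627816560; 70158617099; 6796966264; -130937494359;
  147698829462; -82448974795; 33036469972; -14099697295; 5795441340;
  -1260771825; 50138566]; [:: -444289283; -132750925; 70962037; -5458305000;
  7375056489; 286808655; -19825774227; 38457046732; -22857848101; -21733247157;
  67641959697; -63246749192; 32508336575; -12789721715; 5453090289; -2091982428;
  384775322]; [:: -137877263; -116686480; -60236060; -588471069; 1048235019;
  -643548486; -823884810; 3971712073; -4779534001; 2808545574; 3182775384;
  -5190866549; 3015557039; -1152849458; 506354790; -229346199; 48465224]; [::
  -1150150; -189173; -122206; 67502949; -92897694; 35812485; 213866898;
  -454038835; 355087018; 114481095; -613606050; 593367665; -304704884;
  120226607; -52204998; 20043357; -3626396]; [:: 1252143; 863655; -148662;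
  5760684; -6079185; -1214619; 17409474; -31210152; 20134191; 8322561;
  -47445306; 49643880; -26505501; 10305393; -4393050; 1781376; -346338]; [::
  112506; 87603; 86721; 468033; -716604; 494163; 756927; -3131067; 3675804;
  -1570233; -3576555; 4905021; -2754774; 1056969; -463329; 202353; -41346]; [::
  4422]].

Local Close Scope Z_scope.

Section ListPoly.
Local Open Scope Z_scope.

Fixpoint padd (s t : seq Z) : seq Z :=
  match s, t with
  | [::], _ => t
  | _, [::] => s
  | a :: s', b :: t' => a + b :: padd s' t'
  end.

Definition pscale (c : Z) (s : seq Z) : seq Z := [seq c * a | a <- s].

Fixpoint pmul (s t : seq Z) : seq Z :=
  if s is a :: s' then padd (pscale a t) (0 :: pmul s' t) else [::].

(** Multiplication by the variable modulo the monic polynomial whose lower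
    coefficients are m. *)
Definition pmulx (m s : seq Z) : seq Z :=
  if (size s < size m)%N then 0 :: s
  else padd (0 :: take (size m).-1 s) (pscale (- last 0 s) m).

Definition preduce (m : seq Z) : seq Z -> seq Z :=
  foldr (fun c s => padd [:: c] (pmulx m s)) [::].

Fixpoint yadd (s t : seq (seq Z)) : seq (seq Z) :=
  match s, t with
  | [::], _ => t
  | _, [::] => s
  | a :: s', b :: t' => padd a b :: yadd s' t'
  end.

Fixpoint ymul (s t : seq (seq Z)) : seq (seq Z) :=
  if s is a :: s' then yadd [seq pmul a b | b <- t] ([::] :: ymul s' t) else [::].

End ListPoly.

Definition P_low : seq Z := take 17 P_coefs.

(** All coefficients in Y of A * H - 4422 ^ 2 * Q vanish modulo P. *)
Definition factor_check : bool :=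
  all (all (Z.eqb 0)) [seq preduce P_low s | s <-
    yadd (ymul A_coefs H_coefs) [seq [:: (- (4422 * 4422) * c)%Z] | c <- Q_coefs]].
Lemma factor_checkT : factor_check. Proof. by vm_cast_no_check (erefl true). Qed.

Section Reduction.
Local Open Scope Z_scope.
(** Barrett reduction: the large constant is 2 ^ 160 divided by the prime,
    rounded down. The result need not be the least residue. *)
Definition redp (z : Z) : Z :=
  z - big_prime * Z.shiftr (Z.shiftr z 72 * 309480236205472069265905964) 88.
(** The multiples of the prime that can remain after [redp]. *)
Definition is_zero_mod (z : Z) : bool :=
  [|| z =? 0, z =? big_prime, z =? - big_prime | z =? big_prime + big_prime].
Fixpoint powers (n : nat) (x y : Z) : seq Z :=
  if n is n'.+1 then y :: powers n' x (redp (x * y)) else [::].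
Fixpoint dotp (s t : seq Z) : Z :=
  match s, t with a :: s', b :: t' => a * b + dotp s' t' | _, _ => 0 end.
Definition prodp (a : seq Z) (B : seq nat) : Z :=
  (foldr (fun i v => redp (nth 0 a i * v)) 1 B) mod big_prime.
Fixpoint powp (x : Z) (n : positive) : Z :=
  match n with
  | xH => x
  | xO n' => let y := powp x n' in redp (y * y)
  | xI n' => let y := powp x n' in redp (x * redp (y * y))
  end.

Definition block_roots : seq Z := map (prodp roots_mod_p) blocks.

Definition roots_check : bool :=
  all (fun x => is_zero_mod (redp (dotp P_coefs (powers 18 x 1)))) roots_mod_p.
Definition distinct_check : bool :=
  let s := roots_mod_p ++ block_roots in
  all (fun x => (0 <=? x) && (x <? big_prime)) s && uniq s.
Definition coefs_at (s : seq (seq Z)) (x : Z) : seq Z :=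
  let px := powers 17 x 1 in [seq redp (dotp c px) | c <- s].
Definition block_powers : seq (seq nat * seq Z) :=
  [seq (Bb.1, powers 21 Bb.2 1) | Bb <- zip blocks block_roots].
Definition incident (i : nat) (Ai : seq Z) (Bb : seq nat * seq Z) : bool :=
  if i \in Bb.1 then is_zero_mod (redp (dotp Ai Bb.2)) else true.
Definition incidence_check : bool :=
  let b := block_powers in
  all (fun i => all (incident i (coefs_at A_coefs (nth 0 roots_mod_p i))) b)
    (iota 0 17).
Definition regular_check : bool :=
  all (fun i => count (fun B : seq nat => i \in B) blocks == 20%N) (iota 0 17).
(** 3 ^ ((N - 1) / 2) = -1 mod N, Proth's condition. *)
Definition power_check : bool := is_zero_mod (powp 3 (17180134177 * 2 ^ 37) + 1).
End Reduction.

Lemma roots_checkT : roots_check. Proof. by vm_cast_no_check (erefl true). Qed.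
Lemma distinct_checkT : distinct_check. Proof. by vm_cast_no_check (erefl true). Qed.
Lemma incidence_checkT : incidence_check. Proof. by vm_cast_no_check (erefl true). Qed.
Lemma regular_checkT : regular_check. Proof. by vm_cast_no_check (erefl true). Qed.
Lemma power_checkT : power_check. Proof. by vm_cast_no_check (erefl true). Qed.

Definition zsum (f : nat -> Z) : Z := foldr (fun i s => (f i + s)%Z) 0%Z points.
Definition root_products : seq (seq Z) :=
  [seq [seq redp (a * b)%Z | b <- roots_mod_p] | a <- roots_mod_p].
(** The sum [cr_sum] below, evaluated at the roots mod p, with common factors
    taken out of the inner sums. *)
Definition cr_sum_mod (lam : nat) : Z :=
  let w := root_products in
  zsum (fun i => zsum (fun j =>
    if i == j then 0%Z else
    let r := [seq ratio i j k | k <- points] in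
    let c := nth 0%Z (nth [::] w i) j in
    (redp (c * c) * zsum (fun k =>
      let rk := nth 0%N r k in
      if rk == 0%N then 0%Z else
      let wk := nth [::] w k in
      zsum (fun l => if rk == cmul lam (nth 0%N r l) then nth 0%Z wk l else 0%Z)))%Z)).
Definition cr_sum_check : bool :=
  all (fun c : nat * Z => is_zero_mod (redp (cr_sum_mod c.1 - c.2)%Z))
    [:: (2, (-40)%Z); (4, (-632)%Z); (3, (-408)%Z); (5, 472%Z)].

Lemma cr_sum_checkT : cr_sum_check. Proof. by vm_cast_no_check (erefl true). Qed.

Section ModQ.
Local Open Scope Z_scope.
Variable q : nat.
Definition modq (s : seq Z) : seq Z := [seq c mod (Z.of_nat q) | c <- s].
Definition mulx_mod (s : seq Z) : seq Z := modq (pmulx (modq P_low) s).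
(** x ^ (q i) modulo P, for i < 17: since (s(x)) ^ q = s(x ^ q) mod q, raising
    a residue to the power q is a linear combination of these rows. *)
Definition frob_table : seq (seq Z) := traject (iter q mulx_mod) [:: 1] 17.
Definition frob_mod (s : seq Z) : seq Z :=
  modq (foldr padd [::] [seq pscale ct.1 ct.2 | ct <- zip s frob_table]).
Definition frob_iter (n : nat) : seq Z := iter n frob_mod [:: 0; 1].
Definition vanishes (s : seq Z) : bool := all (Z.eqb 0) (modq s).
Fixpoint pderiv (s : seq Z) : seq Z :=
  if s is c :: s' then padd s' (0 :: pderiv s') else [::].
Definition bezout (u s v t w : seq Z) : bool :=
  vanishes (padd (padd (pmul u s) (pmul v t)) (pscale (-1) w)).
End ModQ.

Definition minus_X (s : seq Z) : seq Z := padd s [:: 0; -1]%Z.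

Definition separable_check (q : nat) (u v : seq Z) : bool :=
  bezout q u (pderiv P_coefs) v P_coefs [:: 1%Z].
Definition period_check (q n : nat) : bool := vanishes q (minus_X (frob_iter q n)).
Definition fixed_check (q n : nat) (u v w : seq Z) : bool :=
  bezout q u (minus_X (frob_iter q n)) v P_coefs w.

Definition ints : seq nat -> seq Z := map Z.of_nat.

Lemma separable5 : separable_check 5
  (ints [:: 2; 3; 1; 1; 1; 2; 4; 1; 3; 3; 2; 2; 3; 2; 2; 2; 3])
  (ints [:: 3; 2; 2; 2; 1; 2; 4; 0; 0; 3; 1; 4; 2; 3; 1; 4]).
Proof. by vm_cast_no_check (erefl true). Qed.

Lemma separable7 : separable_check 7
  (ints [:: 2; 6; 5; 3; 6; 4; 3; 1; 3; 5; 1; 2; 1; 2; 2; 5; 3])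
  (ints [:: 0; 3; 1; 2; 3; 1; 6; 6; 6; 4; 2; 4; 4; 1; 5; 5]).
Proof. by vm_cast_no_check (erefl true). Qed.

Lemma period5 : period_check 5 17. Proof. by vm_cast_no_check (erefl true). Qed.
Lemma period7 : period_check 7 15. Proof. by vm_cast_no_check (erefl true). Qed.

Lemma fixed5 : fixed_check 5 1
  (ints [:: 2; 2; 4; 2; 3; 3; 1; 2; 1; 2; 2; 0; 3; 2; 3; 0; 4])
  (ints [:: 4; 1; 0; 0; 1]) [:: 1%Z].
Proof. by vm_cast_no_check (erefl true). Qed.

(** 15 - 8 X + X ^ 2 = (X - 3)(X - 5): modulo 7, the only roots of P fixed by
    the third or fifth power of Frobenius are 3 and 5. *)
Lemma fixed7_3 : fixed_check 7 3
  (ints [:: 3; 6; 0; 6; 2; 5; 0; 3; 1; 6; 4; 3; 5; 6; 3])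
  (ints [:: 1; 4; 6; 3; 5; 6; 4; 6; 2; 2; 5; 1; 1; 3]) [:: 15; -8; 1]%Z.
Proof. by vm_cast_no_check (erefl true). Qed.

Lemma fixed7_5 : fixed_check 7 5
  (ints [:: 3; 6; 1; 6; 3; 2; 4; 6; 6; 2; 3; 2; 5; 0; 3])
  (ints [:: 2; 2; 4; 5; 5; 3; 0; 5; 2; 1; 2; 5; 2; 3]) [:: 15; -8; 1]%Z.
Proof. by vm_cast_no_check (erefl true). Qed.

Local Open Scope ring_scope.

(** * Specialization of the roots of an integer polynomial *)

Lemma mmap_comp_mpoly (n k : nat) (R S : comNzRingType) (f : {rmorphism R -> S})
    (g : 'I_k -> S) (t : {mpoly R[n]}) (lq : n.-tuple {mpoly R[k]}) :
  mmap f g (t \mPo lq) = mmap f (fun i => mmap f g (tnth lq i)) t.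
Proof.
rewrite comp_mpolyEX raddf_sum /= [in RHS](mpolyE t) raddf_sum /=.
apply: eq_bigr => m _; rewrite !mmapZ mmapX comp_mpolyX; congr (_ * _).
by rewrite rmorph_prod; apply: eq_bigr => i _; rewrite rmorphXn.
Qed.

Lemma eq_mmap (n : nat) (R S : nzRingType) (f : R -> S) (g h : 'I_n -> S) :
  g =1 h -> mmap f g =1 mmap f h.
Proof.
by move=> gh t; apply: eq_bigr => m _; congr (_ * _); apply: mmap1_eq.
Qed.

Section Specialization.
Variable n : nat.

(** Evaluation of an integral polynomial in n variables in any commutative
    ring; [specializes u v] means that u_i -> v_i defines a ring morphism on
    the subring generated by the u_i. *)
Definition int_eval (K : comNzRingType) (u : 'I_n -> K) : {mpoly int[n]} -> K :=
  mmap intr u.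

HB.instance Definition _ (K : comNzRingType) (u : 'I_n -> K) :=
  GRing.RMorphism.copy (int_eval u) (mmap intr u).

Definition specializes (C K : comNzRingType) (u : 'I_n -> C) (v : 'I_n -> K) :=
  forall h : {mpoly int[n]}, int_eval u h = 0 -> int_eval v h = 0.

(** Evaluation of polynomials whose coefficients involve an extra variable,
    used to pack finitely many polynomials h_s into the single one
    H = sum 'X^s * h_s. *)
Definition poly_eval (K : comNzRingType) (u : 'I_n -> K) :
    {mpoly {poly int}[n]} -> {poly K} :=
  mmap (map_poly intr) (fun i => (u i)%:P).

HB.instance Definition _ (K : comNzRingType) (u : 'I_n -> K) :=
  GRing.RMorphism.copy (poly_eval u) (mmap (map_poly intr) (fun i => (u i)%:P)).

Lemma poly_eval_mesym (K : idomainType) (u : 'I_n -> K) (f : {poly int}) (i : nat) :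
    (i <= n)%N ->
    map_poly intr f = \prod_(j < n) ('X - (u j)%:P) ->
  poly_eval u (mesym n _ i) = map_poly intr ((-1) ^+ i * f`_(n - i))%:P.
Proof.
move=> le_i_n Df.
have Du: tnth [tuple u j | j < n] =1 u by move=> j; rewrite tnth_mktuple.
have:= mroots_coeff [tuple u j | j < n] (Ordinal (n:=n.+1) le_i_n).
rewrite big_tuple (eq_bigr (fun j => 'X - (u j)%:P)) => [|j _]; last first.
  by rewrite Du.
rewrite -Df coef_map /= => /(congr1 (fun x => (-1) ^+ i * x)).
rewrite mulrA -exprMn mulrNN mulr1 expr1n mul1r => Di.
rewrite map_polyC /= intrM rmorphXn rmorphN1 /= Di /poly_eval.
rewrite (raddf_sum (meval _)) raddf_sum rmorph_sum /=; apply: eq_bigr => h _.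
rewrite !rmorph_prod /=; apply: eq_bigr => j _.
by rewrite mmapX mmap1U mevalXU Du.
Qed.

Lemma poly_eval_sym (K : idomainType) (u : 'I_n -> K) (f : {poly int})
    (t : {mpoly {poly int}[n]}) :
    map_poly intr f = \prod_(j < n) ('X - (u j)%:P) ->
  poly_eval u (t \mPo [tuple mesym n _ i.+1 | i < n]) =
  map_poly intr (mmap idfun
    (fun i : 'I_n => ((-1) ^+ i.+1 * f`_(n - i.+1))%:P) t).
Proof.
move=> Df; rewrite /poly_eval mmap_comp_mpoly [in RHS]/mmap rmorph_sum /=.
rewrite /mmap; apply: eq_bigr => m _; rewrite rmorphM /=; congr (_ * _).
rewrite /mmap1 rmorph_prod /=; apply: eq_bigr => i _.
rewrite rmorphXn tnth_mktuple; congr (_ ^+ _).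
exact: poly_eval_mesym.
Qed.

Lemma poly_eval_msym (K : comNzRingType) (u : 'I_n -> K) s h :
  poly_eval u (msym s h) = poly_eval (u \o s) h.
Proof.
rewrite (mpolyE h) (raddf_sum (msym s)) !(raddf_sum (poly_eval _)) /=.
apply: eq_bigr => m _; rewrite msymZ msymX /poly_eval !mmapZ !mmapX; congr (_ * _).
rewrite /mmap1 (reindex_inj (@perm_inj _ s)) /=; apply: eq_bigr => i _.
by rewrite mnmE permK.
Qed.

Lemma poly_eval_map (K : comNzRingType) (u : 'I_n -> K) h :
  poly_eval u (map_mpoly polyC h) = (int_eval u h)%:P.
Proof.
rewrite (mpolyE h) [map_mpoly _ _]raddf_sum [LHS]raddf_sum.
rewrite [int_eval _ _]raddf_sum rmorph_sum /=; apply: eq_bigr => m _.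
rewrite map_mpolyZ map_mpolyX /poly_eval /int_eval !mmapZ !mmapX.
rewrite /= map_polyC rmorphM; congr (_ * _).
by rewrite /mmap1 rmorph_prod; apply: eq_bigr => i _; rewrite rmorphXn.
Qed.

Lemma int_eval_msym (K : comNzRingType) (u : 'I_n -> K) s h :
  int_eval u (msym s h) = int_eval (u \o s) h.
Proof.
apply: (@polyC_inj K); rewrite -!poly_eval_map -poly_eval_msym; congr (poly_eval u _).
rewrite (mpolyE h) [msym _ _]raddf_sum ![map_mpoly _ _]raddf_sum.
rewrite [msym _ _]raddf_sum /=.
apply: eq_bigr => m _.
by rewrite msymZ map_mpolyZ msymX !map_mpolyX map_mpolyZ msymZ map_mpolyX msymX.
Qed.

(** If no numbering of the u_i works, each permutation s violates some relation
    h_s of the permuted u_i. Pack the h_s into one polynomial H; the product of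
    the conjugates of H under all permutations is symmetric, hence its values at
    u and at v come from the same integral polynomial. The value at u is 0 as
    the factor of the identity vanishes, but at v no factor vanishes. *)
Theorem specialization (C K : idomainType) (f : {poly int})
    (u : 'I_n -> C) (v : 'I_n -> K) :
    (forall m : int, m%:~R = 0 :> C -> m = 0) ->
    map_poly intr f = \prod_(i < n) ('X - (u i)%:P) ->
    map_poly intr f = \prod_(i < n) ('X - (v i)%:P) ->
  exists s : 'S_n, specializes (u \o s) v.
Proof.
move=> char0 Du Dv; apply: NNPP => bad.
(* By classical logic, every permutation comes with a relation that fails. *)
have [h hP]: exists h : 'S_n -> {mpoly int[n]}, forall s : 'S_n,
    int_eval u (h s) = 0 /\ int_eval (v \o s) (h s) != 0.
  apply: (fin_all_exists (P := fun (s : 'S_n) g =>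
    int_eval u g = 0 /\ int_eval (v \o s) g != 0)) => s; apply: NNPP => bad_s; apply: bad.
  exists s^-1%g => g gu0; apply/eqP/negPn/negP => gv.
  apply: bad_s; exists (msym s^-1%g g); rewrite !int_eval_msym; split=> //.
  congr (_ != 0): gv; rewrite /int_eval.
  by apply: eq_mmap => i /=; rewrite permKV.
pose H : {mpoly {poly int}[n]} :=
  \sum_(s : 'S_n) 'X^(enum_rank s) *: map_mpoly polyC (h s).
have HE (M : comNzRingType) (w : 'I_n -> M) :
    poly_eval w H = \sum_s 'X^(enum_rank s) * (int_eval w (h s))%:P.
  rewrite /poly_eval raddf_sum /=; apply: eq_bigr => s _.
  by rewrite mmapZ -/(poly_eval w _) poly_eval_map /= map_polyXn.
pose T : {mpoly {poly int}[n]} := \prod_(s : 'S_n) msym s H.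
have symT: T \is symmetric.
  apply/issymP => s; rewrite /T rmorph_prod /=.
  rewrite [RHS](reindex_inj (mulIg s)) /=; apply: eq_bigr => r _.
  by rewrite msymMm.
have [t [Dt _]] := sym_fundamental symT.
have upT (M : comNzRingType) (w : 'I_n -> M) : poly_eval w T = \prod_(s : 'S_n) poly_eval (w \o s) H.
  by rewrite /T (rmorph_prod (poly_eval w)); apply: eq_bigr => s _; apply: poly_eval_msym.
set elt := mmap idfun (fun i : 'I_n => ((-1) ^+ i.+1 * f`_(n - i.+1))%:P) t.
have elt0 : elt = 0.
  have: map_poly (intr : int -> C) elt = 0.
    rewrite -(poly_eval_sym t Du) Dt upT (bigD1 1%g) //= HE big1 ?mul0r // => s _.
    have [hu _] := hP s; rewrite -[RHS](mulr0 'X^(enum_rank s)) -polyC0 -hu.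
    by congr (_ * _%:P); apply: eq_mmap => i /=; rewrite perm1.
  move=> /polyP elt0; apply/polyP => i; have := elt0 i.
  by rewrite coef_map /= !coef0 => /char0.
have /eqP := poly_eval_sym t Dv; rewrite -/elt elt0 rmorph0 Dt upT.
move=> /prodf_eq0[s _ /eqP]; rewrite HE => /polyP/(_ (enum_rank s)).
rewrite coef_sum (bigD1 s) //= big1 ?addr0 => [|r ne_rs]; last first.
  by rewrite coefMC coefXn (inj_eq (@ord_inj _)) (inj_eq enum_rank_inj) eq_sym (negPf ne_rs) mul0r.
rewrite coefMC coefXn eqxx mul1r coef0 => /eqP.
by have [_ /negPf->] := hP s.
Qed.

End Specialization.

Lemma int_evalX (R : comNzRingType) n (u : 'I_n -> R) i : int_eval u 'X_i = u i.
Proof. by rewrite /int_eval mmapX mmap1U. Qed.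

Lemma specializes_inj n (C R : comNzRingType) (u : 'I_n -> C) (v : 'I_n -> R) :
  injective v -> specializes u v -> injective u.
Proof.
move=> v_inj uv i j eq_ij; apply/v_inj/eqP; rewrite -subr_eq0.
rewrite -(int_evalX v i) -(int_evalX v j) -rmorphB; apply/eqP.
by apply: uv; rewrite rmorphB /= !int_evalX eq_ij subrr.
Qed.

(** * Galois groups over the rationals *)

Lemma galois_over_rat (L : splittingFieldType rat) : galois 1%VS {:L}.
Proof.
rewrite /galois sub1v normalFieldf andbT /=; apply/separableP => x _.
by apply: pcharf0_separable => p; rewrite pchar_lalg pchar_num.
Qed.

(** L is generated by one element, which can be sent to any complex root of its
    minimal polynomial. *)
Lemma num_field_embedding (L : splittingFieldType rat) :
  exists _ : {rmorphism L -> algC}, True.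
Proof.
pose th : L := separable_generator 1 {:L}.
have genL x : exists p, x == (map_poly (in_alg L) p).[th].
  have: x \in <<1; th>>%VS.
    rewrite -eq_adjoin_separable_generator ?sub1v ?memvf //.
    by case/and3P: (galois_over_rat L).
  by case/Fadjoin1_polyP => p ->; exists p.
pose g x := xchoose (genL x).
have gE x : (map_poly (in_alg L) (g x)).[th] = x.
  by rewrite [RHS](eqP (xchooseP (genL x))).
have /polyOver1P[m Dm] := minPolyOver 1 th.
pose toC := map_poly (ratr : rat -> algC).
have [z mz]: exists z, root (toC m) z.
  apply/closed_rootP; rewrite size_map_poly -(size_map_poly (in_alg L)) -Dm.
  by rewrite size_minPoly.
have ker p : (map_poly (in_alg L) p).[th] = 0 -> (toC p).[z] = 0.
  move/rootP/(minPoly_dvdp (alg_polyOver 1%AS p)); rewrite Dm.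
  rewrite dvdp_map -(dvdp_map (ratr : rat -> algC)) => dv; apply/rootP.
  by move: mz; rewrite -!dvdp_XsubCl => /dvdp_trans; apply.
have eqC p q : (map_poly (in_alg L) p).[th] = (map_poly (in_alg L) q).[th] ->
    (toC p).[z] = (toC q).[z].
  move=> /eqP; rewrite -subr_eq0 -hornerN -hornerD -rmorphB => /eqP /ker.
  by rewrite /toC rmorphB hornerD hornerN => /eqP; rewrite subr_eq0 => /eqP.
pose iota x := (toC (g x)).[z].
have iotaB : zmod_morphism iota.
  move=> x y; rewrite /iota -hornerN -hornerD -rmorphB; apply: eqC.
  by rewrite rmorphB hornerD hornerN !gE.
have iotaM : monoid_morphism iota.
  split=> [|x y]; last first.
    rewrite /iota -hornerM -rmorphM; apply: eqC.
    by rewrite rmorphM hornerM !gE.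
  rewrite -[RHS](hornerC 1 z); have <-: toC 1 = 1%:P by rewrite /toC rmorph1 polyC1.
  by apply: eqC; rewrite gE rmorph1 hornerC.
pose iB := GRing.isZmodMorphism.Build L algC iota iotaB.
pose iM := GRing.isMonoidMorphism.Build L algC iota iotaM.
by exists (HB.pack iota iB iM : {rmorphism L -> algC}).
Qed.

Section Frobenius.
Variables (L : splittingFieldType rat) (n : nat) (f : {poly int}).
Variable alpha : 'I_n -> L.
Hypothesis f_monic : f \is monic.
Hypothesis f_roots : map_poly intr f = \prod_(i < n) ('X - (alpha i)%:P).
Hypothesis alpha_inj : injective alpha.
Let G := 'Gal({:L} / 1%VS)%g.

Lemma root_f x : root (map_poly intr f) x = (x \in codom alpha).
Proof.
rewrite f_roots -(root_prod_XsubC (codom alpha)); congr (root _ x).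
by rewrite big_map big_enum.
Qed.

Lemma gal_root_index (s : gal_of {:L}) i : {j | s (alpha i) = alpha j}.
Proof.
suff /codomP/sig_eqW: s (alpha i) \in codom alpha by [].
rewrite -root_f; have: root (map_poly intr f) (alpha i) by rewrite root_f codom_f.
rewrite -(fmorph_root s) -map_poly_comp; congr (root _ _).
by apply: eq_map_poly => m /=; rewrite rmorph_int.
Qed.

Definition gal_index (s : gal_of {:L}) i := sval (gal_root_index s i).

Lemma gal_indexE s i : alpha (gal_index s i) = s (alpha i).
Proof. by rewrite /gal_index; case: gal_root_index. Qed.

Lemma gal_index_inj s : injective (gal_index s).
Proof.
move=> i j /(congr1 alpha); rewrite !gal_indexE => /fmorph_inj.
exact: alpha_inj.
Qed.

Lemma Aint_int_eval (iota : {rmorphism L -> algC}) h :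
  iota (int_eval alpha h) \in Aint.
Proof.
rewrite /int_eval /mmap rmorph_sum rpred_sum // => m _.
rewrite rmorphM /= rmorph_int rpredM ?Aint_int // rmorph_prod rpred_prod // => i _.
rewrite rmorphXn rpredX //.
have: root (map_poly intr f) (alpha i) by rewrite root_f codom_f.
rewrite -(fmorph_root iota) => /root_monic_Aint; apply.
  by do 2!apply: monic_map.
by apply/polyOverP => j; rewrite !coef_map /= rmorph_int rpred_int.
Qed.

(** An element fixed by the group is rational, and its complex image is an
    algebraic integer. *)
Lemma gal_fixed_int h :
    (forall s, s \in G -> s (int_eval alpha h) = int_eval alpha h) ->
  exists m : int, int_eval alpha h = m%:~R.
Proof.
move=> fix_h; have [iota _] := num_field_embedding L.
have: int_eval alpha h \in fixedField G by apply/fixedFieldP; rewrite ?memvf.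
rewrite (galois_fixedField (galois_over_rat L)) => /vlineP[c Dh].
have: iota (int_eval alpha h) \in Num.int.
  apply: Cint_rat_Aint (Aint_int_eval iota h).
  by rewrite Dh rmorphZ_num rmorph1 mulr1 Crat_rat.
by case/intrP=> m; rewrite -(rmorph_int iota) => /fmorph_inj Dm; exists m.
Qed.

Definition int_eval2 (K : comNzRingType) (u : 'I_n -> K) :
    {poly {poly {mpoly int[n]}}} -> {poly {poly K}} :=
  map_poly (map_poly (int_eval u)).

HB.instance Definition _ (K : comNzRingType) (u : 'I_n -> K) :=
  GRing.RMorphism.copy (int_eval2 u) (map_poly (map_poly (int_eval u))).

Definition generating (K : nzRingType) (u : 'I_n -> K) : {poly K} :=
  \sum_(i < n) (u i)%:P * 'X^i.

Lemma coef_generating (K : nzRingType) (u : 'I_n -> K) (i : 'I_n) :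
  (generating u)`_i = u i.
Proof.
rewrite coef_sum (bigD1 i) //= coefMXn ltnn subnn coefC eqxx big1 ?addr0 //.
move=> j ne_ji; rewrite coefMXn coefC subn_eq0.
by case: ltngtP (ne_ji) => // /val_inj->; rewrite eqxx.
Qed.

Lemma map_generating (K M : nzRingType) (g : {rmorphism K -> M}) u :
  map_poly g (generating u) = generating (g \o u).
Proof.
rewrite rmorph_sum; apply: eq_bigr => i _.
by rewrite rmorphM /= map_polyC map_polyXn.
Qed.

(** A generic resolvent: the roots x_i are the coefficients of a polynomial in
    an auxiliary variable, so that its conjugates determine the permutation. *)
Definition gal_resolvent : {poly {poly {mpoly int[n]}}} :=
  \prod_(s in G) ('X - (generating (fun i => 'X_(gal_index s i)))%:P).

Lemma int_eval_resolvent (K : comNzRingType) (u : 'I_n -> K) :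
  int_eval2 u gal_resolvent =
  \prod_(s in G) ('X - (generating (u \o gal_index s))%:P).
Proof.
rewrite /int_eval2 rmorph_prod; apply: eq_bigr => s _.
rewrite rmorphB /= map_polyX map_polyC /= map_generating; congr (_ - _%:P).
by apply: eq_bigr => i _; rewrite /= /int_eval mmapX mmap1U.
Qed.

Lemma gal_resolvent_int i j :
  exists m : int, int_eval alpha gal_resolvent`_i`_j = m%:~R.
Proof.
apply: gal_fixed_int => s Gs.
have coefE (h : {poly {poly {mpoly int[n]}}}) : int_eval alpha h`_i`_j = (int_eval2 alpha h)`_i`_j.
  by rewrite !coef_map.
have: map_poly (map_poly s) (int_eval2 alpha gal_resolvent) =
      int_eval2 alpha gal_resolvent.
  rewrite int_eval_resolvent rmorph_prod /= [RHS](reindex_inj (mulIg s)) /=.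
  apply: eq_big => [r | r Gr]; first by rewrite groupMr.
  rewrite rmorphB /= map_polyX map_polyC /= map_generating; congr (_ - _%:P).
  by apply: eq_bigr => k _; rewrite /= !gal_indexE galM ?memvf.
move/(congr1 (fun g : {poly {poly L}} => g`_i`_j)).
by rewrite coefE !coef_map.
Qed.

(** The resolvent of alpha has integral coefficients, so its reduction, with v
    in place of alpha, is invariant under raising coefficients to the power q.
    Thus the q-th power of the root attached to v is again a root, and the roots
    are indexed by the Galois group. *)
Theorem gal_frobenius (q : nat) (K : idomainType) (v : 'I_n -> K) :
    q \in [pchar K] -> specializes alpha v ->
  exists2 s, s \in G & forall i, v i ^+ q = v (gal_index s i).
Proof.
move=> charK spec.
pose Phi := pFrobenius_aut charK.
pose F := int_eval2 v gal_resolvent.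
have fixF : map_poly (map_poly Phi) F = F.
  apply/polyP => i; apply/polyP => j; rewrite !coef_map /=.
  have [m Dm] := gal_resolvent_int i j.
  have: int_eval v (gal_resolvent`_i`_j - m%:~R) = 0.
    by apply: spec; rewrite rmorphB rmorph_int /= Dm subrr.
  move/eqP; rewrite rmorphB rmorph_int subr_eq0 /= => /eqP->.
  by rewrite rmorph_int.
have v_root: root F (generating v).
  rewrite /F int_eval_resolvent (bigD1 1%g) ?group1 //= rootM root_XsubC.
  apply/orP; left; apply/eqP/eq_bigr => i _; congr ((v _)%:P * _).
  by apply: alpha_inj; rewrite gal_indexE gal_id.
have: root F (map_poly Phi (generating v)).
  by move/rootP: v_root => v0; rewrite -fixF; apply/rootP; rewrite horner_map v0 rmorph0.
rewrite /F int_eval_resolvent => /rootP/eqP; rewrite horner_prod.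
case/prodf_eq0=> s Gs; rewrite hornerXsubC subr_eq0 => /eqP Ds.
exists s => // i; have := congr1 (fun g : {poly K} => g`_i) Ds.
by rewrite coef_map !coef_generating.
Qed.

End Frobenius.

(** * Evaluation of coefficient lists *)

Section Evaluation.
Variable R : comNzRingType.

(** The morphism from Z is locked, lest large literals be unfolded into unary
    numbers. *)
Fact zr_key : unit. Proof. by []. Qed.
Definition zr : Z -> R := locked_with zr_key (fun z => (int_of_Z z)%:~R).

Lemma zrE z : zr z = (int_of_Z z)%:~R.
Proof. by rewrite /zr unlock. Qed.
Lemma zr0 : zr 0%Z = 0. Proof. by rewrite zrE. Qed.
Lemma zr1 : zr 1%Z = 1. Proof. by rewrite zrE. Qed.
Lemma zrD a b : zr (a + b)%Z = zr a + zr b.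
Proof. by rewrite !zrE (rmorphD int_of_Z) rmorphD. Qed.
Lemma zrM a b : zr (a * b)%Z = zr a * zr b.
Proof. by rewrite !zrE (rmorphM int_of_Z) rmorphM. Qed.
Lemma zrN a : zr (- a)%Z = - zr a.
Proof. by rewrite !zrE (rmorphN int_of_Z) rmorphN. Qed.
Lemma zrB a b : zr (a - b)%Z = zr a - zr b.
Proof. by rewrite zrD zrN. Qed.

Variable x : R.

Definition ev (s : seq Z) : R := foldr (fun c v => zr c + x * v) 0 s.

Lemma ev_padd s t : ev (padd s t) = ev s + ev t.
Proof.
elim: s t => [|a s IHs] [|b t] /=; rewrite ?add0r ?addr0 //.
by rewrite IHs zrD mulrDr addrACA.
Qed.

Lemma ev_pscale c s : ev (pscale c s) = zr c * ev s.
Proof.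
elim: s => [|a s IHs] /=; first by rewrite mulr0.
by rewrite IHs zrM mulrDr mulrCA.
Qed.

Lemma ev_pmul s t : ev (pmul s t) = ev s * ev t.
Proof.
elim: s => [|a s IHs] /=; first by rewrite mul0r.
by rewrite ev_padd ev_pscale /= IHs zr0 add0r mulrDl mulrA.
Qed.

Lemma ev_rcons s c : ev (rcons s c) = ev s + zr c * x ^+ size s.
Proof.
elim: s => [|a s IHs] /=; first by rewrite mulr0 addr0 add0r mulr1.
by rewrite IHs mulrDr addrA exprS mulrCA.
Qed.

Variable m : seq Z.
Hypothesis m_gt0 : (0 < size m)%N.
Hypothesis m_root : x ^+ size m + ev m = 0.

Lemma size_padd s t : size (padd s t) = maxn (size s) (size t).
Proof.
elim: s t => [|a s IHs] [|b t]; rewrite ?max0n ?maxn0 //=.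
by rewrite IHs maxnSS.
Qed.

#[local] Arguments padd : simpl never.

Lemma size_pmulx s : (size s <= size m -> size (pmulx m s) <= size m)%N.
Proof.
rewrite /pmulx; case: ltnP => // le_ms _.
rewrite size_padd /pscale size_map geq_max leqnn andbT /= size_takel.
  by rewrite prednK.
by rewrite (leq_trans (leq_pred _)).
Qed.

Lemma ev_pmulx s : (size s <= size m)%N -> ev (pmulx m s) = x * ev s.
Proof.
rewrite /pmulx; case: ltnP => [_ _ | ge_sm le_sm]; first by rewrite /= zr0 add0r.
have{ge_sm le_sm} Ds: size s = size m by apply/eqP; rewrite eqn_leq ge_sm le_sm.
case/lastP: s Ds => [|s c]; first by move=> m0; move: m_gt0; rewrite -m0.
rewrite size_rcons last_rcons => Ds.
have -> : take (size m).-1 (rcons s c) = s by rewrite -Ds -cats1 take_size_cat.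
rewrite ev_padd /= zr0 add0r ev_pscale zrN mulNr ev_rcons mulrDr; congr (_ + _).
rewrite mulrCA -exprS Ds -mulrN; congr (_ * _).
by apply/eqP; rewrite eq_sym -addr_eq0 m_root.
Qed.

Lemma size_preduce s : (size (preduce m s) <= size m)%N.
Proof.
by elim: s => //= c s IHs; rewrite size_padd geq_max size_pmulx //= m_gt0.
Qed.

Lemma ev_preduce s : ev (preduce m s) = ev s.
Proof.
elim: s => //= c s IHs.
by rewrite ev_padd ev_pmulx ?size_preduce // IHs /= mulr0 addr0.
Qed.

End Evaluation.

Lemma zr_rmorph (R S : comNzRingType) (f : {rmorphism R -> S}) z :
  f (zr R z) = zr S z.
Proof. by rewrite !zrE rmorph_int. Qed.

Lemma ev_rmorph (R S : comNzRingType) (f : {rmorphism R -> S}) x s :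
  f (ev x s) = ev (f x) s.
Proof.
elim: s => [|c s IHs] /=; first by rewrite rmorph0.
by rewrite rmorphD rmorphM IHs zr_rmorph.
Qed.

Section Evaluation2.
Variable R : comNzRingType.

Definition ev2 (x y : R) (s : seq (seq Z)) : R :=
  foldr (fun c v => ev x c + y * v) 0 s.

(** The polynomial in Y obtained by specializing x. *)
Definition evY (x : R) (s : seq (seq Z)) : {poly R} := Poly (map (ev x) s).

Lemma ev2_yadd x y s t : ev2 x y (yadd s t) = ev2 x y s + ev2 x y t.
Proof.
elim: s t => [|a s IHs] [|b t] /=; rewrite ?add0r ?addr0 //.
by rewrite IHs ev_padd mulrDr addrACA.
Qed.

Lemma ev2_ymul x y s t : ev2 x y (ymul s t) = ev2 x y s * ev2 x y t.
Proof.
elim: s => [|a s IHs] /=; first by rewrite mul0r.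
rewrite ev2_yadd /= IHs add0r mulrDl mulrA; congr (_ + _).
elim: t {IHs} => [|b t IHt] /=; first by rewrite mulr0.
by rewrite IHt ev_pmul mulrDr mulrCA.
Qed.

End Evaluation2.

Lemma evYE (R : comNzRingType) (x : R) s : evY x s = ev2 x%:P 'X s.
Proof.
rewrite /evY; elim: s => [|c s IHs] //=.
rewrite cons_poly_def IHs addrC mulrC; congr (_ + _).
exact: (ev_rmorph (polyC : {rmorphism R -> {poly R}})).
Qed.

Lemma ev2_rmorph (R S : comNzRingType) (f : {rmorphism R -> S}) x y s :
  f (ev2 x y s) = ev2 (f x) (f y) s.
Proof.
elim: s => [|c s IHs] /=; first by rewrite rmorph0.
by rewrite rmorphD rmorphM IHs ev_rmorph.
Qed.

Lemma horner_evY (R : comNzRingType) (x y : R) s : (evY x s).[y] = ev2 x y s.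
Proof.
rewrite /evY; elim: s => [|c s IHs] /=; first by rewrite horner0.
by rewrite horner_cons IHs addrC mulrC.
Qed.

Lemma ZeqbP : Equality.axiom Z.eqb.
Proof. by move=> a b; apply: (iffP idP) => /Z.eqb_eq. Qed.

Section Certificate.
Variables (R : comNzRingType) (x : R).

Lemma ev_P_low : ev x P_coefs = x ^+ size P_low + ev x P_low.
Proof.
have -> : P_coefs = rcons P_low 1%Z by [].
by rewrite ev_rcons zr1 mul1r addrC.
Qed.

(** Once P(x) = 0, reduction modulo P does not change the value at x. *)
Lemma factorization : factor_check -> ev x P_coefs = 0 ->
  evY x A_coefs * evY x H_coefs = (zr R (4422 * 4422)) *: Poly (map (zr R) Q_coefs).
Proof.
move=> /allP ok Px0; apply/eqP; rewrite -subr_eq0; apply/eqP.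
set s := yadd _ _ in ok.
have: ev2 x%:P 'X s = 0.
  elim: s ok => [|c s IHs] //= ok.
  rewrite IHs; last by move=> d sd; apply: ok; rewrite inE sd orbT.
  rewrite mulr0 addr0 -(ev_rmorph (polyC : {rmorphism R -> {poly R}})).
  have <-: ev x (preduce P_low c) = ev x c.
    by apply: ev_preduce => //; rewrite -ev_P_low.
  have: all (Z.eqb 0) (preduce P_low c) by apply: ok; rewrite inE eqxx.
  elim: (preduce _ _) => [|d t IHt]; first by rewrite /= rmorph0.
  by move=> /andP[/ZeqbP <- /IHt]; rewrite /= zr0 add0r rmorphM /= => ->; rewrite mulr0.
rewrite ev2_yadd ev2_ymul !evYE => <-; congr (_ + _).
move: (4422 * 4422)%Z => D.
elim: Q_coefs => [|c t IHt] /=; first by rewrite scaler0 oppr0.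
rewrite -IHt mulr0 addr0 cons_poly_def scalerDr opprD scalerAl -mulNr.
rewrite [_ * 'X]mulrC addrC; congr (_ + _).
rewrite -(zr_rmorph (polyC : {rmorphism R -> {poly R}})) zrM zrN.
by rewrite /= -mul_polyC -polyCM mulNr polyCN.
Qed.

End Certificate.

(** * A prime modulus where the polynomial splits *)

Section ModP.
Variable R : comNzRingType.
Hypothesis p0 : zr R big_prime = 0.

Lemma zr_redp z : zr R (redp z) = zr R z.
Proof. by rewrite /redp zrB zrM p0 mul0r subr0. Qed.

Lemma zr_is_zero_mod z : is_zero_mod z -> zr R z = 0.
Proof.
by case/or4P=> /Z.eqb_spec ->; rewrite ?zrN ?zrD ?p0 ?oppr0 ?addr0 ?zr0.
Qed.

Lemma dotp_powers s n x y : (size s <= n)%N ->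
  zr R (dotp s (powers n x y)) = zr R y * ev (zr R x) s.
Proof.
elim: n s y => [|n IHn] [|c s] y //=; rewrite ?zr0 ?mulr0 //.
rewrite ltnS => le_sn.
rewrite zrD zrM IHn // zr_redp zrM mulrDr; congr (_ + _); first by rewrite mulrC.
by rewrite mulrCA mulrA.
Qed.

#[local] Arguments powers : simpl never.

Lemma zr_powp x n : zr R (powp x n) = zr R x ^+ Pos.to_nat n.
Proof.
elim: n => [n IHn|n IHn|] /=.
- rewrite zr_redp zrM zr_redp zrM IHn Pos2Nat.inj_xI exprS -exprD.
  by rewrite multE mul2n addnn.
- by rewrite zr_redp zrM IHn Pos2Nat.inj_xO -exprD multE mul2n addnn.
- by rewrite expr1.
Qed.

Lemma mod_root i : (i < 17)%N -> ev (zr R (nth 0%Z roots_mod_p i)) P_coefs = 0.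
Proof.
move=> lt_i; have := roots_checkT; rewrite /roots_check => /all_nthP-/(_ 0%Z i lt_i).
by move/zr_is_zero_mod; rewrite zr_redp dotp_powers // zr1 mul1r.
Qed.

Lemma ev_coefs_at s x y : all (fun c => size c <= 17)%N s ->
  ev y (coefs_at s x) = ev2 (zr R x) y s.
Proof.
elim: s => [|c s IHs] //= /andP[le_c /IHs IH].
by rewrite -IH zr_redp dotp_powers // zr1 mul1r.
Qed.

Lemma mod_incidence i j : (i < 17)%N -> (j < 68)%N -> i \in nth [::] blocks j ->
  ev2 (zr R (nth 0%Z roots_mod_p i)) (zr R (nth 0%Z block_roots j)) A_coefs = 0.
Proof.
move=> lt_i lt_j ij; have := incidence_checkT.
rewrite /incidence_check => /allP/(_ i).
rewrite mem_iota lt_i => /(_ isT)/all_nthP.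
have sz_b : size block_roots = 68 by rewrite size_map.
have sz_bp : size block_powers = 68 by rewrite size_map size_zip sz_b.
move=> /(_ ([::], [::]) j); rewrite sz_bp => /(_ lt_j).
rewrite (nth_map ([::], 0%Z)) ?size_zip ?sz_b // nth_zip ?sz_b //.
have incE Ai B b : incident i Ai (B, b) = if i \in B then is_zero_mod (redp (dotp Ai b)) else true.
  by [].
rewrite incE ij => /zr_is_zero_mod; rewrite zr_redp dotp_powers ?size_map // zr1 mul1r.
by rewrite ev_coefs_at.
Qed.
End ModP.

Lemma regular_blocks i : (i < 17)%N ->
  count (fun B : seq nat => i \in B) blocks = 20%N.
Proof.
move=> lt_i; have := regular_checkT; rewrite /regular_check => /allP/(_ i).
by rewrite mem_iota => /(_ lt_i)/eqP.
Qed.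

Section Distinct.
Variable R : comNzRingType.
Hypothesis ker_zr : forall z, zr R z = 0 -> exists y, z = (big_prime * y)%Z.

Lemma mod_distinct : uniq (map (zr R) (roots_mod_p ++ block_roots)).
Proof.
have := distinct_checkT; rewrite /distinct_check; set s := _ ++ _.
case/andP=> /allP range Us; rewrite map_inj_in_uniq; first exact: Us.
move=> x y /range xp /range yp eq_xy.
have [z Dz] : exists z, (x - y)%Z = (big_prime * z)%Z.
  by apply: ker_zr; rewrite zrB eq_xy subrr.
have bigp_gt0 : (0 < big_prime)%Z by [].
case/andP: xp => /Z.leb_spec0 x0 /Z.ltb_spec0 xp.
case/andP: yp => /Z.leb_spec0 y0 /Z.ltb_spec0 yp.
move: big_prime bigp_gt0 Dz xp yp => p p0 Dz xp yp.
case: (Z.lt_trichotomy z 0) => [z0 | [z0 | z0]]; last 1 first.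
- have: (p * 1 <= p * z)%Z by apply: Z.mul_le_mono_nonneg_l; lia.
  lia.
- have: (p * z <= p * -1)%Z by apply: Z.mul_le_mono_nonneg_l; lia.
  lia.
by rewrite z0 Z.mul_0_r in Dz; lia.
Qed.
End Distinct.

(** Let r be a prime factor of N = k 2 ^ m + 1. The witness has order exactly
    2 ^ m modulo r, so 2 ^ m divides r - 1 and r > 2 ^ m; as N < (2 ^ m) ^ 2 + 1,
    the smallest prime factor exceeds the square root of N. The hypothesis is
    stated for all rings in which N = 0, as this is what a computation with
    integers modulo N provides. *)
Lemma proth_prime (k m : nat) : (0 < m)%N -> (k < 2 ^ m)%N -> (0 < k)%N ->
    (forall R : comNzRingType, (k * 2 ^ m).+1%:R = 0 :> R ->
       exists x : R, x ^+ (2 ^ m.-1) = -1) ->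
  prime (k * 2 ^ m).+1.
Proof.
move=> m_gt0 lt_k k_gt0 witness; set N := _.+1.
have N_gt1 : (1 < N)%N by rewrite ltnS muln_gt0 k_gt0 expn_gt0.
set r := pdiv N; have r_pr : prime r by apply: pdiv_prime.
have charFr : r \in [pchar 'F_r] by apply: pchar_Fp.
have N0 : N%:R = 0 :> 'F_r by apply/eqP; rewrite -(dvdn_pcharf charFr) pdiv_dvd.
have [x Dx] := witness _ N0.
have r_odd : 2%:R != 0 :> 'F_r.
  rewrite -(dvdn_pcharf charFr) gtnNdvd // ltn_neqAle prime_gt1 // andbT.
  apply/eqP => r2; have: (r %| N)%N by apply: pdiv_dvd.
  by rewrite -r2 dvdn2 /= oddM oddX /= orbF (gtn_eqF m_gt0) andbF.
have x2m : x ^+ (2 ^ m) = 1.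
  by rewrite -(prednK m_gt0) expnSr exprM Dx expr2 mulrNN mulr1.
have x_neq0 : x != 0.
  by apply: contraTneq isT => x0; rewrite x0 expr0n expn_eq0 /= in x2m;
     move/eqP: x2m; rewrite eq_sym oner_eq0.
have m2_gt0 : (0 < 2 ^ m)%N by rewrite expn_gt0.
have [d prim_d dv_d] := prim_order_exists m2_gt0 x2m.
(* The order of the witness x divides 2 ^ m but not 2 ^ (m - 1). *)
have Dd : d = (2 ^ m)%N.
  have /(dvdn_pfactor _ _ (isT : prime 2))[elt le_em De] := dv_d.
  rewrite De; congr (2 ^ _)%N; apply/eqP; rewrite eqn_leq le_em leqNgt.
  apply/negP => lt_em; case/eqP: r_odd.
  have: x ^+ (2 ^ m.-1) = 1.
    apply/eqP; rewrite -(prim_order_dvd prim_d) De dvdn_exp2l //.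
    by rewrite -ltnS prednK.
  by rewrite Dx mulr2n => /eqP; rewrite eq_sym -addr_eq0 => /eqP.
have dv_r : (2 ^ m %| r.-1)%N.
  rewrite -Dd (prim_order_dvd prim_d); apply/eqP/(mulfI x_neq0).
  by rewrite -exprS prednK ?prime_gt0 // mulr1 -[in RHS](expf_card x) card_Fp.
apply: ltn_pdiv2_prime => //; rewrite -/r.
have lt_r : (2 ^ m < r)%N.
  rewrite -(ltn_predK (prime_gt0 r_pr)) ltnS dvdn_leq //.
  by rewrite -ltnS prednK ?prime_gt0 ?prime_gt1.
rewrite (leq_trans _ (leq_mul lt_r lt_r)) // /N.
have: (k * 2 ^ m < 2 ^ m * 2 ^ m)%N by rewrite ltn_pmul2r ?expn_gt0.
by move/leq_ltn_trans; apply; rewrite ltn_mul.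
Qed.

Lemma zr_nat (R : comNzRingType) n : zr R (Z.of_nat n) = n%:R.
Proof.
elim: n => [|n IHn]; first exact: zr0.
by rewrite Nat2Z.inj_succ -Z.add_1_l zrD zr1 IHn -[in RHS]add1n natrD.
Qed.

Lemma Z_of_pow2 m : Z.of_nat (2 ^ m) = (2 ^ Z.of_nat m)%Z.
Proof.
elim: m => // m IHm.
rewrite expnS Nat2Z.inj_mul IHm (Nat2Z.inj_succ m) Z.pow_succ_r //.
exact: Zle_0_nat.
Qed.

Lemma big_prime_prime : exists2 N : nat, prime N & Z.of_nat N = big_prime.
Proof.
have [k Dk]: exists k, Z.of_nat k = 17180134177%Z.
  by exists (Z.to_nat 17180134177); rewrite Z2Nat.id.
have DN : Z.of_nat (k * 2 ^ 38).+1 = big_prime.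
  by rewrite Nat2Z.inj_succ Nat2Z.inj_mul Dk Z_of_pow2.
exists (k * 2 ^ 38).+1 => //; apply: proth_prime => //.
- by apply/ssrnat.ltP/Nat2Z.inj_lt; rewrite Dk Z_of_pow2.
- by apply/ssrnat.ltP/Nat2Z.inj_lt; rewrite Dk.
move=> R; rewrite -zr_nat DN => p0; exists (zr R 3 ^+ k).
have := power_checkT => /(zr_is_zero_mod p0)/eqP.
rewrite zrD zr_powp // zr1 addr_eq0 => /eqP <-.
rewrite -exprM; congr (_ ^+ _).
have nat_of_pos q : Z.pos q = (17180134177 * 2 ^ 37)%Z -> (k * 2 ^ 37)%N = Pos.to_nat q.
  move=> Dq; apply: Nat2Z.inj; rewrite positive_nat_Z Dq.
  by rewrite Nat2Z.inj_mul Dk Z_of_pow2.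
exact: nat_of_pos.
Qed.

Lemma big_prime_field : exists K : fieldType,
  zr K big_prime = 0 /\ forall z, zr K z = 0 -> exists y, z = (big_prime * y)%Z.
Proof.
have [N N_pr DN] := big_prime_prime; exists ('F_N : fieldType).
have charN : N \in [pchar 'F_N] by apply: pchar_Fp.
have nat0 n : n%:R = 0 :> 'F_N -> exists y, Z.of_nat n = (big_prime * y)%Z.
  move/eqP; rewrite -(dvdn_pcharf charN) => /dvdnP[q ->].
  by exists (Z.of_nat q); rewrite Nat2Z.inj_mul DN Z.mul_comm.
split; first by rewrite -DN zr_nat pcharf0.
case=> [_ | q | q].
- by exists 0%Z.
- by rewrite -positive_nat_Z zr_nat => /nat0.
rewrite -Pos2Z.opp_pos zrN -positive_nat_Z zr_nat => /eqP.
rewrite oppr_eq0 => /eqP/nat0[y ->]; exists (- y)%Z.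
by rewrite Z.mul_opp_r.
Qed.

(** * The roots modulo that prime and in characteristic zero *)

Definition zpoly (s : seq Z) : {poly int} := Poly (map int_of_Z s).

Lemma map_zpoly (R : comNzRingType) s : map_poly intr (zpoly s) = Poly (map (zr R) s).
Proof.
rewrite /zpoly; elim: s => [|c s IHs] /=; first by rewrite rmorph0.
by rewrite !cons_poly_def rmorphD rmorphM /= map_polyX map_polyC /= IHs zrE.
Qed.

Lemma horner_zpoly (R : comNzRingType) s (x : R) : (map_poly intr (zpoly s)).[x] = ev x s.
Proof.
rewrite map_zpoly; elim: s => [|c s IHs] /=; first by rewrite horner0.
by rewrite horner_cons IHs addrC mulrC.
Qed.

Lemma size_zpoly s c : c != 0%Z -> size (zpoly (rcons s c)) = (size s).+1.
Proof.
move=> c0; rewrite /zpoly (PolyK (c := 1)) ?size_map ?size_rcons //.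
rewrite map_rcons last_rcons; apply: contraNneq c0 => c0.
by rewrite -[c]int_of_ZK c0.
Qed.

Lemma monic_zpoly s : zpoly (rcons s 1%Z) \is monic.
Proof.
rewrite monicE lead_coefE size_zpoly // coef_Poly (nth_map 0%Z) ?size_rcons //.
by rewrite nth_rcons ltnn eqxx.
Qed.

Definition P_int := zpoly P_coefs.
Definition Q_int := zpoly Q_coefs.

Lemma P_int_monic : P_int \is monic. Proof. exact: (monic_zpoly (take 17 P_coefs)). Qed.
Lemma Q_int_monic : Q_int \is monic. Proof. exact: (monic_zpoly (take 68 Q_coefs)). Qed.
Lemma size_P_int : size P_int = 18%N. Proof. exact: (@size_zpoly (take 17 P_coefs)). Qed.
Lemma size_Q_int : size Q_int = 69%N. Proof. exact: (@size_zpoly (take 68 Q_coefs)). Qed.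

Lemma Poly_ev (R : comNzRingType) s : Poly (map (zr R) s) = ev ('X : {poly R}) s.
Proof.
elim: s => [|c s IHs] //=; rewrite cons_poly_def IHs addrC mulrC.
by congr (_ + _); apply: (zr_rmorph (polyC : {rmorphism R -> {poly R}})).
Qed.

Lemma ev_P_coefs (R : comNzRingType) (x : R) : ev x P_coefs =
  x ^+ 17 - x ^+ 16 *+ 5 + x ^+ 15 *+ 12 - x ^+ 14 *+ 28 + x ^+ 13 *+ 72
  - x ^+ 12 *+ 132 + x ^+ 11 *+ 116 - x ^+ 9 *+ 74 + x ^+ 8 *+ 90 - x ^+ 7 *+ 28
  - x ^+ 6 *+ 12 + x ^+ 5 *+ 24 - x ^+ 4 *+ 12 - x ^+ 3 *+ 4 - x *+ 3 - 1.
Proof. by rewrite /ev /P_coefs /foldr !zrE; ring. Qed.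

Lemma P_intE : P = map_poly intr P_int.
Proof.
by rewrite map_zpoly (Poly_ev rat P_coefs) (ev_P_coefs ('X : {poly rat})) /P !scaler_nat.
Qed.

(** Concatenation of two families; the roots of P and of Q are specialized
    together, as those of P * Q. *)
Definition join (T : Type) m n (u : 'I_m -> T) (v : 'I_n -> T) (k : 'I_(m + n)) : T :=
  match split k with inl i => u i | inr j => v j end.

Lemma join_l T m n (u : 'I_m -> T) (v : 'I_n -> T) i : join u v (lshift n i) = u i.
Proof. by rewrite /join (unsplitK (inl i)). Qed.

Lemma join_r T m n (u : 'I_m -> T) (v : 'I_n -> T) j : join u v (rshift m j) = v j.
Proof. by rewrite /join (unsplitK (inr j)). Qed.

Lemma int_eval_ev n (R : comNzRingType) (u : 'I_n -> R) i s :
  int_eval u (ev 'X_i s) = ev (u i) s.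
Proof. by rewrite ev_rmorph /= int_evalX. Qed.

Section ModRoots.
Variable K : fieldType.
Hypothesis p0 : zr K big_prime = 0.
Hypothesis ker_zr : forall z, zr K z = 0 -> exists y, z = (big_prime * y)%Z.

Definition P_root_mod (i : 'I_17) : K := zr K (nth 0%Z roots_mod_p i).
Definition Q_root_mod (j : 'I_68) : K := zr K (nth 0%Z block_roots j).

Lemma zr_neq0 z : (0 < z < big_prime)%Z -> zr K z != 0.
Proof.
case=> z0 zp; apply/eqP=> /ker_zr[y Dz]; move: zp z0; rewrite {}Dz.
have : (0 < big_prime)%Z by [].
move: big_prime => p p0' lt1 lt2; have [y1 | y1] := Z.le_gt_cases y 0.
  have: (p * y <= p * 0)%Z by apply: Z.mul_le_mono_nonneg_l; lia.
  lia.
have: (p * 1 <= p * y)%Z by apply: Z.mul_le_mono_nonneg_l; lia.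
lia.
Qed.

Lemma join_root_mod_inj : injective (join P_root_mod Q_root_mod).
Proof.
have := mod_distinct ker_zr; rewrite map_cat => Us.
have nth_ab k : join P_root_mod Q_root_mod k =
    nth 0 (map (zr K) roots_mod_p ++ map (zr K) block_roots) k.
  have sz : size roots_mod_p = 17 by [].
  rewrite nth_cat size_map sz; case: (split_ordP k) => [i | j] ->.
    by rewrite join_l (_ : lshift _ i = i :> nat) // (nth_map 0%Z) ?sz // ltn_ord.
  rewrite join_r (_ : rshift _ j = (17 + j)%N :> nat) // addKn (nth_map 0%Z) //.
move=> k l; rewrite !nth_ab => /eqP.
by rewrite nth_uniq ?size_cat ?size_map ?ltn_ord // => /eqP/val_inj.
Qed.

Lemma P_root_mod_inj : injective P_root_mod.
Proof. by move=> i j eq_ij; apply/(@lshift_inj _ 68)/join_root_mod_inj; rewrite !join_l. Qed.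

Lemma Q_root_mod_inj : injective Q_root_mod.
Proof. by move=> i j eq_ij; apply/(@rshift_inj 17)/join_root_mod_inj; rewrite !join_r. Qed.

Lemma root_mod_neq i j : P_root_mod i != Q_root_mod j.
Proof.
apply/eqP=> eq_ij; have := @join_root_mod_inj (lshift 68 i) (rshift 17 j).
rewrite join_l join_r => /(_ eq_ij)/eqP; by rewrite eq_lrshift.
Qed.

Lemma P_root_modP i : ev (P_root_mod i) P_coefs = 0.
Proof. exact: mod_root. Qed.

Lemma size_A_at (R : idomainType) (x : R) : zr R 4422 != 0 -> size (evY x A_coefs) = 21%N.
Proof.
move=> D0; rewrite /evY (PolyK (c := 0)) ?size_map //.
have -> : A_coefs = rcons (take 20 A_coefs) [:: 4422%Z] by [].
by rewrite map_rcons last_rcons /= mulr0 addr0.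
Qed.

Lemma incident_A (i : 'I_17) (j : 'I_68) : (i : nat) \in nth [::] blocks j ->
  root (evY (P_root_mod i) A_coefs) (Q_root_mod j).
Proof.
by move=> ij; apply/rootP; rewrite horner_evY; apply: mod_incidence.
Qed.

Lemma card_blocks (i : 'I_17) : #|[pred j : 'I_68 | (i : nat) \in nth [::] blocks j]| = 20%N.
Proof.
rewrite -[RHS](regular_blocks (ltn_ord i)) -sum1_count -sum1_card.
transitivity (\sum_(0 <= j < 68 | (i : nat) \in nth [::] blocks j) 1)%N.
  by rewrite big_mkord; apply: eq_bigl => j; rewrite inE.
by rewrite [RHS](big_nth [::]).
Qed.

(** The 20 blocks through i already provide as many roots as the degree of A
    in Y allows. *)
Lemma mod_incidenceP (i : 'I_17) (j : 'I_68) :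
  root (evY (P_root_mod i) A_coefs) (Q_root_mod j) = ((i : nat) \in nth [::] blocks j).
Proof.
have D0 : zr K 4422 != 0 by apply: zr_neq0.
pose I := [pred j : 'I_68 | (i : nat) \in nth [::] blocks j].
pose J := [pred j : 'I_68 | root (evY (P_root_mod i) A_coefs) (Q_root_mod j)].
have sIJ : I \subset J.
  by apply/subsetP=> k; rewrite !inE => /incident_A.
have le_J : (#|J| <= 20)%N.
  have sA := size_A_at (P_root_mod i) D0.
  have A0 : evY (P_root_mod i) A_coefs != 0 by rewrite -size_poly_gt0 sA.
  have: (size (map Q_root_mod (enum J)) < size (evY (P_root_mod i) A_coefs))%N.
    apply: max_poly_roots => //.
      by apply/allP=> x /mapP[k kJ ->]; rewrite mem_enum inE in kJ.
    by rewrite (map_inj_uniq Q_root_mod_inj) enum_uniq.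
  by rewrite sA size_map -cardE.
have eq_card : #|I| = #|J|.
  apply/eqP; rewrite eqn_leq subset_leq_card //=.
  by rewrite (leq_trans le_J) // card_blocks.
by have /(subset_cardP eq_card)/(_ j) := sIJ; rewrite !inE.
Qed.

Lemma Q_root_modP j : ev (Q_root_mod j) Q_coefs = 0.
Proof.
have [i ij] : exists i : 'I_17, (i : nat) \in nth [::] blocks j.
  have : all (has (fun i => i < 17)%N) blocks by [].
  move/all_nthP => /(_ [::] j (ltn_ord j))/hasP[i iB lt_i].
  by exists (Ordinal lt_i).
have := factorization factor_checkT (P_root_modP i).
move/(congr1 (fun q => q.[Q_root_mod j])); rewrite hornerM (rootP (incident_A ij)) mul0r.
rewrite hornerZ -map_zpoly horner_zpoly => /esym/eqP.
have D0 : zr K (4422 * 4422) != 0 by apply: zr_neq0.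
by rewrite mulf_eq0 (negPf D0) => /eqP.
Qed.

Lemma prod_roots (n : nat) (f : {poly int}) (v : 'I_n -> K) :
    f \is monic -> size f = n.+1 -> injective v ->
    (forall i, root (map_poly intr f) (v i)) ->
  map_poly intr f = \prod_(i < n) ('X - (v i)%:P).
Proof.
move=> f_monic sf v_inj v_root; set g := map_poly _ f.
have g_monic : g \is monic by apply: monic_map.
have sg : size g = n.+1.
  by rewrite size_map_poly_id0 // (monicP f_monic) oner_eq0.
rewrite (@all_roots_prod_XsubC _ g (codom v)) ?(monicP g_monic) ?scale1r.
- by rewrite big_map big_enum.
- by rewrite size_codom card_ord.
- by apply/allP=> _ /codomP[i ->].
by rewrite uniq_rootsE map_inj_uniq ?enum_uniq.
Qed.

Lemma prod_root_mod : map_poly intr (P_int * Q_int) = \prod_k ('X - (join P_root_mod Q_root_mod k)%:P).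
Proof.
rewrite rmorphM big_split_ord /=; congr (_ * _).
  rewrite (prod_roots P_int_monic size_P_int P_root_mod_inj) => [|i].
    by apply: eq_bigr => i _; rewrite join_l.
  by apply/rootP; rewrite horner_zpoly P_root_modP.
rewrite (prod_roots Q_int_monic size_Q_int Q_root_mod_inj) => [|i].
  by apply: eq_bigr => i _; rewrite join_r.
by apply/rootP; rewrite horner_zpoly Q_root_modP.
Qed.

End ModRoots.

Lemma root_P_int (R : comNzRingType) (x : R) : root (map_poly intr P_int) x = (ev x P_coefs == 0).
Proof. by rewrite rootE horner_zpoly. Qed.

Lemma root_Q_int (R : comNzRingType) (x : R) : root (map_poly intr Q_int) x = (ev x Q_coefs == 0).
Proof. by rewrite rootE horner_zpoly. Qed.

Lemma root_prod_index (R : idomainType) n (f : {poly R}) (v : 'I_n -> R) x :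
  f = \prod_(i < n) ('X - (v i)%:P) -> root f x -> exists i, x = v i.
Proof.
move=> ->; rewrite -(big_enum _ _ _ (fun i => 'X - (v i)%:P)) /= -(big_map v xpredT (fun c => 'X - c%:P)).
by rewrite root_prod_XsubC => /mapP[i _ ->]; exists i.
Qed.

Lemma split_roots (R : idomainType) n (f : {poly int}) (rs : seq R) :
    f \is monic -> size f = n.+1 ->
    map_poly intr f = \prod_(c <- rs) ('X - c%:P) ->
  map_poly intr f = \prod_(i < n) ('X - (rs`_i)%:P).
Proof.
move=> f_monic sf Df; have: size (map_poly (intr : int -> R) f) = n.+1.
  by rewrite size_map_poly_id0 // (monicP f_monic) oner_eq0.
by rewrite {1}Df size_prod_XsubC => -[sz]; rewrite Df (big_nth 0) big_mkord sz.
Qed.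

Section Setup.
Variables (L : splittingFieldType rat) (K : fieldType).
Hypothesis p0 : zr K big_prime = 0.
Hypothesis ker_zr : forall z, zr K z = 0 -> exists y, z = (big_prime * y)%Z.

(** The numbering given by [specialization] mixes roots of P and of Q only in
    appearance: a root of P specializes to a root of P, and P and Q have no
    common root mod p. *)
Theorem matching_roots : splittingFieldFor 1%VS (map_poly (in_alg L) P) {:L} ->
  exists (iota : {rmorphism L -> algC}) (alpha : 'I_17 -> L) (y : 'I_68 -> algC),
    [/\ map_poly intr P_int = \prod_i ('X - (alpha i)%:P),
        map_poly intr Q_int = \prod_j ('X - (y j)%:P)
      & specializes (join (iota \o alpha) y) (join (P_root_mod K) (Q_root_mod K))].
Proof.
case=> rs Drs _; have [iota _] := num_field_embedding L.
have {}Drs : map_poly intr P_int = \prod_(c <- rs) ('X - c%:P).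
  apply/eqP; rewrite -eqp_monic ?monic_prod_XsubC ?(monic_map _ P_int_monic) //.
  rewrite (eqp_trans _ Drs) // P_intE -map_poly_comp.
  by rewrite -(eq_map_poly (fun m => esym (rmorph_int (in_alg L) m))) eqpxx.
have {}Drs := split_roots P_int_monic size_P_int Drs.
have [ys Dys] := closed_field_poly_normal (map_poly intr Q_int : {poly algC}).
rewrite (monicP (monic_map _ Q_int_monic)) scale1r in Dys.
have {}Dys := split_roots Q_int_monic size_Q_int Dys.
set al := fun i : 'I_17 => rs`_i in Drs; set y := fun j : 'I_68 => ys`_j in Dys.
have Du : map_poly intr (P_int * Q_int) =
    \prod_k ('X - (join (iota \o al) y k)%:P).
  rewrite rmorphM big_split_ord /=; congr (_ * _).
    have <- : map_poly iota (map_poly intr P_int) = map_poly intr P_int.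
      rewrite -map_poly_comp; apply: eq_map_poly => m /=; exact: rmorph_int.
    rewrite Drs rmorph_prod; apply: eq_bigr => i _.
    by rewrite rmorphB /= map_polyX map_polyC join_l.
  by rewrite Dys; apply: eq_bigr => i _; rewrite join_r.
have char0 (m : int) : m%:~R = 0 :> algC -> m = 0.
  by move/eqP; rewrite intr_eq0 => /eqP.
have [s spec] := specialization char0 Du (prod_root_mod p0 ker_zr).
have rel k c : ev (join (iota \o al) y (s k)) c = 0 -> ev (join (P_root_mod K) (Q_root_mod K) k) c = 0.
  by move=> sk; rewrite -int_eval_ev; apply: spec; rewrite int_eval_ev.
have Da : map_poly intr P_int = \prod_(i < 17) ('X - (P_root_mod K i)%:P).
  apply: prod_roots P_int_monic size_P_int (P_root_mod_inj ker_zr) _ => i.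
  by rewrite root_P_int P_root_modP.
have Db : map_poly intr Q_int = \prod_(j < 68) ('X - (Q_root_mod K j)%:P).
  apply: prod_roots Q_int_monic size_Q_int (Q_root_mod_inj ker_zr) _ => j.
  by rewrite root_Q_int (Q_root_modP p0 ker_zr).
have s_l i : exists i', s (lshift 68 i) = lshift 68 i'.
  case: (split_ordP (s (lshift 68 i))) => [i' | j] Ds; first by exists i'.
  have: root (map_poly intr Q_int) (P_root_mod K i).
    rewrite root_Q_int -(join_l _ (Q_root_mod K)) rel // Ds join_r.
    apply/eqP; rewrite -root_Q_int Dys (bigD1 j) //= rootM root_XsubC eqxx //.
  move=> /(root_prod_index Db)[k Dk].
  by have /eqP := root_mod_neq ker_zr i k.
have s_r j : exists j', s (rshift 17 j) = rshift 17 j'.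
  case: (split_ordP (s (rshift 17 j))) => [i | j'] Ds; last by exists j'.
  have: root (map_poly intr P_int) (Q_root_mod K j).
    rewrite root_P_int -(join_r (P_root_mod K)) rel // Ds join_l.
    have : root (map_poly intr P_int) (al i).
      by rewrite Drs (bigD1 i) //= rootM root_XsubC eqxx.
    by rewrite root_P_int -(fmorph_eq0 iota) ev_rmorph => /eqP.
  move=> /(root_prod_index Da)[k Dk].
  by have /eqP[] := root_mod_neq ker_zr k j.
have [sl Dsl] := fin_all_exists s_l; have [sr Dsr] := fin_all_exists s_r.
have sl_inj : injective sl.
  by move=> i j eq_ij; apply/(@lshift_inj _ 68)/(@perm_inj _ s); rewrite !Dsl eq_ij.
have sr_inj : injective sr.
  by move=> i j eq_ij; apply/(@rshift_inj 17)/(@perm_inj _ s); rewrite !Dsr eq_ij.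
exists iota, (al \o sl), (y \o sr); split.
- by rewrite Drs (reindex_inj sl_inj).
- by rewrite Dys (reindex_inj sr_inj).
move=> h h0; apply: spec; rewrite -{}h0; apply: eq_mmap => k.
by case: (split_ordP k) => [i | j] -> /=; rewrite ?Dsl ?Dsr ?join_l ?join_r.
Qed.
End Setup.

Section Incidence.
Variables (L : splittingFieldType rat) (K : fieldType).
Hypothesis p0 : zr K big_prime = 0.
Hypothesis ker_zr : forall z, zr K z = 0 -> exists y, z = (big_prime * y)%Z.
Variables (iota : {rmorphism L -> algC}) (alpha : 'I_17 -> L) (y : 'I_68 -> algC).
Hypothesis P_roots : map_poly intr P_int = \prod_i ('X - (alpha i)%:P).
Hypothesis Q_roots : map_poly intr Q_int = \prod_j ('X - (y j)%:P).
Hypothesis spec : specializes (join (iota \o alpha) y) (join (P_root_mod K) (Q_root_mod K)).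

Lemma spec_alpha : specializes alpha (P_root_mod K).
Proof.
pose lq := [tuple ('X_(lshift 68 i) : {mpoly int[17 + 68]}) | i < 17].
have evE (R : comNzRingType) (u : 'I_17 -> R) v h :
    int_eval (join u v) (h \mPo lq) = int_eval u h.
  rewrite /int_eval mmap_comp_mpoly; apply: eq_mmap => i.
  by rewrite tnth_mktuple mmapX mmap1U join_l.
move=> h h0; rewrite -(evE _ _ (Q_root_mod K)); apply: spec; rewrite evE.
rewrite -[RHS](rmorph0 iota) -h0 /int_eval /mmap rmorph_sum.
apply: eq_bigr => m _; rewrite rmorphM /= rmorph_int rmorph_prod /=.
by congr (_ * _); apply: eq_bigr => i _; rewrite rmorphXn.
Qed.

Lemma alpha_inj : injective alpha.
Proof. exact: specializes_inj (P_root_mod_inj ker_zr) spec_alpha. Qed.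

Lemma ev_alpha i : ev (alpha i) P_coefs = 0.
Proof. by apply/eqP; rewrite -root_P_int P_roots (bigD1 i) //= rootM root_XsubC eqxx. Qed.

Lemma A_dvd_Q i : evY (iota (alpha i)) A_coefs %| (\prod_j ('X - (y j)%:P)).
Proof.
have D0 : zr algC (4422 * 4422) != 0 by rewrite zrE intr_eq0.
rewrite -Q_roots map_zpoly -(dvdpZr _ _ D0) -(@factorization _ (iota (alpha i)) factor_checkT).
  exact: dvdp_mulr.
by rewrite -ev_rmorph ev_alpha rmorph0.
Qed.

Lemma A_roots_card i : (20 <= #|[pred j | root (evY (iota (alpha i)) A_coefs) (y j)]|)%N.
Proof.
have := A_dvd_Q i; rewrite -(big_enum _ _ _ (fun j => 'X - (y j)%:P)) /=.
case/dvdp_prod_XsubC => m Dm.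
have := eqp_size Dm; rewrite size_A_at; last by rewrite zrE intr_eq0.
rewrite size_prod_XsubC => -[sz]; rewrite [leqLHS]sz cardE.
apply: uniq_leq_size; first by rewrite mask_uniq ?enum_uniq.
move=> j jm; rewrite mem_enum inE (eqp_root Dm).
by rewrite -(big_map y xpredT (fun c => 'X - c%:P)) root_prod_XsubC map_f.
Qed.

(** A root y_j of A at alpha_i specializes to an incidence mod p. Conversely
    there are enough such roots: A divides Q, which has simple roots, so A has
    20 roots among the y_j, and only 20 blocks contain i. *)
Lemma incidenceP i j :
  root (evY (iota (alpha i)) A_coefs) (y j) = ((i : nat) \in nth [::] blocks j).
Proof.
set J := [pred j | root (evY (iota (alpha i)) A_coefs) (y j)].
set I := [pred j : 'I_68 | (i : nat) \in nth [::] blocks j].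
have sJI : J \subset I.
  apply/subsetP=> k; rewrite !inE => /rootP; rewrite horner_evY => Ak.
  rewrite -(mod_incidenceP p0 ker_zr); apply/rootP; rewrite horner_evY.
  have evE (R : comNzRingType) (u : 'I_17 -> R) v :
    int_eval (join u v) (ev2 'X_(lshift 68 i) 'X_(rshift 17 k) A_coefs) = ev2 (u i) (v k) A_coefs.
    by rewrite ev2_rmorph /= !int_evalX join_l join_r.
  by rewrite -evE; apply: spec; rewrite evE.
have eq_card : #|J| = #|I|.
  by apply/eqP; rewrite eqn_leq subset_leq_card //= card_blocks A_roots_card.
by have /(subset_cardP eq_card)/(_ j) := sJI; rewrite !inE.
Qed.

End Incidence.

(** * Concyclic quadruples *)

Lemma blocksP i j k l : (i < 17)%N -> (j < 17)%N -> (k < 17)%N -> (l < 17)%N ->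
    uniq [:: i; j; k; l] ->
  has (fun B : seq nat => [&& i \in B, j \in B, k \in B & l \in B]) blocks = concyclic i j k l.
Proof.
move=> lt_i lt_j lt_k lt_l; rewrite !cons_uniq !inE !negb_or => /and4P[].
move=> /and3P[ij ik il] /andP[jk jl] kl _.
have := blocks_checkT; rewrite /blocks_check; cbv zeta.
move=> /allP/(_ i); rewrite mem_iota => /(_ lt_i).
move=> /allP/(_ j); rewrite mem_iota => /(_ lt_j).
have ji : (j == i) = false by rewrite eq_sym (negPf ij).
rewrite ji orFb => /allP/(_ k); rewrite mem_iota => /(_ lt_k).
rewrite [k == i]eq_sym (negPf ik) [k == j]eq_sym (negPf jk) !orFb => /allP/(_ l).
rewrite mem_iota => /(_ lt_l).
rewrite [l == i]eq_sym (negPf il) [l == j]eq_sym (negPf jl) [l == k]eq_sym (negPf kl) !orFb => /eqP.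
have nth_ratio m : (m < 17)%N -> nth 0%N [seq ratio i j k | k <- points] m = ratio i j m.
  by move=> lt_m; rewrite (nth_map 0%N) ?size_iota // nth_iota.
rewrite !nth_ratio // /concyclic /has_cr => <-.
elim: blocks => // B s IHs; rewrite [LHS]/= IHs /=; case: (i \in B) => //=.
by case: (j \in B) => //=; case: (k \in B).
Qed.

Section Quads.
Variables (L : splittingFieldType rat) (K : fieldType).
Hypothesis p0 : zr K big_prime = 0.
Hypothesis ker_zr : forall z, zr K z = 0 -> exists y, z = (big_prime * y)%Z.
Variables (iota : {rmorphism L -> algC}) (alpha : 'I_17 -> L) (y : 'I_68 -> algC).
Hypothesis P_roots : map_poly intr P_int = \prod_i ('X - (alpha i)%:P).
Hypothesis Q_roots : map_poly intr Q_int = \prod_j ('X - (y j)%:P).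
Hypothesis spec : specializes (join (iota \o alpha) y) (join (P_root_mod K) (Q_root_mod K)).

(** The coefficient list is kept abstract, since simplification would otherwise
    unfold A. *)
Definition common_factor s (R : fieldType) (x : 'I_17 -> R) (i j k l : 'I_17) :=
  let A m := evY (x m) s in
  (size (gcdp (gcdp (A i) (A j)) (gcdp (A k) (A l))) != 1)%N.

Lemma map_evY (R S : fieldType) (f : {rmorphism R -> S}) x s :
  map_poly f (evY x s) = evY (f x) s.
Proof. by rewrite !evYE ev2_rmorph /= map_polyC map_polyX. Qed.

Lemma common_factor_map s (R S : fieldType) (f : {rmorphism R -> S}) x i j k l :
  common_factor s (f \o x) i j k l = common_factor s x i j k l.
Proof. by rewrite /common_factor /= -!map_evY -!gcdp_map size_map_poly. Qed.

(** A common root in the algebraic closure is some y_j, whose block contains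
    the four points. *)
Lemma common_factorP (i j k l : 'I_17) : uniq [:: (i : nat); (j : nat); (k : nat); (l : nat)] ->
  common_factor A_coefs alpha i j k l = concyclic i j k l.
Proof.
move=> Uq; rewrite -(common_factor_map _ iota) -blocksP ?ltn_ord //.
apply/closed_rootP/hasP => [[c] | [B sB BP]].
  rewrite !root_gcd => /andP[/andP[ri rj] /andP[rk rl]].
  have: root (\prod_j ('X - (y j)%:P)) c.
    by move: ri; rewrite -!dvdp_XsubCl => /dvdp_trans; apply; apply: A_dvd_Q.
  case/(root_prod_index erefl) => m Dc; exists (nth [::] blocks m); first by rewrite mem_nth.
  by rewrite -!(incidenceP p0 ker_zr P_roots Q_roots spec) -Dc; apply/and4P.
have lt_m : (index B blocks < 68)%N by rewrite index_mem.
exists (y (Ordinal lt_m)); case/and4P: BP => Bi Bj Bk Bl.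
by rewrite !root_gcd !(incidenceP p0 ker_zr P_roots Q_roots spec) /= nth_index // Bi Bj Bk Bl.
Qed.

Let alpha_inj := alpha_inj ker_zr spec.
Let t s := gal_index P_roots s.

(** The degree of a greatest common divisor is unchanged by applying a field
    automorphism to the coefficients. *)
Lemma concyclic_gal s (i j k l : 'I_17) : uniq [:: (i : nat); (j : nat); (k : nat); (l : nat)] ->
  concyclic (t s i) (t s j) (t s k) (t s l) = concyclic i j k l.
Proof.
move=> Uq; rewrite -!common_factorP //.
  rewrite -[RHS](common_factor_map _ s alpha) /common_factor /t.
  by rewrite !gal_indexE.
have -> : [:: (t s i : nat); (t s j : nat); (t s k : nat); (t s l : nat)] =
   map val (map (t s) [:: i; j; k; l]) by [].
rewrite (map_inj_uniq val_inj) (map_inj_uniq (@gal_index_inj _ _ _ _ P_roots alpha_inj s)).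
by rewrite -(map_inj_uniq val_inj).
Qed.

End Quads.

(** * The projective line over F16 *)

Lemma add_code u v : (u < 16)%N -> (v < 16)%N ->
  [/\ (cadd u v < 16)%N, bits_of (cadd u v) = bits_add (bits_of u) (bits_of v)
    & (cadd u v == 0%N) = (u == v)].
Proof.
move=> lt_u lt_v; have /allP/(_ u) := codes_checkT; rewrite mem_iota => /(_ lt_u).
case/and4P=> _ _ _ /allP/(_ v); rewrite mem_iota => /(_ lt_v).
by case/and5P=> ? ? /eqP ? ? /eqP.
Qed.

Lemma mul_code u v : (u < 16)%N -> (v < 16)%N ->
  (cmul u v < 16)%N /\ bits_of (cmul u v) = bits_mul (bits_of u) (bits_of v).
Proof.
move=> lt_u lt_v; have /allP/(_ u) := codes_checkT; rewrite mem_iota => /(_ lt_u).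
case/and4P=> _ _ _ /allP/(_ v); rewrite mem_iota => /(_ lt_v).
by case/and5P=> ? ? ? /eqP.
Qed.

Lemma inv_code u : (u < 16)%N ->
  (cinv u < 16)%N /\ (u != 0%N -> cmul u (cinv u) = 1%N).
Proof.
move=> lt_u; have /allP/(_ u) := codes_checkT; rewrite mem_iota => /(_ lt_u).
by case/and4P=> ? /orP[-> | /eqP].
Qed.

Section F16.
Variables (F16 : finFieldType) (cardF16 : #|F16| = 16%N).

Lemma char2 : 2%N \in [pchar F16].
Proof. exact: (@card_finPcharP _ 2 4). Qed.

Lemma sqrD (x y : F16) : (x + y) ^+ 2 = x ^+ 2 + y ^+ 2.
Proof. by rewrite sqrrD mulr2n (addrr_pchar2 char2) addr0. Qed.

(** The additive map w(x) = x ^ 4 + x satisfies w ^ 4 = w, so it takes values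
    in F4, where w ^ 3 + w ^ 2 + w is 0 unless w = 1. As a polynomial in x that
    expression has degree 12 < 16, so it is not 0 for all x. *)
Lemma exists_generator : exists z : F16, z ^+ 4 == z + 1.
Proof.
pose w (x : F16) := x ^+ 4 + x.
have w4 x : w x ^+ 4 = w x.
  have D4 (a b : F16) : (a + b) ^+ 4 = a ^+ 4 + b ^+ 4.
    by rewrite !(exprM _ 2 2) !sqrD.
  by rewrite {1}/w D4 -exprM -[(4 * 4)%N]cardF16 expf_card addrC.
pose W : {poly F16} := 'X^4 + 'X.
have sW : size W = 5%N by rewrite size_polyDl ?size_polyXn ?size_polyX.
pose V := W ^+ 3 + W ^+ 2 + W.
have sX n : size (W ^+ n) = (4 * n).+1.
  have := size_exp W n; rewrite sW => <-; rewrite prednK // size_poly_gt0.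
  by rewrite expf_neq0 // -size_poly_gt0 sW.
have sV : size V = 13%N.
  have s2: size (W ^+ 2 + W) = 9%N by rewrite size_polyDl sX ?sW.
  by rewrite /V -addrA size_polyDl sX ?s2.
have [x Vx] : exists x, V.[x] != 0.
  apply/existsP; apply: contraTT isT => /existsPn V0.
  have V_neq0 : V != 0 by rewrite -size_poly_gt0 sV.
  have: all (root V) (enum F16).
    by apply/allP=> x _; move: (V0 x); rewrite negbK.
  by move/(max_poly_roots V_neq0)/(_ (enum_uniq _)); rewrite -cardE cardF16 sV.
exists x; rewrite -(inj_eq (addIr x)) addrAC (addrr_pchar2 char2) add0r -/(w x).
have {}Vx : w x ^+ 3 + w x ^+ 2 + w x != 0
  by rewrite !(hornerD, horner_exp, hornerXn, hornerX) in Vx.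
rewrite -(inj_eq (addIr 1)) (addrr_pchar2 char2).
apply/eqP/(mulfI Vx); rewrite mulr0.
transitivity (w x ^+ 4 + w x + (w x ^+ 3 + w x ^+ 2) *+ 2); first by ring.
by rewrite w4 mulr2n !(addrr_pchar2 char2).
Qed.

Variable z : F16.
Hypothesis z4 : z ^+ 4 = z + 1.

Definition ev_bits (b : bits) : F16 :=
  let: (b0, b1, b2, b3) := b in
  b0%:R + b1%:R * z + b2%:R * z ^+ 2 + b3%:R * z ^+ 3.

Definition elt (u : nat) : F16 := ev_bits (bits_of u).

Lemma natr_addb (a b : bool) : (a (+) b)%:R = a%:R + b%:R :> F16.
Proof. by case: a; case: b; rewrite ?addr0 ?add0r ?(addrr_pchar2 char2). Qed.

Lemma natr_andb (a b : bool) : (a && b)%:R = a%:R * b%:R :> F16.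
Proof. by case: a; case: b; rewrite ?mulr0 ?mulr1. Qed.

Lemma ev_bits_add a b : ev_bits (bits_add a b) = ev_bits a + ev_bits b.
Proof.
case: a => [[[a0 a1] a2] a3]; case: b => [[[b0 b1] b2] b3].
by rewrite /= !natr_addb; ring.
Qed.

Lemma ev_bits_mul a b : ev_bits (bits_mul a b) = ev_bits a * ev_bits b.
Proof.
case: a => [[[a0 a1] a2] a3]; case: b => [[[b0 b1] b2] b3].
rewrite /= !natr_addb !natr_andb.
move: {a0}(a0%:R) {a1}(a1%:R) {a2}(a2%:R) {a3}(a3%:R) => a0 a1 a2 a3.
move: {b0}(b0%:R) {b1}(b1%:R) {b2}(b2%:R) {b3}(b3%:R) => b0 b1 b2 b3.
set lhs := LHS.
transitivity ((a0 * b0) + (a0 * b1 + a1 * b0) * z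
  + (a0 * b2 + a1 * b1 + a2 * b0) * z ^+ 2
  + (a0 * b3 + a1 * b2 + a2 * b1 + a3 * b0) * z ^+ 3
  + z ^+ 4 * ((a1 * b3 + a2 * b2 + a3 * b1) + (a2 * b3 + a3 * b2) * z
     + (a3 * b3) * z ^+ 2)).
  by rewrite z4 /lhs; ring.
by ring.
Qed.

Lemma elt_add u v : (u < 16)%N -> (v < 16)%N -> elt (cadd u v) = elt u + elt v.
Proof. by move=> lt_u lt_v; rewrite /elt; case: (add_code lt_u lt_v) => _ ->; rewrite ev_bits_add. Qed.

Lemma elt_mul u v : (u < 16)%N -> (v < 16)%N -> elt (cmul u v) = elt u * elt v.
Proof. by move=> lt_u lt_v; rewrite /elt; case: (mul_code lt_u lt_v) => _ ->; rewrite ev_bits_mul. Qed.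

Lemma elt0 : elt 0 = 0. Proof. by rewrite /elt /= !mul0r !addr0. Qed.
Lemma elt1 : elt 1 = 1. Proof. by rewrite /elt /= !mul0r !addr0. Qed.

Lemma elt_eq0 u : (u < 16)%N -> (elt u == 0) = (u == 0%N).
Proof.
move=> lt_u; apply/eqP/eqP => [u0 | ->]; last exact: elt0.
apply/eqP/negPn/negP => /(proj2 (inv_code lt_u)) /(congr1 elt)/eqP.
by rewrite elt_mul ?(proj1 (inv_code lt_u)) // u0 mul0r elt1 eq_sym oner_eq0.
Qed.

Lemma elt_inv u : (u < 16)%N -> u != 0%N -> elt (cinv u) = (elt u)^-1.
Proof.
move=> lt_u u0; have [lt_i /(_ u0)/(congr1 elt)] := inv_code lt_u.
rewrite elt_mul // elt1 => ui1; have eu0 : elt u != 0 by rewrite elt_eq0.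
by apply: (mulfI eu0); rewrite ui1 mulfV.
Qed.

Lemma elt_inj u v : (u < 16)%N -> (v < 16)%N -> elt u = elt v -> u = v.
Proof.
move=> lt_u lt_v eq_uv; have [lt_w _ Duv] := add_code lt_u lt_v.
apply/eqP; rewrite -Duv -elt_eq0 // elt_add // eq_uv.
by rewrite (addrr_pchar2 char2).
Qed.

Lemma elt_surj x : exists2 u, (u < 16)%N & elt u = x.
Proof.
have elt_inj' : injective (fun u : 'I_16 => elt u).
  by move=> u v /(elt_inj (ltn_ord u) (ltn_ord v)) /val_inj.
have [|g _ gK] := inj_card_bij elt_inj'; first by rewrite card_ord cardF16.
by exists (g x); rewrite ?ltn_ord ?gK.
Qed.

Definition det2 (u v : 'cV[F16]_2) : F16 := u 0 0 * v 1 0 - u 1 0 * v 0 0.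

Definition vec (i : nat) : 'cV[F16]_2 :=
  \col_j (if i == 16%N then (j == 0)%:R else if j == 0 then elt i else 1).

Lemma vecE i : (vec i 0 0 = if i == 16%N then 1 else elt i) *
               (vec i 1 0 = if i == 16%N then 0 else 1).
Proof. by split; rewrite mxE //=. Qed.

Lemma ltn16 i : (i < 17)%N -> i != 16%N -> (i < 16)%N.
Proof. by rewrite ltnS leq_eqVlt => /orP[/eqP-> |]. Qed.

Lemma br_lt i j : (i < 17)%N -> (j < 17)%N -> (br i j < 16)%N.
Proof.
move=> /ltn16 lt_i /ltn16 lt_j; rewrite /br.
case: eqP => [_ | /eqP/lt_i {}lt_i]; first by case: eqP.
by case: eqP => // /eqP/lt_j /(add_code lt_i)[].
Qed.

Lemma elt_br i j : (i < 17)%N -> (j < 17)%N -> elt (br i j) = det2 (vec i) (vec j).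
Proof.
move=> /ltn16 lt_i /ltn16 lt_j; rewrite /br /det2 !vecE.
case: eqP => [_ | /eqP/lt_i {}lt_i].
  by case: eqP => _ /=; rewrite ?elt0 ?elt1 ?(mulr0, mul0r, mulr1, subrr, subr0).
case: eqP => [_ | /eqP/lt_j {}lt_j].
  by rewrite elt1 mulr0 mulr1 sub0r (oppr_pchar2 char2).
by rewrite elt_add // mulr1 mul1r (oppr_pchar2 char2).
Qed.

Lemma br_eq0 i j : (i < 17)%N -> (j < 17)%N -> (br i j == 0%N) = (i == j).
Proof.
move=> /ltn16 lt_i /ltn16 lt_j; rewrite /br.
case: (altP (i =P 16%N)) => [-> | i16].
  by rewrite eqb0 negbK eq_sym.
case: (altP (j =P 16%N)) => [-> | j16]; first by rewrite (negPf i16).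
by have [_ _ ->] := add_code (lt_i i16) (lt_j j16).
Qed.

Lemma ratio_lt i j k : (i < 17)%N -> (j < 17)%N -> (k < 17)%N -> (ratio i j k < 16)%N.
Proof.
move=> lt_i lt_j lt_k.
by case: (mul_code (br_lt lt_i lt_k) (proj1 (inv_code (br_lt lt_j lt_k)))).
Qed.

Lemma cinv0 : cinv 0 = 0%N. Proof. by []. Qed.

Lemma elt_ratio i j k : (i < 17)%N -> (j < 17)%N -> (k < 17)%N ->
  elt (ratio i j k) = det2 (vec i) (vec k) / det2 (vec j) (vec k).
Proof.
move=> lt_i lt_j lt_k; rewrite /ratio -!elt_br //.
rewrite elt_mul ?br_lt ?(proj1 (inv_code _)) ?br_lt //; congr (_ * _).
have [-> | nz] := eqVneq (br j k) 0%N; first by rewrite cinv0 elt0 invr0.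
by rewrite elt_inv ?br_lt.
Qed.

Lemma has_crP lam i j k l : (lam < 16)%N ->
    (i < 17)%N -> (j < 17)%N -> (k < 17)%N -> (l < 17)%N ->
  has_cr lam i j k l = [&& i != j, det2 (vec i) (vec k) / det2 (vec j) (vec k) != 0 &
    det2 (vec i) (vec k) / det2 (vec j) (vec k) ==
    elt lam * (det2 (vec i) (vec l) / det2 (vec j) (vec l))].
Proof.
move=> lt_m lt_i lt_j lt_k lt_l; rewrite /has_cr -!elt_ratio // elt_eq0 ?ratio_lt //.
congr [&& _, _ & _]; rewrite -elt_mul ?ratio_lt //.
have [lt_r _] := mul_code lt_m (ratio_lt lt_i lt_j lt_l).
by apply/eqP/eqP=> [-> // | /elt_inj->]; rewrite ?ratio_lt.
Qed.

Lemma det2_mul (M : 'M[F16]_2) u v : det2 (M *m u) (M *m v) = \det M * det2 u v.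
Proof.
rewrite (expand_det_row _ 0) !big_ord_recl big_ord0 /cofactor !det_mx11 !mxE.
rewrite /det2 !mxE !big_ord_recl !big_ord0 /=.
have -> : lift 0 0 = 1 :> 'I_2 by apply: val_inj.
have -> : lift 1 0 = 0 :> 'I_2 by apply: val_inj.
by rewrite /= !addr0 expr0 expr1; ring.
Qed.

Lemma det2_scale a b u v : det2 (a *: u) (b *: v) = a * b * det2 u v.
Proof. by rewrite /det2 !mxE; ring. Qed.

Lemma vec_neq0 i : vec i != 0.
Proof.
apply/eqP=> /colP v0; have [vi0 vi1] := vecE i.
move: (v0 0) (v0 1); rewrite !mxE -/(vec i) => {v0}.
rewrite /= ; case: eqP => _ /= /eqP; rewrite ?oner_eq0 // => _ /eqP.
by rewrite oner_eq0.
Qed.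

Lemma det2_eq0 i j : (i < 17)%N -> (j < 17)%N ->
  (det2 (vec i) (vec j) == 0) = (i == j).
Proof. by move=> lt_i lt_j; rewrite -elt_br // elt_eq0 ?br_lt // br_eq0. Qed.

Lemma ord2P (k : 'I_2) : k = 0 \/ k = 1.
Proof. by case: k => [[|[|]]] // lt_k; [left | right]; apply: val_inj. Qed.

(** Three vectors in the plane are dependent; the coefficients are the minors. *)
Lemma det2_decomp u v w :
  det2 u v *: w = det2 w v *: u + det2 u w *: v.
Proof.
by apply/colP => k; rewrite !mxE /det2; case: (ord2P k) => ->; ring.
Qed.

Definition line (i : nat) : projective_line F16.
Proof.
by exists <[vec i]>%VS; rewrite dim_vline vec_neq0.
Defined.

Lemma line_eq (U V : projective_line F16) : val U = val V -> U = V.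
Proof. exact: val_inj. Qed.

Lemma line_surj U : exists i : 'I_17, U = line i.
Proof.
have [v v_neq0 DU] : exists2 v : 'cV[F16]_2, v != 0 & val U = <[v]>%VS.
  exists (vpick (val U)); first by rewrite vpick0 -dimv_eq0 (eqP (valP U)).
  apply/esym/eqP; rewrite eqEdim (eqP (valP U)) dim_vline vpick0 -dimv_eq0.
  by rewrite (eqP (valP U)) -memvE memv_pick.
suff [i [c c0 Dv]]: exists i : 'I_17, exists2 c, c != 0 & v = c *: vec i.
  exists i; apply: line_eq; rewrite DU /= Dv.
  apply/eqP; rewrite eqEdim !dim_vline scaler_eq0 negb_or c0 vec_neq0 leqnn.
  by rewrite andbT -memvE memvZ ?memv_line.
have [v1 | v1] := eqVneq (v 1 0) 0.
  have v0 : v 0 0 != 0.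
    apply: contraNneq v_neq0 => v0; apply/eqP/colP => k; rewrite mxE.
    by case: (ord2P k) => ->.
  exists (Ordinal (isT : 16 < 17)%N), (v 0 0) => //; apply/colP => k.
  case: (ord2P k) => ->.
  - by rewrite mxE vecE mulr1.
  - by rewrite mxE vecE v1 mulr0.
have [u lt_u Du] := elt_surj (v 0 0 / v 1 0).
have lt_u17 : (u < 17)%N by apply: ltnW.
exists (Ordinal lt_u17), (v 1 0) => //; apply/colP => k.
case: (ord2P k) => ->.
- by rewrite mxE vecE /= ltn_eqF // Du mulrC divfK.
- by rewrite mxE vecE /= ltn_eqF // mulr1.
Qed.

Lemma line_inj (i j : 'I_17) : line i = line j -> i = j.
Proof.
move/(congr1 val) => /= eq_ij; apply: val_inj; apply/eqP.
rewrite -det2_eq0 ?ltn_ord //; have: vec j \in <[vec i]>%VS by rewrite eq_ij memv_line.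
case/vlineP => c ->; rewrite -{1}[vec i]scale1r det2_scale /det2.
by rewrite [vec i 1 0 * _]mulrC subrr mulr0.
Qed.

Implicit Types g h : {'GL_2[F16]}.
Let mx g : 'M[F16]_2 := GLval g.

Lemma mxM g h : mx (g * h)%g = mx g *m mx h.
Proof. by rewrite /mx GL_MxE. Qed.

Lemma mx1 : mx 1%g = 1%:M.
Proof. by rewrite /mx GL_1E. Qed.

Lemma GL2_act_line g i v c : mx g *m vec i = c *: vec v -> c != 0 ->
  GL2_act g (line i) = line v.
Proof.
move=> Dgi c0; apply: line_eq => /=; rewrite limg_line lfunE /= Dgi.
apply/eqP; rewrite eqEdim !dim_vline scaler_eq0 negb_or c0 vec_neq0 leqnn.
by rewrite andbT -memvE memvZ ?memv_line.
Qed.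

Lemma act_index g (i : 'I_17) :
  {j : 'I_17 | [exists c, (c != 0) && (mx g *m vec i == c *: vec j)]}.
Proof.
apply: sigW; have [j Dj] := line_surj (GL2_act g (line i)); exists j.
have := congr1 val Dj; rewrite /= limg_line lfunE /= => Dgj.
have: mx g *m vec i \in <[vec j]>%VS by rewrite -Dgj memv_line.
case/vlineP=> c Dc; apply/existsP; exists c; rewrite Dc eqxx andbT.
apply: contraTneq (vec_neq0 i) => c0; rewrite negbK.
by rewrite -(mulKmx (GL_unitmx g) (vec i)) Dc c0 scale0r mulmx0.
Qed.

Implicit Types i j k l : 'I_17.

(** The action on labels that corresponds to the action on lines. *)
Definition pt g i : 'I_17 := sval (act_index g i).

Lemma pt_vec g i : exists2 c, c != 0 & mx g *m vec i = c *: vec (pt g i).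
Proof. by rewrite /pt; case: act_index => j /= /existsP[c /andP[? /eqP]]; exists c. Qed.

Lemma pt_line g i : GL2_act g (line i) = line (pt g i).
Proof. by have [c c0 /GL2_act_line->] := pt_vec g i. Qed.

Lemma pt_eq g (i j : 'I_17) c : mx g *m vec i = c *: vec j -> c != 0 -> pt g i = j.
Proof. by move=> Dg c0; apply: line_inj; rewrite -pt_line (GL2_act_line Dg c0). Qed.

Lemma ptM g h i : pt (g * h)%g i = pt g (pt h i).
Proof.
have [c c0 Dh] := pt_vec h i; have [d d0 Dg] := pt_vec g (pt h i).
apply: (@pt_eq _ _ _ (c * d)); last by rewrite mulf_neq0.
rewrite mxM. rewrite -mulmxA. rewrite Dh. rewrite -scalemxAr. rewrite Dg. exact: scalerA.
Qed.

Lemma pt1 i : pt 1%g i = i.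
Proof.
apply: (@pt_eq _ _ _ 1); last by rewrite oner_eq0.
by rewrite mx1 mul1mx scale1r.
Qed.

Lemma pt_inj g : injective (pt g).
Proof. by apply: (can_inj (g := pt g^-1%g)) => i; rewrite -ptM mulVg pt1. Qed.

Lemma det2_pt g (gSL : g \in SL2 F16) : exists c : 'I_17 -> F16,
  (forall i, c i != 0) /\ forall i j : 'I_17,
  det2 (vec i) (vec j) = c i * c j * det2 (vec (pt g i)) (vec (pt g j)).
Proof.
have [c c0 cE] := fin_all_exists2 (pt_vec g).
exists c; split=> // i j; move: gSL; rewrite inE => /eqP dg.
by rewrite -det2_scale -!cE det2_mul dg mul1r.
Qed.

(** Each determinant is multiplied by a scalar for each of its two vectors, and
    these scalars cancel in the cross-ratio. *)
Lemma has_cr_pt lam g i j k l : (lam < 16)%N -> g \in SL2 F16 ->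
  has_cr lam (pt g i) (pt g j) (pt g k) (pt g l) = has_cr lam i j k l.
Proof.
move=> lt_lam /det2_pt[c [c0 detE]].
have ratE (m : 'I_17) : det2 (vec i) (vec m) / det2 (vec j) (vec m) = c i / c j *
    (det2 (vec (pt g i)) (vec (pt g m)) / det2 (vec (pt g j)) (vec (pt g m))).
  rewrite (detE i m) (detE j m) [c i * c m]mulrC [c j * c m]mulrC.
  rewrite -[c m * c i * _]mulrA -[c m * c j * _]mulrA -mulf_div divff //.
  by rewrite mul1r mulf_div.
have q0 : c i / c j != 0 by rewrite mulf_neq0 ?invr_eq0.
rewrite !has_crP ?ltn_ord // !ratE !(inj_eq val_inj) (inj_eq (@pt_inj g)).
by rewrite [in RHS]mulf_eq0 (negPf q0) /= [elt lam * (c i / c j * _)]mulrCA (inj_eq (mulfI q0)).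
Qed.

(** The columns of the matrix are multiples of the vectors of i and j, such that
    their sum is a multiple of the vector of k. The common scalar r makes the
    determinant 1; it exists since every element of F16 is a square. *)
Lemma SL2_3transitive i j k : i != j -> i != k -> j != k ->
  exists2 g, g \in SL2 F16 &
    [/\ pt g (inord 16) = i, pt g (inord 0) = j & pt g (inord 1) = k].
Proof.
move=> ne_ij ne_ik ne_jk.
set dij := det2 (vec i) (vec j); set dkj := det2 (vec k) (vec j).
set dik := det2 (vec i) (vec k).
have [dij0 dkj0 dik0]: [/\ dij != 0, dkj != 0 & dik != 0].
  by rewrite !det2_eq0 ?ltn_ord // ne_ij ne_ik [_ == _ :> nat]eq_sym ne_jk.
pose d := dkj * dik * dij; have d0 : d != 0 by rewrite !mulf_neq0.
(* In F16 the square root of x is x ^ 8, as x ^ 16 = x. *)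
pose r := d^-1 ^+ 8; have r2 : r ^+ 2 * d = 1.
  rewrite -exprM -[(8 * 2)%N]cardF16 expf_card mulVf //.
have r0 : r != 0.
  by apply: contra_eq_neq r2 => ->; rewrite expr0n mul0r eq_sym oner_eq0.
pose M : 'M[F16]_2 :=
  \matrix_(a, b) (r * (if b == 0 then dkj * vec i a 0 else dik * vec j a 0)).
have ME x : M *m x = (r * dkj * x 0 0) *: vec i + (r * dik * x 1 0) *: vec j.
  apply/colP => a; rewrite !mxE !big_ord_recl big_ord0 !mxE /=.
  have -> : lift 0 0 = 1 :> 'I_2 by apply: val_inj.
  by rewrite -!mulrA; ring.
have dM : \det M = 1.
  have d160 : det2 (vec 16) (vec 0) = 1 by rewrite /det2 !vecE mulr1 mul0r subr0.
  rewrite -[LHS]mulr1 -[in LHS]d160 -det2_mul.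
  rewrite !ME !vecE elt0 !mulr0 !mulr1 !scale0r addr0 add0r det2_scale.
  by rewrite -r2 /d; rewrite -/dij; ring.
have uM : M \in unitmx by rewrite unitmxE dM unitr1.
pose g : {'GL_2[F16]} := Sub M uM; exists g; first by rewrite inE; apply/eqP.
split.
- apply: (@pt_eq _ _ _ (r * dkj)); last by rewrite mulf_neq0.
  rewrite /mx /= ME !vecE inordK //=.
  by rewrite mulr1 mulr0 scale0r addr0.
- apply: (@pt_eq _ _ _ (r * dik)); last by rewrite mulf_neq0.
  rewrite /mx /= ME !vecE inordK //=.
  by rewrite elt0 mulr1 mulr0 scale0r add0r.
apply: (@pt_eq _ _ _ (r * dij)); last by rewrite mulf_neq0.
rewrite /mx /= ME !vecE inordK //=.
rewrite elt1 !mulr1 -(scalerA r dkj) -(scalerA r dik) -scalerDr -det2_decomp.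
exact: scalerA.
Qed.

(** Three eigenvectors in a plane, pairwise independent, have the same
    eigenvalue a, and a ^ 2 = 1 gives a = 1 in characteristic 2. *)
Lemma SL2_fix3 g i j k : g \in SL2 F16 -> i != j -> i != k -> j != k ->
  pt g i = i -> pt g j = j -> pt g k = k -> g = 1%g.
Proof.
move=> gSL ne_ij ne_ik ne_jk gi gj gk.
have [a a0 Da] := pt_vec g i; have [b b0 Db] := pt_vec g j.
have [c c0 Dc] := pt_vec g k; rewrite gi in Da; rewrite gj in Db; rewrite gk in Dc.
set dij := det2 (vec i) (vec j); set dkj := det2 (vec k) (vec j).
set dik := det2 (vec i) (vec k).
have [dij0 dkj0 dik0]: [/\ dij != 0, dkj != 0 & dik != 0].
  by rewrite !det2_eq0 ?ltn_ord // ne_ij ne_ik [_ == _ :> nat]eq_sym ne_jk.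
move: gSL; rewrite inE => /eqP dg.
have ab : a * b = 1.
  have := det2_mul (mx g) (vec i) (vec j); rewrite Da Db det2_scale dg mul1r.
  by move/(canRL (mulfK dij0)); rewrite divff.
have ac : a * c = 1.
  have := det2_mul (mx g) (vec i) (vec k); rewrite Da Dc det2_scale dg mul1r.
  by move/(canRL (mulfK dik0)); rewrite divff.
have cb : c * b = 1.
  have := det2_mul (mx g) (vec k) (vec j); rewrite Dc Db det2_scale dg mul1r.
  by move/(canRL (mulfK dkj0)); rewrite divff.
have eq_bc : b = c by apply: (mulfI a0); rewrite ab ac.
have eq_ab : a = b by apply: (mulfI c0); rewrite mulrC ac cb.
have a1 : a = 1.
  apply/eqP; rewrite -subr_eq0 -sqrf_eq0 (oppr_pchar2 char2) sqrD expr1n.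
  by rewrite expr2 {2}eq_ab ab (addrr_pchar2 char2).
have fixg (x : 'cV[F16]_2) : mx g *m x = x.
  apply: (scalerI dij0); rewrite scalemxAr /dij (det2_decomp _ _ x) mulmxDr -!scalemxAr.
  by rewrite Da Db -eq_ab a1 !scale1r.
apply: val_inj; rewrite /= -/(mx g).
apply/matrixP => x y; have := fixg (delta_mx y 0); rewrite -colE => /colP/(_ x).
by rewrite !mxE eqxx andbT.
Qed.

Lemma pt_inj2 g h i j k : g \in SL2 F16 -> h \in SL2 F16 ->
    i != j -> i != k -> j != k ->
  pt g i = pt h i -> pt g j = pt h j -> pt g k = pt h k -> g = h.
Proof.
move=> gSL hSL ne_ij ne_ik ne_jk gi gj gk; apply/eqP; rewrite eq_sym eq_mulVg1.
apply/eqP/(SL2_fix3 _ ne_ij ne_ik ne_jk).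
- exact: (@groupM _ (SL2_group F16) _ _ (groupVr hSL) gSL).
- by rewrite ptM gi -ptM mulVg pt1.
- by rewrite ptM gj -ptM mulVg pt1.
- by rewrite ptM gk -ptM mulVg pt1.
Qed.

Lemma frob_lt (i : nat) : (i < 17)%N -> (frob i < 17)%N.
Proof.
rewrite /frob; case: eqP => // /eqP i16 /ltn16/(_ i16) lt_i.
by apply: ltnW; case: (mul_code lt_i lt_i).
Qed.

Lemma vec_frob (i : nat) a : (i < 17)%N -> vec (frob i) a 0 = vec i a 0 ^+ 2.
Proof.
move=> lt_i; case: (ord2P a) => ->; rewrite !vecE /frob.
  case: (altP (i =P 16%N)) => [_ | i16]; first by rewrite /= expr1n.
  have lt16 := ltn16 lt_i i16; have [lt_ii _] := mul_code lt16 lt16.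
  by rewrite ltn_eqF // elt_mul // expr2.
case: (altP (i =P 16%N)) => [_ | i16]; first by rewrite /= expr0n.
have lt16 := ltn16 lt_i i16; have [lt_ii _] := mul_code lt16 lt16.
by rewrite ltn_eqF // expr1n.
Qed.

Lemma det2_frob (i j : nat) : (i < 17)%N -> (j < 17)%N ->
  det2 (vec (frob i)) (vec (frob j)) = det2 (vec i) (vec j) ^+ 2.
Proof.
move=> lt_i lt_j; rewrite /det2 !vec_frob // !(oppr_pchar2 char2) sqrD.
by rewrite !exprMn.
Qed.

Lemma sqr_inj : injective (fun x : F16 => x ^+ 2).
Proof.
move=> x y /eqP; rewrite -subr_eq0 (oppr_pchar2 char2) -sqrD sqrf_eq0.
by rewrite -{1}[y](oppr_pchar2 char2) subr_eq0 => /eqP.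
Qed.

Lemma has_cr_frob (lam i j k l : nat) : (lam < 16)%N ->
    (i < 17)%N -> (j < 17)%N -> (k < 17)%N -> (l < 17)%N ->
  has_cr (cmul lam lam) (frob i) (frob j) (frob k) (frob l) = has_cr lam i j k l.
Proof.
move=> lt_m lt_i lt_j lt_k lt_l; have [lt_mm _] := mul_code lt_m lt_m.
rewrite !has_crP ?frob_lt // !det2_frob // elt_mul // -!expr_div_n -expr2 -exprMn.
rewrite (inj_eq sqr_inj) sqrf_eq0; congr (_ && _).
by rewrite -!det2_eq0 ?frob_lt // det2_frob // sqrf_eq0.
Qed.

End F16.

Lemma SL2_inv (F : finFieldType) (g : {'GL_2[F]}) : g \in SL2 F -> (g^-1)%g \in SL2 F.
Proof.
rewrite !inE => /eqP dg; rewrite GL_VxE det_inv dg; apply/eqP; exact: invr1.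
Qed.

(** Restricting t to the first points of [pt_order] gives, at each stage, one of
    the partial lists retained by the search. *)
Lemma search_sound (t : nat -> nat) :
    (forall i, i < 17 -> t i < 17)%N ->
    (forall i j, i < 17 -> j < 17 -> t i = t j -> i = j)%N ->
    t 16 = 16%N -> t 0 = 0%N -> t 1 = 1%N ->
    (forall i j k l, i < 17 -> j < 17 -> k < 17 -> l < 17 ->
       uniq [:: i; j; k; l] -> concyclic (t i) (t j) (t k) (t l) = concyclic i j k l)%N ->
  exists2 c, (c < 4)%N & forall i, (i < 17)%N -> t i = iter c frob i.
Proof.
move=> t_lt t_inj t16 t0 t1 t_concyclic.
have o_lt m : (nth 0 pt_order m < 17)%N.
  have [lt_m | ?] := ltnP m (size pt_order); last by rewrite nth_default.
  by apply: (allP (isT : all (fun i => i < 17)%N pt_order)); rewrite mem_nth.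
have o_inj a b : (a < 17)%N -> (b < 17)%N -> (nth 0 pt_order a == nth 0 pt_order b) = (a == b).
  by move=> lt_a lt_b; rewrite nth_uniq.
have main n : (n <= 14)%N -> map t (take (3 + n) pt_order) \in
    iter n (fun ls => flatten (map extend ls)) [:: [:: 16; 0; 1]]%N.
  elim: n => [_ | n IHn lt_n]; first by rewrite /= t16 t0 t1 inE.
  have lt_n17 : (3 + n < 17)%N by rewrite -[17%N]/(3 + 14)%N ltn_add2l.
  rewrite iterS addnS (take_nth 0%N) // map_rcons.
  set l := map t (take (3 + n) pt_order) in IHn *.
  have sz_l : size l = (3 + n)%N by rewrite size_map size_takel // ltnW.
  have nth_l a : (a < 3 + n)%N -> nth 0%N l a = t (nth 0%N pt_order a).
    by move=> lt_a; rewrite (nth_map 0%N) ?size_takel ?(ltnW lt_n17) // nth_take.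
  apply/flatten_mapP; exists l; first exact/IHn/ltnW.
  apply/map_f; rewrite mem_filter; apply/andP; split; last first.
    by rewrite mem_iota add0n t_lt.
  apply/andP; split.
    apply/(nthP 0%N); rewrite sz_l => -[a lt_a]; rewrite nth_l //.
    move/t_inj => /(_ (o_lt _) (o_lt _)) /eqP.
    by rewrite o_inj ?(ltn_trans lt_a) // ltn_eqF.
  apply/allP=> -[[a b] c] /allpairsPdep[[a' b'] [c' [abP cP]]] [-> -> ->].
  have /allpairsPdep[a1 [b1 [aP bP]]] := abP.
  move=> [Da Db]; rewrite {}Da {}Db in cP *.
  have {}aP: (a1 < 3 + n)%N by move: aP; rewrite mem_iota add0n sz_l.
  have {}bP: (b1 < a1)%N by move: bP; rewrite mem_iota add0n.
  have {}cP: (c' < b1)%N by move: cP; rewrite mem_iota add0n.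
  have lt_b := ltn_trans bP aP; have lt_c := ltn_trans cP lt_b.
  have lt17 m : (m < 3 + n)%N -> (m < 17)%N by move/ltn_trans; apply.
  rewrite sz_l (nth_l a1) // (nth_l b1) // (nth_l c') // t_concyclic ?o_lt ?eqxx //.
  rewrite !cons_uniq !inE !o_inj ?lt_n17 ?lt17 // !negb_or.
  by rewrite (gtn_eqF bP) (gtn_eqF (ltn_trans cP bP)) (ltn_eqF aP) (gtn_eqF cP)
             (ltn_eqF lt_b) (ltn_eqF lt_c).
have := search_checkT; rewrite /search_check => /allP/(_ _ (main 14 isT))/mapP[c].
rewrite mem_iota add0n => lt_c /eq_in_map eq_t; exists c => // i lt_i.
apply: eq_t; apply: (allP (isT : all (mem pt_order) (iota 0 17))).
by rewrite mem_iota.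
Qed.

(** * Elements of the Galois group belong to the special linear group *)

Lemma zr_Z_of_int (R : comNzRingType) (m : int) : zr R (Z_of_int m) = m%:~R.
Proof. by rewrite zrE Z_of_intK. Qed.

Section CrossRatioSum.
Variable R : comNzRingType.
Implicit Types u : 'I_17 -> R.

(** Permuting four points can change their cross-ratio lam into lam + 1, so with
    a symmetric monomial the sums for the cross-ratios 2 and 3 would agree. *)
Definition cr_sum (lam : nat) u : R :=
  \sum_(i < 17) \sum_(j < 17) \sum_(k < 17) \sum_(l < 17)
    if has_cr lam i j k l then (u i * u j) ^+ 2 * (u k * u l) else 0.

Lemma eq_cr_sum lam u u' : u =1 u' -> cr_sum lam u = cr_sum lam u'.
Proof.
move=> eq_u; do 4!(apply: eq_bigr => ? _).
by case: ifP; rewrite ?eq_u.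
Qed.

Lemma cr_sum_perm lam mu (t : 'I_17 -> 'I_17) u : injective t ->
    (forall i j k l, has_cr mu (t i) (t j) (t k) (t l) = has_cr lam i j k l) ->
  cr_sum lam (u \o t) = cr_sum mu u.
Proof.
move=> t_inj clt; rewrite [RHS](reindex_inj t_inj); apply: eq_bigr => i _.
rewrite [RHS](reindex_inj t_inj); apply: eq_bigr => j _.
rewrite [RHS](reindex_inj t_inj); apply: eq_bigr => k _.
rewrite [RHS](reindex_inj t_inj); apply: eq_bigr => l _.
by rewrite clt.
Qed.
End CrossRatioSum.

Definition cr_poly (lam : nat) : {mpoly int[17]} := cr_sum lam (fun i => 'X_i).

Lemma cr_sum_rmorph (R S : comNzRingType) (f : {rmorphism R -> S}) lam u :
  f (cr_sum lam u) = cr_sum lam (f \o u).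
Proof.
do 4!(rewrite rmorph_sum; apply: eq_bigr => ? _).
by case: ifP; rewrite ?rmorph0 // !(rmorphM, rmorphXn).
Qed.

Lemma int_eval_cr_poly (R : comNzRingType) (u : 'I_17 -> R) lam :
  int_eval u (cr_poly lam) = cr_sum lam u.
Proof. by rewrite cr_sum_rmorph; apply: eq_cr_sum => i; apply: int_evalX. Qed.

Section ModValues.
Variable K : comNzRingType.
Hypothesis p0 : zr K big_prime = 0.
Let a (i : 'I_17) : K := zr K (nth 0%Z roots_mod_p i).

Lemma zr_zsum f : zr K (zsum f) = \sum_(i < 17) zr K (f i).
Proof.
rewrite -(big_mkord xpredT (fun i => zr K (f i))) /index_iota subn0 /zsum.
rewrite -/points; elim: points => [|i s IHs]; first by rewrite big_nil; apply: zr0.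
by rewrite big_cons [foldr _ _ _]/= zrD IHs.
Qed.

Lemma zr_cr_sum lam : zr K (cr_sum_mod lam) = cr_sum lam a.
Proof.
have sz : size roots_mod_p = 17 by [].
have nth_w (i j : 'I_17) : zr K (nth 0%Z (nth [::] root_products i) j) = a i * a j.
  by rewrite (nth_map 0%Z) ?sz // (nth_map 0%Z) ?sz // (zr_redp p0) zrM.
have nth_r i j (m : 'I_17) : nth 0%N [seq ratio i j k | k <- points] m = ratio i j m.
  by rewrite (nth_map 0%N) ?size_iota // nth_iota.
rewrite zr_zsum; apply: eq_bigr => i _; rewrite zr_zsum; apply: eq_bigr => j _.
case: eqP => [ij | /eqP ij].
  rewrite zr0; apply/esym/big1 => k _; apply: big1 => l _.
  by rewrite /has_cr ij eqxx.
rewrite zrM (zr_redp p0) zrM nth_w -expr2 zr_zsum mulr_sumr; apply: eq_bigr => k _.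
rewrite /= nth_r; case: eqP => [rk | /eqP rk].
  rewrite zr0 mulr0; apply/esym/big1 => l _; by rewrite /has_cr rk andbF.
rewrite zr_zsum mulr_sumr; apply: eq_bigr => l _.
rewrite nth_r /has_cr ij rk; case: eqP => _ /=; last by rewrite zr0 mulr0.
by rewrite nth_w.
Qed.

Lemma cr_sum_values :
  [/\ cr_sum 2 a = zr K (-40), cr_sum 4 a = zr K (-632),
      cr_sum 3 a = zr K (-408) & cr_sum 5 a = zr K 472].
Proof.
have := cr_sum_checkT; rewrite /cr_sum_check => /and5P[].
have val lam n : is_zero_mod (redp (cr_sum_mod lam - n)) -> cr_sum lam a = zr K n.
  move/(zr_is_zero_mod p0)/eqP; rewrite (zr_redp p0) zrB zr_cr_sum subr_eq0.
  by move/eqP.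
by do 4!move/val => ?.
Qed.
End ModValues.

Section RootBound.
Variable C : numClosedFieldType.

Lemma zr_ge0 z : (0 <= z)%Z -> 0 <= zr C z.
Proof. by move=> z0; rewrite -(Z2Nat.id z z0) zr_nat ler0n. Qed.

Lemma zr_le z w : (z <= w)%Z -> zr C z <= zr C w.
Proof. by move=> zw; rewrite -subr_ge0 -zrB zr_ge0 //; lia. Qed.

Lemma zr_lt z w : (z < w)%Z -> zr C z < zr C w.
Proof.
move=> zw; have: zr C (z + 1) <= zr C w by apply: zr_le; lia.
by apply: lt_le_trans; rewrite zrD zr1 ltrDl ltr01.
Qed.

Lemma norm_zr z : `|zr C z| = zr C (Z.abs z).
Proof.
have [z0 | z0] := Z.le_ge_cases 0 z.
  by rewrite Z.abs_eq // ger0_norm // zr_ge0.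
by rewrite Z.abs_neq // zrN ler0_norm // -[zr C z]opprK -zrN oppr_le0 zr_ge0 //; lia.
Qed.

Lemma norm_ev (x : C) s : `|ev x s| <= ev `|x| (map Z.abs s).
Proof.
elim: s => [|c s IHs] /=; first by rewrite normr0.
rewrite (le_trans (ler_normD _ _)) // norm_zr normrM lerD2l.
by rewrite ler_wpM2l.
Qed.

(** For nonnegative coefficients and a degree less than n, s(x) / x ^ n
    decreases with x. *)
Lemma ev_homog (x b : C) s n : 0 <= b -> b <= x -> (size s <= n)%N ->
  ev x (map Z.abs s) * b ^+ n <= ev b (map Z.abs s) * x ^+ n.
Proof.
move=> b0 bx; have x0 := le_trans b0 bx.
elim: s n => [|c s IHs] [|n] //=; rewrite ?mul0r //.
move=> /IHs{}IHs; rewrite !mulrDl lerD //.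
  by rewrite ler_wpM2l ?zr_ge0 //; [lia | apply: lerXn2r].
rewrite !exprS mulrACA [leRHS]mulrACA [x * b]mulrC.
by rewrite ler_wpM2l ?mulr_ge0.
Qed.

(** 8 ^ 17 exceeds the sum of the absolute values of the lower terms at 8. *)
Lemma root_bound (x : C) : ev x P_coefs = 0 -> `|x| < 8.
Proof.
rewrite ev_P_low => Px.
have real_x : `|x| \is Num.real by rewrite normr_real.
rewrite real_ltNge ?realn //; apply/negP => ge_x8.
have: `|x| ^+ 17 <= ev `|x| (map Z.abs P_low).
  rewrite -normrX (le_trans _ (norm_ev x _)) //.
  by rewrite -[17%N]/(size P_low) (_ : x ^+ _ = - ev x P_low) ?normrN //; apply/eqP; rewrite -addr_eq0 Px.
have := @ev_homog `|x| 8 P_low 17 (ler0n _ _) ge_x8 isT.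
have x17 : 0 < `|x| ^+ 17 by rewrite exprn_gt0 // (lt_le_trans _ ge_x8).
have lt8 : ev (8 : C) (map Z.abs P_low) < 8 ^+ 17.
  have -> : 8 = zr C 8 by rewrite -[8%Z]/(Z.of_nat 8) zr_nat.
  have -> s : ev (zr C 8) s = zr C (foldr (fun c v => c + 8 * v)%Z 0%Z s).
    elim: s => [|c s IHs]; first by rewrite zr0.
    by rewrite [LHS]/= IHs -zrM -zrD.
  have -> : zr C 8 ^+ 17 = zr C (8 ^ 17).
    have zrX n : zr C 8 ^+ n = zr C (8 ^ Z.of_nat n).
      elim: n => [|n IHn]; first by rewrite zr1.
      by rewrite exprS IHn -zrM -Z.pow_succ_r ?Nat2Z.inj_succ //; lia.
    exact: zrX.
  exact: zr_lt.
move=> le1 le2; have: `|x| ^+ 17 * 8 ^+ 17 < 8 ^+ 17 * `|x| ^+ 17.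
  apply: (le_lt_trans (ler_wpM2r _ le2)); first by rewrite exprn_ge0.
  by apply: (le_lt_trans le1); rewrite ltr_pM2r.
by rewrite mulrC ltxx.
Qed.

Lemma cr_sum_bound lam (u : 'I_17 -> C) : (forall i, `|u i| <= 8) ->
  `|cr_sum lam u| <= zr C (17 ^ 4 * 8 ^ 6).
Proof.
have zr8 : zr C 8 = 8 by rewrite -[8%Z]/(Z.of_nat 8) zr_nat.
rewrite -zr8 => u8.
have bound (f : 'I_17 -> C) m : (forall i, `|f i| <= zr C m) ->
    `|\sum_i f i| <= zr C (17 * m).
  move=> le_f; rewrite (le_trans (ler_norm_sum _ _ _)) //.
  rewrite (le_trans (ler_sum _ (fun i _ => le_f i))) //.
  by rewrite sumr_const card_ord zrM -[17%Z]/(Z.of_nat 17) zr_nat mulr_natl.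
apply: (@bound _ (17 * (17 * (17 * 8 ^ 6)))%Z) => i.
apply: (@bound _ (17 * (17 * 8 ^ 6))%Z) => j.
apply: (@bound _ (17 * 8 ^ 6)%Z) => k; apply: bound => l.
have -> : zr C (8 ^ 6) = (zr C 8 * zr C 8) ^+ 2 * (zr C 8 * zr C 8).
  by rewrite -!zrM expr2 -!zrM.
have zr8_ge0 : 0 <= zr C 8 by rewrite zr8.
case: ifP => _; last by rewrite normr0 !mulr_ge0.
have le8 m m' : `|u m| * `|u m'| <= zr C 8 * zr C 8 by apply: ler_pM.
rewrite !(normrM, normrX); apply: ler_pM (le8 k l); rewrite ?exprn_ge0 ?mulr_ge0 //.
by apply: ler_pM (le8 i j) (le8 i j); apply: mulr_ge0.
Qed.

End RootBound.

Section Pair.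
Variables (L : splittingFieldType rat) (K : fieldType) (n : nat).
Hypothesis p0 : zr K big_prime = 0.
Hypothesis ker_zr : forall z, zr K z = 0 -> exists y, z = (big_prime * y)%Z.
Variables (iota : {rmorphism L -> algC}) (f : {poly int}) (alpha : 'I_n -> L) (a : 'I_n -> K).
Hypothesis f_monic : f \is monic.
Hypothesis f_roots : map_poly intr f = \prod_i ('X - (alpha i)%:P).
Hypothesis spec : specializes alpha a.
Let G := 'Gal({:L} / 1%VS)%g.

(** The integer is divisible by p, and less than p in absolute value. *)
Lemma small_int (m : int) (h : {mpoly int[n]}) :
    int_eval alpha h = m%:~R -> int_eval a h = 0 ->
    `|iota (int_eval alpha h)| < zr algC big_prime ->
  int_eval alpha h = 0.
Proof.
move=> Dm h0; have: int_eval a (h - m%:~R) = 0.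
  by apply: spec; rewrite rmorphB rmorph_int /= Dm subrr.
rewrite rmorphB rmorph_int /= h0 sub0r => /eqP.
rewrite oppr_eq0 -zr_Z_of_int => /eqP/ker_zr[w Dw].
rewrite Dm rmorph_int -!zr_Z_of_int Dw zrM normrM norm_zr => lt_p.
suff -> : w = 0%Z by rewrite Z.mul_0_r zr0.
have pos_p : 0 < zr algC big_prime by rewrite -[0](zr0 algC); apply: zr_lt.
apply/Z.abs_0_iff/Z.le_antisymm; last exact: Z.abs_nonneg.
apply/Z.nlt_ge => w1; have: zr algC 1 <= zr algC (Z.abs w) by apply: zr_le; lia.
rewrite zr1 -norm_zr => w1'; move: lt_p.
have -> : Z.abs big_prime = big_prime by [].
by rewrite -[ltRHS]mulr1 ltr_pM2l // => /lt_le_trans/(_ w1'); rewrite ltxx.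
Qed.

(** The product (H1 - z)(H2 - z) is a rational integer that vanishes mod p, so
    it is 0; as H2 differs from z mod p, H1 = z is fixed by the group. *)
Lemma conjugate_pair (h1 h2 : {mpoly int[n]}) (z : Z) :
    let H1 := int_eval alpha h1 in let H2 := int_eval alpha h2 in
    (forall s, s \in G -> (s H1 = H1 /\ s H2 = H2) \/ (s H1 = H2 /\ s H2 = H1)) ->
    int_eval a h1 = zr K z -> int_eval a h2 != zr K z ->
    `|iota H1 - zr algC z| * `|iota H2 - zr algC z| < zr algC big_prime ->
  forall s, s \in G -> s H1 != H2.
Proof.
move=> H1 H2 swap a1 a2 small.
have zE (R : comNzRingType) (u : 'I_n -> R) h :
    int_eval u (h - zr _ z) = int_eval u h - zr R z.
  by rewrite rmorphB /= zr_rmorph.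
have H2z : H2 != zr L z.
  apply: contraNneq a2 => H2z; rewrite -subr_eq0 -zE; apply/eqP/spec.
  by rewrite zE -/H2 H2z subrr.
have hE (R : comNzRingType) (u : 'I_n -> R) :
    int_eval u ((h1 - zr _ z) * (h2 - zr _ z)) =
    (int_eval u h1 - zr R z) * (int_eval u h2 - zr R z).
  by rewrite rmorphM /= !zE.
have [s Gs | m Dm] := gal_fixed_int f_monic f_roots (h := (h1 - zr _ z) * (h2 - zr _ z)).
  rewrite hE rmorphM !rmorphB /= !zr_rmorph -/H1 -/H2.
  by case: (swap s Gs) => -[-> ->] //; rewrite mulrC.
have := small_int Dm; rewrite !hE a1 subrr mul0r => /(_ erefl).
rewrite rmorphM !rmorphB /= zr_rmorph normrM => /(_ small)/eqP.
rewrite mulf_eq0 !subr_eq0 -/H1 -/H2 (negPf H2z) orbF => /eqP H1z s Gs.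
by rewrite H1z zr_rmorph eq_sym.
Qed.
End Pair.

Section UpperBound.
Variables (L : splittingFieldType rat) (K : fieldType).
Hypothesis p0 : zr K big_prime = 0.
Hypothesis ker_zr : forall z, zr K z = 0 -> exists y, z = (big_prime * y)%Z.
Variables (iota : {rmorphism L -> algC}) (alpha : 'I_17 -> L).
Hypothesis P_roots : map_poly intr P_int = \prod_i ('X - (alpha i)%:P).
Hypothesis spec : specializes alpha (P_root_mod K).
Let G := 'Gal({:L} / 1%VS)%g.
Let t s := gal_index P_roots s.
Hypothesis concyclic_gal : forall s (i j k l : 'I_17),
  uniq [:: (i : nat); (j : nat); (k : nat); (l : nat)] ->
  concyclic (t s i) (t s j) (t s k) (t s l) = concyclic i j k l.
Variables (F16 : finFieldType) (cardF16 : #|F16| = 16%N) (z : F16).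
Hypothesis z4 : z ^+ 4 = z + 1.
Let alpha_inj := specializes_inj (P_root_mod_inj ker_zr) spec.
Let pt := pt cardF16 z4.

(** Correct s by the element of SL2 with the same effect on infinity, 0, 1; the
    result preserves concyclicity, so the search applies. *)
Lemma gal_semilinear s : exists2 g, g \in SL2 F16 &
  exists2 c, (c < 4)%N & forall i j : 'I_17, (j : nat) = iter c frob i -> t s i = pt g j.
Proof.
have t_inj : injective (t s) by apply: gal_index_inj.
have ne (i j : nat) : i != j -> (i < 17)%N -> (j < 17)%N -> t s (inord i) != t s (inord j).
  by move=> ij lt_i lt_j; rewrite (inj_eq t_inj) -val_eqE /= !inordK.
have [g gSL [g16 g0 g1]] := SL2_3transitive cardF16 z4
  (ne 16%N 0%N isT isT isT) (ne 16%N 1%N isT isT isT) (ne 0%N 1%N isT isT isT).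
exists g => //; pose t' (i : nat) : nat := pt g^-1%g (t s (inord i)).
have gK i : pt g^-1%g (pt g i) = i by rewrite /pt -ptM mulVg pt1.
have gVSL := SL2_inv gSL.
have [||||||c lt_c Dc] := @search_sound t'.
- by move=> i _; apply: ltn_ord.
- move=> i j lt_i lt_j /val_inj/pt_inj/t_inj/(congr1 val).
  by rewrite /= !inordK.
- by rewrite /t' -g16 gK inordK.
- by rewrite /t' -g0 gK inordK.
- by rewrite /t' -g1 gK inordK.
- move=> i j k l lt_i lt_j lt_k lt_l Uq; rewrite /t' /concyclic !has_cr_pt // -/(concyclic _ _ _ _) concyclic_gal !inordK //.
exists c => // i j Dj; apply: (@pt_inj _ cardF16 z z4 g^-1%g); rewrite -/pt gK.
by apply: val_inj; rewrite [RHS]Dj -Dc ?ltn_ord // /t' inord_val.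
Qed.

Lemma has_cr_iter_frob c lam i j k l : (lam < 16)%N ->
    (i < 17)%N -> (j < 17)%N -> (k < 17)%N -> (l < 17)%N ->
  has_cr (iter c (fun m => cmul m m) lam)
     (iter c frob i) (iter c frob j) (iter c frob k) (iter c frob l) = has_cr lam i j k l.
Proof.
elim: c lam i j k l => // c IHc lam i j k l lt_lam lt_i lt_j lt_k lt_l.
have [lt_sq _] := mul_code lt_lam lt_lam.
by rewrite !iterSr IHc ?frob_lt ?(has_cr_frob cardF16 z4).
Qed.

Lemma gal_cr_sum s : exists2 g, g \in SL2 F16 & exists c,
  [/\ (c < 4)%N, c = 0%N -> forall i, pt g i = t s i
    & forall lam, (lam < 16)%N -> s (cr_sum lam alpha) =
        cr_sum (iter c (fun m => cmul m m) lam) alpha].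
Proof.
have [g gSL [c lt_c Dt]] := gal_semilinear s; exists g => //; exists c; split=> //.
  by move=> c0 i; rewrite -(Dt i i) // c0.
have lt_fr (i : 'I_17) : (iter c frob i < 17)%N.
  by elim: c {lt_c Dt} => [|c IHc] //=; apply: frob_lt.
move=> lam lt_lam; rewrite cr_sum_rmorph.
have t_inj : injective (t s) by apply: gal_index_inj.
rewrite -(@cr_sum_perm _ lam _ (t s) alpha t_inj) => [|i j k l].
  by apply: eq_cr_sum => i /=; rewrite gal_indexE.
have Dts (m : 'I_17) : t s m = pt g (Ordinal (lt_fr m)) by apply: Dt.
rewrite !Dts /pt has_cr_pt //; first by rewrite -[RHS](has_cr_iter_frob c).
by elim: c {lt_c Dt lt_fr Dts} => //= c IHc; case: (mul_code IHc IHc).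
Qed.

Let F lam := int_eval alpha (cr_poly lam).

Lemma norm_F lam : `|iota (F lam)| <= zr algC (17 ^ 4 * 8 ^ 6).
Proof.
rewrite /F int_eval_cr_poly cr_sum_rmorph; apply: cr_sum_bound => i /=.
apply/ltW/root_bound; rewrite -ev_rmorph.
suff -> : ev (alpha i) P_coefs = 0 by rewrite rmorph0.
by apply/eqP; rewrite -root_P_int P_roots (bigD1 i) //= rootM root_XsubC eqxx.
Qed.

Lemma small_product (x y : algC) b c : `|x| <= zr algC b -> `|y| <= zr algC b ->
    (0 <= b)%Z -> (0 <= c)%Z -> ((b + c) * (b + c) < big_prime)%Z ->
  `|x - zr algC (- c)| * `|y - zr algC (- c)| < zr algC big_prime.
Proof.
move=> le_x le_y b0 c0 lt_p.
have le u : `|u| <= zr algC b -> `|u - zr algC (- c)| <= zr algC (b + c).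
  move=> le_u; rewrite zrN opprK zrD (le_trans (ler_normD _ _)) // lerD //.
  by rewrite norm_zr Z.abs_eq.
apply: (le_lt_trans (ler_pM _ _ (le _ le_x) (le _ le_y))) => //.
by rewrite -zrM zr_lt.
Qed.

(** An odd power of Frobenius would exchange F 2 + F 3 with F 4 + F 5, and its
    square would exchange F 2 with F 3; these values differ mod p. *)
Theorem gal_in_SL2 s : s \in G -> exists2 g, g \in SL2 F16 & forall i, pt g i = t s i.
Proof.
have [v2 v4 v3 v5] := cr_sum_values p0.
have FE r lam c : (lam < 16)%N ->
    (forall lam, (lam < 16)%N -> r (cr_sum lam alpha) =
        cr_sum (iter c (fun m => cmul m m) lam) alpha) ->
    r (F lam) = F (iter c (fun m => cmul m m) lam).
  by move=> lt_lam Dr; rewrite /F !int_eval_cr_poly Dr.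
have act (r : gal_of {:L}) : exists c, [/\ (c < 4)%N,
    exists2 g, g \in SL2 F16 & c = 0%N -> forall i, pt g i = t r i &
    [/\ r (F 2) = F (iter c (fun m => cmul m m) 2%N),
        r (F 4) = F (iter c (fun m => cmul m m) 4%N),
        r (F 3) = F (iter c (fun m => cmul m m) 3%N) &
        r (F 5) = F (iter c (fun m => cmul m m) 5%N)]].
  have [g gSL [c [lt_c c0 Dr]]] := gal_cr_sum r; exists c; split=> //.
    by exists g.
  by split; apply: FE.
have vE lam m : cr_sum lam (fun i : 'I_17 => zr K (nth 0%Z roots_mod_p i)) = zr K m ->
  int_eval (P_root_mod K) (cr_poly lam) = zr K m by rewrite int_eval_cr_poly.
move/vE in v2; move/vE in v3; move/vE in v4; move/vE in v5.
(* Mod p, F 2 + F 3 = -448 and F 4 + F 5 = -160. *)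
have no_odd r : r \in G -> r (F 2 + F 3) != F 4 + F 5.
  move=> Gr; have := @conjugate_pair L K 17 ker_zr iota P_int alpha (P_root_mod K)
    P_int_monic P_roots spec (cr_poly 2 + cr_poly 3) (cr_poly 4 + cr_poly 5) (-448)%Z.
  rewrite !(rmorphD (int_eval _)) /= -/(F 2) -/(F 3) -/(F 4) -/(F 5); apply=> //.
  - move=> r' _; have [c [lt_c _ [D2 D4 D3 D5]]] := act r'.
    rewrite !rmorphD /= D2 D3 D4 D5.
    by case: c lt_c {D2 D3 D4 D5} => [|[|[|[|]]]] //= _;
       [left | right | left | right]; split; rewrite // addrC.
  - by rewrite v2 v3 -zrD.
  - rewrite v4 v5 -zrD -subr_eq0 -zrB; exact: zr_neq0.
  have le_sum l m : `|iota (F l + F m)| <= zr algC (2 * (17 ^ 4 * 8 ^ 6)).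
    have -> : (2 * (17 ^ 4 * 8 ^ 6) = 17 ^ 4 * 8 ^ 6 + 17 ^ 4 * 8 ^ 6)%Z by [].
    rewrite rmorphD zrD; apply: le_trans (ler_normD _ _) _.
    by apply: lerD; apply: norm_F.
  by apply: (@small_product _ _ _ 448%Z (le_sum _ _) (le_sum _ _)).
have no_two r : r \in G -> r (F 2) != F 3.
  move=> Gr; apply: (@conjugate_pair L K 17 ker_zr iota P_int alpha (P_root_mod K)
    P_int_monic P_roots spec (cr_poly 2) (cr_poly 3) (-40)%Z) => //.
  - rewrite -/(F 2) -/(F 3) => r' Gr'; have [c [lt_c _ [D2 D4 D3 D5]]] := act r'.
    have := no_odd r' Gr'; rewrite rmorphD /= D2 D3.
    case: c lt_c {D2 D3 D4 D5} => [|[|[|[|]]]] //= _; [by left | | by right |].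
      by rewrite eqxx.
    by rewrite addrC eqxx.
  - rewrite v3 -subr_eq0 -zrB -oppr_eq0 -zrN; exact: zr_neq0.
  by apply: (@small_product _ _ _ 40%Z (norm_F _) (norm_F _)).
move=> Gs; have [c [lt_c [g gSL c0] [D2 D4 D3 D5]]] := act s; exists g => //; apply: c0.
have := no_odd s Gs; have := no_two s Gs; rewrite rmorphD /= D2 D3.
case: c lt_c {D2 D3 D4 D5} => [|[|[|[|]]]] //= _; rewrite ?eqxx //.
by rewrite addrC eqxx.
Qed.

End UpperBound.

(** * Frobenius elements at 5 and 7 *)

Lemma zrN1 (R : comNzRingType) : zr R (-1)%Z = -1.
Proof. by rewrite -[(-1)%Z]/(Z.opp 1) zrN zr1. Qed.

Section ModQTheory.
Variables (q : nat) (K : fieldType).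
Hypothesis charK : q \in [pchar K].

Let q_gt0 : (0 < q)%N. Proof. by rewrite prime_gt0 // (pcharf_prime charK). Qed.

Lemma zr_mod c : zr K (c mod Z.of_nat q)%Z = zr K c.
Proof.
have q0 : zr K (Z.of_nat q) = 0 by rewrite zr_nat (pcharf0 charK).
rewrite Z.mod_eq; first by rewrite zrB zrM q0 mul0r subr0.
by move: q_gt0; case: (q).
Qed.

Lemma ev_modq (x : K) s : ev x (modq q s) = ev x s.
Proof. by elim: s => //= c s ->; rewrite zr_mod. Qed.

Lemma vanishesP (x : K) s : vanishes q s -> ev x s = 0.
Proof.
rewrite /vanishes -(ev_modq x); elim: (modq q s) => // c t IHt /andP[/ZeqbP <- /IHt].
by rewrite [ev x (_ :: _)]/= zr0 add0r => ->; rewrite mulr0.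
Qed.

Lemma bezoutP (x : K) u s v t w : bezout q u s v t w ->
  ev x s = 0 -> ev x t = 0 -> ev x w = 0.
Proof.
move=> /(vanishesP x) ok s0 t0; move: ok.
rewrite !ev_padd !ev_pmul ev_pscale s0 t0 !mulr0 !add0r => /eqP; rewrite zrN1 mulN1r oppr_eq0.
by move/eqP.
Qed.

Variable x : K.
Hypothesis Px : ev x P_coefs = 0.

Lemma mulx_modP s : (size s <= 17)%N ->
  (size (mulx_mod q s) <= 17)%N /\ ev x (mulx_mod q s) = x * ev x s.
Proof.
move=> le_s; have sz : size (modq q P_low) = 17%N by rewrite size_map.
rewrite /mulx_mod; split; first by rewrite size_map -sz size_pmulx ?sz.
by rewrite ev_modq ev_pmulx ?sz // ev_modq -[17%N]/(size P_low) -ev_P_low.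
Qed.

Lemma iter_mulx_modP n s : (size s <= 17)%N ->
  (size (iter n (mulx_mod q) s) <= 17)%N /\ ev x (iter n (mulx_mod q) s) = x ^+ n * ev x s.
Proof.
move=> le_s; elim: n => [|n [/mulx_modP[le_n En] IHn]]; first by rewrite mul1r.
by rewrite iterS le_n En IHn exprS mulrA.
Qed.

Lemma frob_modP s : (size s <= 17)%N ->
  (size (frob_mod q s) <= 17)%N /\ ev x (frob_mod q s) = ev (x ^+ q) s.
Proof.
rewrite /frob_mod size_map ev_modq /frob_table => le_s.
suff main n t : (size s <= n)%N -> (size t <= 17)%N ->
    let r := foldr padd [::] [seq pscale ct.1 ct.2 |
      ct <- zip s (traject (iter q (mulx_mod q)) t n)] in
    (size r <= 17)%N /\ ev x r = ev (x ^+ q) s * ev x t.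
  by have [-> ->] := main 17%N [:: 1%Z] le_s isT; split; rewrite //= zr1 mulr0 addr0 mulr1.
elim: s n t {le_s} => [|c s IHs] [|n] t //=; first by rewrite mul0r.
  by rewrite mul0r.
rewrite ltnS => le_s le_t; have [le_qt Eqt] := iter_mulx_modP q le_t.
have [le_r Er] := IHs _ _ le_s le_qt.
by rewrite size_padd geq_max size_map le_t le_r ev_padd ev_pscale Er Eqt mulrDl mulrCA mulrA.
Qed.

(** The size is part of the statement because the table has 17 rows only. *)
Lemma frob_iterP n : (size (frob_iter q n) <= 17)%N /\ ev x (frob_iter q n) = x ^+ (q ^ n).
Proof.
elim: n => [|n [/frob_modP[le_n En] IHn]].
  by rewrite /= zr0 zr1 mulr0 addr0 add0r mulr1.
rewrite /frob_iter iterS le_n En; split=> //.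
by rewrite -(ev_rmorph (pFrobenius_aut charK)) /= IHn pFrobenius_autE -exprM mulnC expnS.
Qed.

Lemma periodP n : period_check q n -> x ^+ (q ^ n) = x.
Proof.
move/(vanishesP x)/eqP; rewrite ev_padd (proj2 (frob_iterP n)) /= zr0 add0r mulr0 addr0.
by rewrite zrN1 mulrN1 subr_eq0 => /eqP.
Qed.

Lemma fixedP n u v w : fixed_check q n u v w -> x ^+ (q ^ n) = x -> ev x w = 0.
Proof.
move=> /bezoutP ok xq; apply: ok Px; rewrite ev_padd (proj2 (frob_iterP n)) xq /=.
by rewrite zr0 zrN1 mulr0 addr0 add0r mulrN1 subrr.
Qed.

End ModQTheory.

Lemma deriv_ev (R : comNzRingType) s (x : R) :
  ((map_poly intr (zpoly s))^`()).[x] = ev x (pderiv s).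
Proof.
rewrite map_zpoly; elim: s => [|c s IHs] /=; first by rewrite deriv0 horner0.
rewrite cons_poly_def derivD derivM derivX derivC mulr1 addr0 hornerD hornerM hornerX IHs.
by rewrite ev_padd /= zr0 add0r -map_zpoly horner_zpoly addrC [x * _]mulrC.
Qed.

(** At a double root P and its derivative vanish, so the Bezout identity would
    give 1 = 0. *)
Lemma separableP q (K : fieldType) u v (a : 'I_17 -> K) : q \in [pchar K] ->
    separable_check q u v -> map_poly intr P_int = \prod_i ('X - (a i)%:P) ->
  injective a.
Proof.
move=> charK ok Da i j eq_ij; apply/eqP/negPn/negP => ne_ij.
have Pa : ev (a i) P_coefs = 0.
  by apply/eqP; rewrite -root_P_int Da (bigD1 i) //= rootM root_XsubC eqxx.
suff /(bezoutP charK ok)/(_ Pa)/eqP : ev (a i) (pderiv P_coefs) = 0.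
  by rewrite /= zr1 mulr0 addr0 oner_eq0.
rewrite -deriv_ev -/P_int Da (bigD1 i) //= (bigD1 j) 1?eq_sym //= -eq_ij.
by rewrite derivM hornerD !hornerM !hornerXsubC subrr !(mul0r, mulr0) addr0.
Qed.

Section FrobeniusElement.
Variables (L : splittingFieldType rat) (alpha : 'I_17 -> L).
Hypothesis P_roots : map_poly intr P_int = \prod_i ('X - (alpha i)%:P).
Hypothesis alpha_inj : injective alpha.

(** The roots are taken in the algebraic closure of the field with q elements
    and numbered as in [specialization]. *)
Lemma frobenius_element q u v : prime q -> separable_check q u v ->
  exists (K : fieldType) (a : 'I_17 -> K) (s : gal_of {:L}),
    [/\ q \in [pchar K], injective a,
        map_poly intr P_int = \prod_i ('X - (a i)%:P),
        s \in 'Gal({:L} / 1%VS)%g & forall i, a i ^+ q = a (gal_index P_roots s i)].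
Proof.
move=> q_pr ok.
have [K [f _]] := countable_algebraic_closure ('F_q : countFieldType).
have charK : q \in [pchar K].
  by rewrite (fmorph_pchar f) pchar_Fp.
have [rs Drs] := closed_field_poly_normal (map_poly intr P_int : {poly K}).
rewrite (monicP (monic_map _ P_int_monic)) scale1r in Drs.
have {}Drs := split_roots P_int_monic size_P_int Drs.
have char0 (m : int) : m%:~R = 0 :> L -> m = 0.
  by move/eqP; rewrite -scaler_int scaler_eq0 oner_eq0 orbF intr_eq0 => /eqP.
have [p spec] := specialization char0 P_roots Drs.
pose a i := rs`_(p^-1%g i); have spec_a : specializes alpha a.
  move=> h h0; rewrite -[RHS](spec (msym p^-1%g h)) /=.
    by rewrite int_eval_msym.
  by rewrite int_eval_msym -[RHS]h0; apply: eq_mmap => i /=; rewrite permKV.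
have Da : map_poly intr P_int = \prod_i ('X - (a i)%:P).
  by rewrite Drs (reindex_inj (@perm_inj _ p^-1%g)).
have [s Gs Ds] := gal_frobenius P_int_monic P_roots alpha_inj charK spec_a.
by exists K, a, s; split=> //; apply: separableP ok Da.
Qed.

Let t := gal_index P_roots.

Lemma galX_index s n i : t (s ^+ n)%g i = iter n (t s) i.
Proof.
elim: n => [|n IHn]; apply: alpha_inj; first by rewrite gal_indexE gal_id.
by rewrite iterS -IHn !gal_indexE expgSr galM ?memvf.
Qed.

Lemma frobenius_iter q (K : fieldType) (a : 'I_17 -> K) s :
    (forall i, a i ^+ q = a (t s i)) ->
  forall n i, a i ^+ (q ^ n) = a (t (s ^+ n)%g i).
Proof.
move=> Ds n i; rewrite galX_index; elim: n => [|n IHn]; first by rewrite expr1.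
by rewrite expnSr exprM IHn Ds iterS.
Qed.

Lemma frobenius5 : exists2 s, s \in 'Gal({:L} / 1%VS)%g &
  forall i, t (s ^+ 17)%g i = i /\ t s i != i.
Proof.
have [K [a [s [charK P_root_mod_inj Da Gs Ds]]]] := frobenius_element (isT : prime 5) separable5.
exists s => // i; have DsX := frobenius_iter Ds.
have Pa : ev (a i) P_coefs = 0.
  by apply/eqP; rewrite -root_P_int Da (bigD1 i) //= rootM root_XsubC eqxx.
split; first by apply: P_root_mod_inj; rewrite -DsX (periodP charK Pa period5).
apply/eqP=> ti; have := fixedP charK Pa fixed5.
rewrite (DsX 1%N) expg1 ti => /(_ erefl)/eqP.
by rewrite /= zr1 mulr0 addr0 oner_eq0.
Qed.

Lemma frobenius7 : exists2 s, s \in 'Gal({:L} / 1%VS)%g &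
  exists i0 i1, [/\ i0 != i1, t s i0 = i0, t s i1 = i1,
    forall i, t (s ^+ 15)%g i = i &
    forall i, i != i0 -> i != i1 -> t (s ^+ 3)%g i != i /\ t (s ^+ 5)%g i != i].
Proof.
have [K [a [s [charK P_root_mod_inj Da Gs Ds]]]] := frobenius_element (isT : prime 7) separable7.
exists s => //; have DsX := frobenius_iter Ds.
have Pa i : ev (a i) P_coefs = 0.
  by apply/eqP; rewrite -root_P_int Da (bigD1 i) //= rootM root_XsubC eqxx.
have root_mod m : (foldr (fun c v => c + m * v) 0 P_coefs mod 7 = 0)%Z ->
    exists2 i, a i = zr K m & t s i = i.
  move=> Pm; have : root (map_poly intr P_int) (zr K m).
    rewrite root_P_int; set w := foldr _ _ _ in Pm.
    have -> : ev (zr K m) P_coefs = zr K w.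
      by rewrite /w; elim: P_coefs => [|c l IHl]; rewrite ?zr0 // [LHS]/= IHl -zrM -zrD.
    by rewrite -(zr_mod charK) -[Z.of_nat 7]/7%Z Pm zr0.
  case/(root_prod_index Da) => i Di; exists i => //; apply: P_root_mod_inj.
  by rewrite -Ds -Di; apply: (zr_rmorph (pFrobenius_aut charK)).
have [i0 D0 fix0] := root_mod 3%Z erefl; have [i1 D1 fix1] := root_mod 5%Z erefl.
have only n u v i : fixed_check 7 n u v [:: 15; -8; 1]%Z ->
    i != i0 -> i != i1 -> t (s ^+ n)%g i != i.
  move=> ok ne0 ne1; apply/eqP => fix_i; have := fixedP charK (Pa i) ok.
  rewrite DsX fix_i => /(_ erefl)/eqP.
  have -> : ev (a i) [:: 15; -8; 1]%Z = (a i - a i0) * (a i - a i1).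
    have z15 : zr K 15 = zr K 3 * zr K 5 by rewrite -zrM.
    have z8 : zr K (-8) = - (zr K 3 + zr K 5) by rewrite -zrD -zrN.
    by rewrite D0 D1 /= z15 z8 zr1; ring.
  by rewrite mulf_eq0 !subr_eq0 !(inj_eq P_root_mod_inj) (negPf ne0) (negPf ne1).
exists i0, i1; split=> // [|i|i ne0 ne1].
- apply/eqP=> eq01; have /eqP: zr K (3 - 5) = 0 by rewrite zrB -D0 -D1 eq01 subrr.
  rewrite -[(3 - 5)%Z]/(Z.opp 2) zrN oppr_eq0 -[2%Z]/(Z.of_nat 2) zr_nat.
  by rewrite -(dvdn_pcharf charK).
- by apply: P_root_mod_inj; rewrite -DsX (periodP charK (Pa i) period7).
by split; [apply: only fixed7_3 _ _ | apply: only fixed7_5 _ _].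
Qed.

End FrobeniusElement.

(** * The Galois group *)

Section Conclusion.
Variables (L : splittingFieldType rat) (alpha : 'I_17 -> L).
Hypothesis P_roots : map_poly intr P_int = \prod_i ('X - (alpha i)%:P).
Hypothesis alpha_inj : injective alpha.
Hypothesis splitL : splittingFieldFor 1%VS (map_poly (in_alg L) P) {:L}.
Variables (F16 : finFieldType) (cardF16 : #|F16| = 16%N) (z : F16).
Hypothesis z4 : z ^+ 4 = z + 1.
Let G := ('Gal({:L} / 1%VS))%G.
Let t := gal_index P_roots.
Let pt := pt cardF16 z4.
Hypothesis gal_SL2 : forall s, s \in G -> exists2 g, g \in SL2 F16 & forall i, pt g i = t s i.

Lemma gal_indexM s r i : t (s * r)%g i = t r (t s i).
Proof. by apply: alpha_inj; rewrite !gal_indexE galM ?memvf. Qed.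

Lemma root_PE x : root (map_poly (in_alg L) P) x = (x \in codom alpha).
Proof.
rewrite -(root_f P_roots) P_intE -map_poly_comp; congr (root _ x).
by apply: eq_map_poly => m; apply: (rmorph_int (in_alg L)).
Qed.

(** L is generated by the roots of P. *)
Lemma gal_index_faithful s r : t s =1 t r -> s = r.
Proof.
move=> eq_t; have fix_u x : x \in codom alpha -> (s * r^-1)%g x = x.
  case/codomP=> i ->; rewrite galM ?memvf // -(gal_indexE P_roots) -/(t s i) eq_t gal_indexE.
  by rewrite -galM ?memvf // mulgV gal_id.
case: splitL => rs Drs gen; apply/eqP; rewrite eq_mulgV1; apply/eqP/eqP.
have subL : ({:L} <= fixedField [set (s * r^-1)%g])%VS.
  rewrite -[X in (X <= _)%VS]gen; apply/Fadjoin_seqP; split; first exact: sub1v.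
  move=> x xs; apply/fixedFieldP; rewrite ?memvf // => u /set1P ->; apply: fix_u.
  by rewrite -root_PE (eqp_root Drs) root_prod_XsubC.
apply/gal_eqP => x _; rewrite gal_id.
by have /fixedFieldP := subvP subL x (memvf x); apply; rewrite ?memvf ?set11.
Qed.

Definition gal_perm s : {perm 'I_17} := perm (@gal_index_inj _ _ _ _ P_roots alpha_inj s).

Lemma gal_perm_group : group_set [set gal_perm s | s in G].
Proof.
apply/group_setP; split.
  apply/imsetP; exists 1%g; rewrite ?group1 //; apply/permP => i.
  by rewrite perm1 permE; apply: alpha_inj; rewrite gal_indexE gal_id.
move=> _ _ /imsetP[s Gs ->] /imsetP[r Gr ->]; apply/imsetP.
by exists (s * r)%g; rewrite ?groupM //; apply/permP => i; rewrite permM !permE; apply/esym/gal_indexM.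
Qed.

Lemma gal_permX s n : (gal_perm s ^+ n)%g =1 t (s ^+ n)%g.
Proof.
move=> i; rewrite permX [RHS](galX_index P_roots alpha_inj); elim: n => // n IHn.
by rewrite !iterS IHn permE.
Qed.

(** The group contains an element with the same effect as g on three points,
    and this element acts through SL2 as well. *)
Lemma SL2_gal g : g \in SL2 F16 -> exists2 s, s \in G & forall i, pt g i = t s i.
Proof.
move=> gSL; have [s Gs s17] := frobenius5 P_roots alpha_inj.
have [r Gr [i0 [i1 [ne01 r0 r1 r15 r35]]]] := frobenius7 P_roots alpha_inj.
have [i2 i20 i21] : exists2 i2, i2 != i0 & i2 != i1.
  have /set0Pn[i2] : ~: [set i0; i1] != set0.
    by rewrite -card_gt0 -(leq_add2l #|[set i0; i1]|) cardsC cards2 card_ord; case: (_ != _).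
  by rewrite !inE negb_or => /andP[]; exists i2.
have inH u : u \in G -> gal_perm u \in group gal_perm_group by move=> Gu; apply: imset_f.
have perm_eq1 u n : (forall i, t (u ^+ n)%g i = i) -> (gal_perm u ^+ n)%g = 1%g.
  by move=> u1; apply/permP => i; rewrite gal_permX u1 perm1.
have moved i : i != i0 -> i != i1 ->
    (gal_perm r ^+ 3)%g i != i /\ (gal_perm r ^+ 5)%g i != i.
  by rewrite !gal_permX; apply: r35.
have s_perm i : gal_perm s i != i by rewrite permE; have [] := s17 i.
have r_perm i : t r i = i -> gal_perm r i = i by rewrite permE.
have ne_pt i j : i != j -> pt g i != pt g j by rewrite (inj_eq (@pt_inj _ _ _ _ g)).
have [h /imsetP[u Gu ->] []] := transitive3 (inH s Gs) (inH r Gr) (card_ord 17)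
  (perm_eq1 s 17%N (fun i => proj1 (s17 i))) s_perm ne01 (r_perm _ r0) (r_perm _ r1)
  (perm_eq1 r 15%N r15) moved i20 i21 (ne_pt _ _ ne01)
  (ne_pt i0 i2 (contra_neq esym i20)) (ne_pt i1 i2 (contra_neq esym i21)).
rewrite !permE -!/(t u _) => u0 u1 u2; exists u => //.
have [g' g'SL Dg'] := gal_SL2 Gu.
suff -> : g = g' by [].
apply: (@pt_inj2 _ cardF16 z z4 g g' i0 i1 i2) => //.
- by rewrite eq_sym.
- by rewrite eq_sym.
- by rewrite -/pt Dg' u0.
- by rewrite -/pt Dg' u1.
- by rewrite -/pt Dg' u2.
Qed.

Lemma pt_faithful g h : g \in SL2 F16 -> h \in SL2 F16 -> pt g =1 pt h -> g = h.
Proof.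
move=> gSL hSL eq_gh.
by apply: (@pt_inj2 _ cardF16 z z4 g h (inord 0) (inord 1) (inord 2));
   rewrite -?val_eqE /= ?inordK //; apply: eq_gh.
Qed.

Definition gal_mx s : {'GL_2[F16]} :=
  odflt 1%g [pick g in SL2 F16 | [forall i, pt g i == t s i]].

Lemma gal_mxP s : s \in G -> gal_mx s \in SL2 F16 /\ forall i, pt (gal_mx s) i = t s i.
Proof.
move=> Gs; rewrite /gal_mx; case: pickP => [g /andP[gSL /forallP eq_gs] | none].
  by split=> // i; apply/eqP.
have [g gSL eq_gs] := gal_SL2 Gs; case/andP: (none g); split=> //.
by apply/forallP => i; rewrite eq_gs.
Qed.

Lemma root_index (r : roots_in L P) : {i | val r = alpha i}.
Proof. by apply/sig_eqW/codomP; rewrite -root_PE (valP r). Qed.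

Definition root_line (r : roots_in L P) := line z (sval (root_index r)).

Lemma root_line_bij : bijective root_line.
Proof.
have alpha_root i : root (map_poly (in_alg L) P) (alpha i) by rewrite root_PE codom_f.
have line_index U : {i : 'I_17 | U == line z i}.
  by apply: sigW; have [i ->] := line_surj cardF16 z4 U; exists i.
exists (fun U => exist _ (alpha (sval (line_index U))) (alpha_root _) : roots_in L P).
  move=> r; apply: val_inj; rewrite /= /root_line.
  case: root_index => i Di; case: line_index => j /= /eqP /(line_inj cardF16 z4) <-.
  by rewrite Di.
move=> U; rewrite /root_line; case: root_index => i /=.
by case: line_index => j /= /eqP -> /alpha_inj ->.
Qed.

Lemma galois_SL2 :
  exists (phi : gal_of {:L} -> {'GL_2[F16]})
         (b : roots_in L P -> projective_line F16),
    [/\ {in 'Gal({:L} / 1%VS)%g &, forall s t,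
           phi (gal_comp s t) = (phi s * phi t)%g},
        {in 'Gal({:L} / 1%VS)%g &, injective phi},
        phi @: 'Gal({:L} / 1%VS)%g = SL2 F16,
        bijective b
      & {in 'Gal({:L} / 1%VS)%g, forall s, forall r : roots_in L P,
           b (gal_act s r) = GL2_act (phi s) (b r)}].
Proof.
exists gal_mx, root_line; split.
- move=> s r Gs Gr; rewrite /gal_comp.
  have [sSL Ds] := gal_mxP Gs; have [rSL Dr] := gal_mxP Gr.
  have [|rsSL Drs] := @gal_mxP (r * s)%g; first exact: groupM.
  apply: pt_faithful => // [|i]; first exact: (@groupM _ (SL2_group F16)).
  by rewrite Drs gal_indexM /pt ptM -/pt Ds Dr.
- move=> s r Gs Gr eq_sr; apply: gal_index_faithful => i.
  by rewrite -(proj2 (gal_mxP Gs)) eq_sr (proj2 (gal_mxP Gr)).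
- apply/setP => g; apply/imsetP/idP => [[s Gs ->] | gSL].
    by case: (gal_mxP Gs).
  have [s Gs Ds] := SL2_gal gSL; exists s => //; have [sSL Dgs] := gal_mxP Gs.
  by apply: pt_faithful => // i; rewrite Ds Dgs.
- exact: root_line_bij.
move=> s Gs r; rewrite /root_line; case: (root_index r) => i Di /=.
rewrite (pt_line cardF16 z4) -/pt (proj2 (gal_mxP Gs)).
case: root_index => j /= Dj; suff -> : j = t s i by []; apply: alpha_inj.
by rewrite -Dj gal_indexE Di.
Qed.

End Conclusion.

Theorem proposition1
    (L : splittingFieldType rat)
    (splitL : splittingFieldFor 1%VS (map_poly (in_alg L) P) {:L})
    (F16 : finFieldType) (cardF16 : #|F16| = 16%N) :
  exists (phi : gal_of {:L} -> {'GL_2[F16]})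
         (b : roots_in L P -> projective_line F16),
    [/\ {in 'Gal({:L} / 1%VS)%g &, forall s t,
           phi (gal_comp s t) = (phi s * phi t)%g},
        {in 'Gal({:L} / 1%VS)%g &, injective phi},
        phi @: 'Gal({:L} / 1%VS)%g = SL2 F16,
        bijective b
      & {in 'Gal({:L} / 1%VS)%g, forall s, forall r : roots_in L P,
           b (gal_act s r) = GL2_act (phi s) (b r)}].
Proof.
have [K [p0 ker_zr]] := big_prime_field.
have [iota [alpha [y [P_roots Q_roots spec]]]] := matching_roots p0 ker_zr splitL.
have [z /eqP z4] := exists_generator cardF16.
have spec' := spec_alpha spec.
have alpha_inj := specializes_inj (P_root_mod_inj ker_zr) spec'.
have gal_SL2 s : s \in 'Gal({:L} / 1%VS)%G ->
    exists2 g, g \in SL2 F16 & forall i, pt cardF16 z4 g i = gal_index P_roots s i.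
  move=> Gs; apply: (gal_in_SL2 p0 ker_zr iota spec') => // r i j k l.
  exact: (concyclic_gal p0 ker_zr P_roots Q_roots spec).
exact (galois_SL2 alpha_inj splitL gal_SL2).
Qed.
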